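(* There exists $u\in\dot{\mathscr W}^{1,2}$ such that $\mathcal E(u)\le\mathcal E(v)$ for all $v\in\dot{\mathscr W}^{1,2}$.
   Context: Let $\mathsf R_6$ be rotation through $\pi/3$, $a_1=(1,0)^T$, $a_i=\mathsf R_6^{i-1}a_1$, $\Lambda:=(\tfrac12,\tfrac{\sqrt3}{6})^T+\{m a_1+n a_2:m,n\in\mathbb Z\}$. Bonds: $\mathcal B=\{(\xi,\eta)\in\Lambda^2:|\xi-\eta|=1\}$ (ordered pairs); $Dy_b=y(\eta)-y(\xi)$ for $b=(\xi,\eta)$. Let $\xi_0=(0,\sqrt3/3)^T$, $\mathscr W_0=\{v:\Lambda\to\mathbb R: v(\xi_0)=0,\ \{b:Dv_b\neq0\}\text{ bounded}\}$, and $\dot{\mathscr W}^{1,2}=\{v:\Lambda\to\mathbb R: v(\xi_0)=0,\ Dv\in\ell^2(\mathcal B)\}$ with norm $\|Dv\|_2=(\sum_{b\in\mathcal B}|Dv_b|^2)^{1/2}$ ($\mathscr W_0$ is dense in it). The potential $\psi\in C(\mathbb R)\cap C^4(\mathbb R\setminus(\mathbb Z+\tfrac12))$ satisfies: ($\psi$1) 1-periodic; ($\psi$2) $\psi$ and $\psi(\tfrac12+\cdot)$ even; ($\psi$3) $\psi(r)=0$ iff $r\in\mathbb Z$; ($\psi$4) $\psi''(0)=\mu>0$; ($\psi$5) $\psi(x)\ge\tfrac12\psi''(0)x^2$ for $x\in[-\tfrac12,\tfrac12]$. Let $\hat y(x)=\frac1{2\pi}\arg(x)$ (identifying $x$ with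 $x_1+ix_2$, branch cut along the positive $x_1$-axis), restricted to $\Lambda$. For $u\in\mathscr W_0$ set $\mathcal E(u):=\sum_{b\in\mathcal B}[\psi(D\hat y_b+Du_b)-\psi(D\hat y_b)]$ (a finite sum); $\mathcal E$ is continuous on $\mathscr W_0$ with respect to $\|D\cdot\|_2$ and $\mathcal E$ on $\dot{\mathscr W}^{1,2}$ denotes its unique continuous extension.
   Formalization: The normalisation point ξ₀=(0,√3/3) does not lie in Λ, so v(ξ₀) is undefined; the formal statement normalises at the lattice point (0,−√3/3) instead, which does not matter since the energy depends only on Dv. *)

(* Defs.v *)
From Stdlib Require Import Reals Lra List.
From Coquelicot Require Import Coquelicot.
Open Scope R_scope.

Definition vec := (R * R)%type.
Definition vadd (x y : vec) : vec := (fst x + fst y, snd x + snd y).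
Definition vsub (x y : vec) : vec := (fst x - fst y, snd x - snd y).
Definition vscal (c : R) (x : vec) : vec := (c * fst x, c * snd x).
Definition vnorm (x : vec) : R := sqrt (fst x ^ 2 + snd x ^ 2).

Definition R6 (x : vec) : vec :=
  (cos (PI / 3) * fst x - sin (PI / 3) * snd x,
   sin (PI / 3) * fst x + cos (PI / 3) * snd x).
Definition a1 : vec := (1, 0).
Definition a2 : vec := R6 a1.

(* The lattice Lambda is parametrized by Z x Z:
   site (m,n) is (1/2, sqrt3/6) + m a1 + n a2 (injective parametrization). *)
Definition site := (Z * Z)%type.
Definition pos (p : site) : vec :=
  vadd (vadd (1/2, sqrt 3 / 6) (vscal (IZR (fst p)) a1)) (vscal (IZR (snd p)) a2).

Definition bond (p q : site) : Prop := vnorm (vsub (pos p) (pos q)) = 1.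

(* normalisation site: the lattice point (0, -sqrt3/3) *)
Definition xi0 : site := (0%Z, (-1)%Z).

Definition D (v : site -> R) (p q : site) : R := v q - v p.

Definition bond_list (l : list (site * site)) : Prop :=
  NoDup l /\ List.Forall (fun b => bond (fst b) (snd b)) l.

Fixpoint sumsq (g : site -> site -> R) (l : list (site * site)) : R :=
  match l with
  | nil => 0
  | b :: l' => (g (fst b) (snd b)) ^ 2 + sumsq g l'
  end.

Definition partial_sq_sums (g : site -> site -> R) (x : R) : Prop :=
  exists l, bond_list l /\ x = sumsq g l.

Definition in_l2 (g : site -> site -> R) : Prop :=
  exists C, forall x, partial_sq_sums g x -> x <= C.

(* ||g||_2 = (sum over bonds of |g_b|^2)^(1/2), the sum of a nonnegative family
   being the supremum of its finite partial sums *)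
Definition l2norm (g : site -> site -> R) : R :=
  sqrt (real (Lub_Rbar (partial_sq_sums g))).

Definition W0 (v : site -> R) : Prop :=
  v xi0 = 0 /\
  exists Rb, forall p q, bond p q -> D v p q <> 0 ->
    vnorm (pos p) <= Rb /\ vnorm (pos q) <= Rb.

Definition W12 (v : site -> R) : Prop := v xi0 = 0 /\ in_l2 (D v).

(* argument in [0, 2*pi), branch cut along the positive x1-axis *)
Definition arg (x : vec) : R :=
  if Rle_dec 0 (snd x) then acos (fst x / vnorm x)
  else 2 * PI - acos (fst x / vnorm x).

Definition yhat (p : site) : R := arg (pos p) / (2 * PI).

Definition bond_energy (psi : R -> R) (u : site -> R) (p q : site) : R :=
  psi (D yhat p q + D u p q) - psi (D yhat p q).

(* E(u) for u in W0: the (finite) sum over all bonds; bonds with Du_b = 0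
   contribute 0, so it is the sum over any finite duplicate-free list of bonds
   containing every bond with Du_b <> 0. *)
Fixpoint sum_list (f : site -> site -> R) (l : list (site * site)) : R :=
  match l with
  | nil => 0
  | b :: l' => f (fst b) (snd b) + sum_list f l'
  end.

Definition E0_value (psi : R -> R) (u : site -> R) (e : R) : Prop :=
  exists l, bond_list l /\
    (forall p q, bond p q -> D u p q <> 0 -> In (p, q) l) /\
    e = sum_list (bond_energy psi u) l.

(* L is the value at u of the continuous extension of E from W0 to W^{1,2}:
   E(w) -> L as w -> u in W0 w.r.t. ||D.||_2 *)
Definition E_ext_value (psi : R -> R) (u : site -> R) (L : R) : Prop :=
  forall eps, 0 < eps -> exists delta, 0 < delta /\
    forall w, W0 w -> l2norm (fun p q => D w p q - D u p q) < delta ->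
      forall e, E0_value psi w e -> Rabs (e - L) < eps.

Definition half_integer (x : R) : Prop := exists k : Z, x = IZR k + 1/2.

Definition psi_hyp (psi : R -> R) : Prop :=
  (forall x, continuous psi x) /\
  (forall x, ~ half_integer x ->
     (forall k, (k <= 4)%nat -> ex_derive_n psi k x) /\
     continuous (Derive_n psi 4) x) /\
  (forall x, psi (x + 1) = psi x) /\
  (forall x, psi (- x) = psi x) /\
  (forall x, psi (1/2 + - x) = psi (1/2 + x)) /\
  (forall r, psi r = 0 <-> exists k : Z, r = IZR k) /\
  0 < Derive_n psi 2 0 /\
  (forall x, -1/2 <= x <= 1/2 -> psi x >= 1/2 * Derive_n psi 2 0 * x ^ 2).

(* Main.v *)
From Stdlib Require Import Reals Lra Lia Psatz ZArith List Permutation Classical ClassicalEpsilon Cantor.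
From Coquelicot Require Import Coquelicot.
Require Import Defs.
Import ListNotations.
Open Scope R_scope.

(** Reducing the bond differences of y = yhat + u modulo 1 gives strains in [-1/2,1/2] whose circulation
    around each lattice triangle is a charge in {-1,0,1}; the charges are finitely many, of total 1.

    The reference strain differs by a field in l2 from c, the rotated gradient of -A log|x| at triangle centres.
    As c is orthogonal to gradients, the energy becomes an absolutely convergent, l2-continuous sum.

    Coercivity modulo lattice symmetries: for a rotated gradient j of a function h of the distance to a charge z,
    the energy is bounded below by |strain - j|^2 - |c_z - j|^2 + 2 sum_f q_f h_f.  Taking h with h' = -A/r on the
    radii where the disc around z has charge >= 1 and h' = 0 elsewhere, the last sum is nonnegative and the middle
    term is A times the logarithmic measure of the bad radii.  A single-linkage clustering of the charges
    yields a centre z for which this loss is less than the energy 1/3 or 1/6 that each charge contributes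
    to |strain - j|^2.  Hence the number of charges is bounded, and after moving z to the origin the strain is at
    bounded l2 distance from the reference strain.  A charge of a field of bounded energy lies in a neutral box
    of bounded size (otherwise its circulation along concentric boxes costs a divergent harmonic sum), so adding
    boundedly many integers makes the difference a gradient.  Minimising sequences are therefore bounded
    up to symmetries, and the energy is lower semicontinuous under pointwise convergence by Fatou. *)

(** * Finite and unordered sums *)

(** The direct method is obstructed by the periodicity of [psi]: the energy controls [Du] only
    modulo integers, so a minimising sequence may carry the dislocation off to infinity or create
    dipoles. Escape is undone by translations and point reflections, which act transitively on
    triangles and preserve orientation, hence charges. Dipoles are controlled by a competition of
    constants. A charge costs 1/3 by Cauchy-Schwarz on the three bonds of its triangle; adjacent
    charges share a bond and are counted with weight 1/2, which gives 1/6. Conversely, dropping [d]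
    charges from a cluster can multiply the outer bad radius by [1 + d], at price [A ln (1 + d)],
    where A = sqrt 3 / (2 PI) is the value for which the rotated gradient of [- A log |x|] agrees
    with the angular strain to leading order. The balance closes because A ln (1 + d) <= 0.98 d / 6
    for d >= 2 and A ln 2 <= 0.98 / 3. A single dropped charge needs the full weight, which is why
    isolated charges are told apart from adjacent ones. *)

Fixpoint lsum {A : Type} (f : A -> R) (l : list A) : R :=
  match l with
  | nil => 0
  | a :: l' => f a + lsum f l'
  end.

Lemma lsum_app {A} (f : A -> R) l l' : lsum f (l ++ l') = lsum f l + lsum f l'.
Proof. induction l as [|a l IH]; simpl; lra. Qed.

Lemma lsum_plus {A} (f g : A -> R) l :
  lsum (fun a => f a + g a) l = lsum f l + lsum g l.
Proof. induction l as [|a l IH]; simpl; lra. Qed.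

Lemma lsum_scal {A} c (f : A -> R) l : lsum (fun a => c * f a) l = c * lsum f l.
Proof. induction l as [|a l IH]; simpl; lra. Qed.

Lemma lsum_minus {A} (f g : A -> R) l :
  lsum (fun a => f a - g a) l = lsum f l - lsum g l.
Proof. induction l as [|a l IH]; simpl; lra. Qed.

Lemma lsum_const {A} c (l : list A) : lsum (fun _ => c) l = c * INR (length l).
Proof. induction l as [|a l IH]; simpl length; simpl lsum; [simpl; lra|]. rewrite S_INR, IH. lra. Qed.

Lemma lsum_le {A} (f g : A -> R) l :
  (forall a, In a l -> f a <= g a) -> lsum f l <= lsum g l.
Proof.
  induction l as [|a l IH]; simpl; intros H; [lra|].
  apply Rplus_le_compat; auto.
Qed.

Lemma lsum_ext {A} (f g : A -> R) l :
  (forall a, In a l -> f a = g a) -> lsum f l = lsum g l.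
Proof. intros H; apply Rle_antisym; apply lsum_le; intros; rewrite H; auto; lra. Qed.

Lemma lsum_0 {A} (f : A -> R) l : (forall a, In a l -> f a = 0) -> lsum f l = 0.
Proof.
  intros H. rewrite (lsum_ext f (fun _ => 0)), lsum_const; auto; lra.
Qed.

Lemma lsum_nonneg {A} (f : A -> R) l : (forall a, In a l -> 0 <= f a) -> 0 <= lsum f l.
Proof.
  intros H. rewrite <- (lsum_0 (fun _ : A => 0) l) by auto. now apply lsum_le.
Qed.

Lemma lsum_abs {A} (f : A -> R) l : Rabs (lsum f l) <= lsum (fun a => Rabs (f a)) l.
Proof.
  induction l as [|a l IH]; simpl; [rewrite Rabs_R0; lra|].
  eapply Rle_trans; [apply Rabs_triang|]. lra.
Qed.

Lemma lsum_map {A B} (s : A -> B) (f : B -> R) l :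
  lsum f (map s l) = lsum (fun a => f (s a)) l.
Proof. induction l as [|a l IH]; simpl; lra. Qed.

Lemma lsum_perm {A} (f : A -> R) l l' : Permutation l l' -> lsum f l = lsum f l'.
Proof. induction 1; simpl; lra. Qed.

Lemma lsum_flat_map {A B} (s : A -> list B) (f : B -> R) l :
  lsum f (flat_map s l) = lsum (fun a => lsum f (s a)) l.
Proof. induction l as [|a l IH]; simpl; [lra|]. rewrite lsum_app; lra. Qed.

Lemma lsum_list_prod {A B} (f : A * B -> R) la lb :
  lsum f (list_prod la lb) = lsum (fun a => lsum (fun b => f (a, b)) lb) la.
Proof.
  induction la as [|a la IH]; simpl; [lra|].
  rewrite lsum_app, lsum_map, IH. lra.
Qed.

Lemma incl_perm_app {A} (l l' : list A) :
  NoDup l -> incl l l' -> exists r, Permutation l' (l ++ r).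
Proof.
  revert l'. induction l as [|a l IH]; intros l' Hn Hi.
  - exists l'. apply Permutation_refl.
  - inversion Hn as [|? ? Hna Hnl]; subst.
    destruct (in_split a l') as (l1 & l2 & ->); [apply Hi; now left|].
    destruct (IH (l1 ++ l2)) as (r & Hr); auto.
    + intros x Hx. assert (Hx' : In x (l1 ++ a :: l2)) by (apply Hi; now right).
      apply in_app_iff in Hx'. apply in_app_iff. destruct Hx' as [|[->|]]; auto. contradiction.
    + exists r. simpl. apply Permutation_trans with (a :: l1 ++ l2).
      * apply Permutation_sym, Permutation_middle.
      * now constructor.
Qed.

Lemma lsum_incl_gen {A} (f : A -> R) l l' :
  NoDup l -> NoDup l' -> incl l l' -> (forall a, In a l' -> ~ In a l -> 0 <= f a) ->
  lsum f l <= lsum f l'.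
Proof.
  intros Hn Hn' Hi Hf. destruct (incl_perm_app l l' Hn Hi) as (r & Hr).
  rewrite (lsum_perm f _ _ Hr), lsum_app.
  assert (0 <= lsum f r); [|lra].
  assert (Hnr : NoDup (l ++ r)) by (eapply Permutation_NoDup; eauto).
  apply lsum_nonneg. intros a Ha. apply Hf.
  - eapply Permutation_in; [apply Permutation_sym; eauto|]. apply in_app_iff; auto.
  - intros Hal. clear - Hnr Ha Hal. induction l as [|b l IH]; simpl in *; [tauto|].
    inversion Hnr; subst. destruct Hal as [->|]; auto.
    apply H1. apply in_app_iff; auto.
Qed.

Lemma lsum_incl {A} (f : A -> R) l l' :
  NoDup l -> incl l l' -> (forall a, 0 <= f a) -> lsum f l <= lsum f l'.
Proof.
  intros Hn Hi Hf. destruct (incl_perm_app l l' Hn Hi) as (r & Hr).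
  rewrite (lsum_perm f _ _ Hr), lsum_app.
  assert (0 <= lsum f r); [|lra]. apply lsum_nonneg; auto.
Qed.

Lemma lsum_incl_neg {A} (f : A -> R) l l' :
  NoDup l -> NoDup l' -> incl l l' -> (forall a, In a l' -> ~ In a l -> f a <= 0) ->
  lsum f l' <= lsum f l.
Proof.
  intros Hn Hn' Hi Hf.
  assert (H := lsum_incl_gen (fun a => -1 * f a) l l' Hn Hn' Hi).
  rewrite !lsum_scal in H. assert (-1 * lsum f l <= -1 * lsum f l'); [|lra].
  apply H. intros a H1 H2. specialize (Hf a H1 H2). lra.
Qed.

Lemma lsum_incl_eq {A} (f : A -> R) l l' :
  NoDup l -> NoDup l' -> incl l l' -> (forall a, In a l' -> ~ In a l -> f a = 0) ->
  lsum f l = lsum f l'.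
Proof.
  intros Hn Hn' Hi Hf. apply Rle_antisym.
  - apply lsum_incl_gen; auto. intros a H1 H2; rewrite Hf; auto; lra.
  - apply lsum_incl_neg; auto. intros a H1 H2; rewrite Hf; auto; lra.
Qed.

Definition site_eq_dec (p q : site) : {p = q} + {p <> q}.
Proof. decide equality; apply Z.eq_dec. Defined.

Definition lunion (l l' : list site) : list site := nodup site_eq_dec (l ++ l').

Lemma lunion_NoDup l l' : NoDup (lunion l l').
Proof. apply NoDup_nodup. Qed.
Lemma lunion_l l l' : incl l (lunion l l').
Proof. intros x Hx. apply nodup_In, in_app_iff; auto. Qed.
Lemma lunion_r l l' : incl l' (lunion l l').
Proof. intros x Hx. apply nodup_In, in_app_iff; auto. Qed.

Lemma lsum_supp_eq (f : site -> R) l l' :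
  NoDup l -> NoDup l' -> (forall a, f a <> 0 -> In a l) -> (forall a, f a <> 0 -> In a l') ->
  lsum f l = lsum f l'.
Proof.
  intros H1 H2 H3 H4.
  rewrite (lsum_incl_eq f l (lunion l l')), (lsum_incl_eq f l' (lunion l l')); auto using lunion_NoDup, lunion_l, lunion_r;
  intros a _ Ha; destruct (Req_dec (f a) 0); auto; exfalso; auto.
Qed.

(** Convergence along the net of finite duplicate-free lists, so that reindexing by a bijection of
    sites and exhaustion by boxes need no separate theory of order. *)
Definition has_sum (f : site -> R) (S : R) : Prop :=
  forall eps, 0 < eps -> exists l0,
    forall l, NoDup l -> incl l0 l -> Rabs (lsum f l - S) < eps.

Definition summable (f : site -> R) : Prop :=
  exists C, forall l, NoDup l -> lsum (fun p => Rabs (f p)) l <= C.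

Lemma has_sum_unique f S S' : has_sum f S -> has_sum f S' -> S = S'.
Proof.
  intros H H'. destruct (Req_dec S S') as [|Hne]; auto. exfalso.
  assert (Hp : 0 < Rabs (S - S') / 2). { assert (0 < Rabs (S - S')) by (apply Rabs_pos_lt; lra). lra. }
  destruct (H _ Hp) as (l & Hl). destruct (H' _ Hp) as (l' & Hl').
  specialize (Hl (lunion l l') (lunion_NoDup _ _) (lunion_l _ _)).
  specialize (Hl' (lunion l l') (lunion_NoDup _ _) (lunion_r _ _)).
  revert Hl Hl' Hp. unfold Rabs. repeat destruct Rcase_abs; lra.
Qed.

Lemma has_sum_plus f g S S' : has_sum f S -> has_sum g S' -> has_sum (fun p => f p + g p) (S + S').
Proof.
  intros H H' eps He. destruct (H (eps/2)) as (l & Hl); [lra|]. destruct (H' (eps/2)) as (l' & Hl'); [lra|].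
  exists (l ++ l'). intros k Hk Hi. rewrite lsum_plus.
  specialize (Hl k Hk (fun x Hx => Hi x (in_or_app _ _ _ (or_introl Hx)))).
  specialize (Hl' k Hk (fun x Hx => Hi x (in_or_app _ _ _ (or_intror Hx)))).
  revert Hl Hl'. unfold Rabs. repeat destruct Rcase_abs; lra.
Qed.

Lemma has_sum_scal c f S : has_sum f S -> has_sum (fun p => c * f p) (c * S).
Proof.
  intros H eps He. destruct (H (eps / (Rabs c + 1))) as (l & Hl).
  { apply Rdiv_lt_0_compat; auto. pose proof (Rabs_pos c); lra. }
  exists l. intros k Hk Hi. specialize (Hl k Hk Hi). rewrite lsum_scal.
  replace (c * lsum f k - c * S) with (c * (lsum f k - S)) by ring. rewrite Rabs_mult.
  pose proof (Rabs_pos c). pose proof (Rabs_pos (lsum f k - S)).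
  apply Rle_lt_trans with ((Rabs c + 1) * Rabs (lsum f k - S) - Rabs (lsum f k - S)); [lra|].
  apply (Rmult_lt_compat_l (Rabs c + 1)) in Hl; [|lra].
  replace ((Rabs c + 1) * (eps / (Rabs c + 1))) with eps in Hl by (field; lra). lra.
Qed.

Lemma has_sum_ext f g S : (forall p, f p = g p) -> has_sum f S -> has_sum g S.
Proof.
  intros H Hf eps He. destruct (Hf eps He) as (l & Hl). exists l. intros k Hk Hi.
  rewrite <- (lsum_ext f g); auto.
Qed.

Lemma has_sum_nonneg_ex f : (forall p, 0 <= f p) -> summable f ->
  exists S, has_sum f S /\ forall l, NoDup l -> lsum f l <= S.
Proof.
  intros Hf (C & HC).
  destruct (completeness (fun x => exists l, NoDup l /\ x = lsum f l)) as (S & HS1 & HS2).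
  - exists C. intros x (l & Hl & ->). eapply Rle_trans; [|apply (HC l Hl)].
    apply lsum_le. intros; apply Rle_abs.
  - exists 0, nil. split; [constructor|reflexivity].
  - exists S. split; [|intros l Hl; apply HS1; eauto].
    intros eps He.
    destruct (classic (exists l, NoDup l /\ S - eps < lsum f l)) as [(l & Hl & Hlt)|Hno].
    + exists l. intros k Hk Hi.
      assert (lsum f l <= lsum f k) by (apply lsum_incl; auto).
      assert (lsum f k <= S) by (apply HS1; eauto).
      unfold Rabs; destruct Rcase_abs; lra.
    + exfalso. assert (S <= S - eps); [|lra].
      apply HS2. intros x (l & Hl & ->). apply Rnot_lt_le. intros Hlt. apply Hno; eauto.
Qed.

Lemma summable_le f g : (forall p, Rabs (f p) <= g p) -> summable g -> summable f.
Proof.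
  intros H (C & HC). exists C. intros l Hl. eapply Rle_trans; [|apply (HC l Hl)].
  apply lsum_le. intros p _. eapply Rle_trans; [apply H|]. apply Rle_abs.
Qed.

Lemma summable_plus f g : summable f -> summable g -> summable (fun p => f p + g p).
Proof.
  intros (C & HC) (C' & HC'). exists (C + C'). intros l Hl.
  apply Rle_trans with (lsum (fun p => Rabs (f p) + Rabs (g p)) l).
  - apply lsum_le; intros; apply Rabs_triang.
  - rewrite lsum_plus. specialize (HC l Hl). specialize (HC' l Hl). lra.
Qed.

Lemma summable_scal c f : summable f -> summable (fun p => c * f p).
Proof.
  intros (C & HC). exists (Rabs c * C). intros l Hl.
  rewrite (lsum_ext _ (fun p => Rabs c * Rabs (f p))) by (intros; apply Rabs_mult).
  rewrite lsum_scal. apply Rmult_le_compat_l; auto using Rabs_pos.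
Qed.

Lemma summable_ext f g : (forall p, f p = g p) -> summable f -> summable g.
Proof.
  intros H (C & HC). exists C. intros l Hl. rewrite <- (lsum_ext (fun p => Rabs (f p))); auto.
  intros; now rewrite H.
Qed.

Lemma summable_abs f : summable f -> summable (fun p => Rabs (f p)).
Proof.
  intros (C & HC). exists C. intros l Hl. rewrite (lsum_ext _ (fun p => Rabs (f p))); auto.
  intros; apply Rabs_Rabsolu.
Qed.

Lemma summable_minus f g : summable f -> summable g -> summable (fun p => f p - g p).
Proof.
  intros Hf Hg. apply summable_ext with (fun p => f p + -1 * g p); [intros; ring|].
  apply summable_plus; auto using summable_scal.
Qed.

(** Writes [f] as [(|f| + f) - |f|], a difference of nonnegative families whose sums are suprema of
    finite sums. *)
Lemma summable_has_sum f : summable f -> exists S, has_sum f S.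
Proof.
  intros Hf.
  destruct (has_sum_nonneg_ex (fun p => Rabs (f p))) as (S1 & H1 & _); auto using Rabs_pos, summable_abs.
  destruct (has_sum_nonneg_ex (fun p => Rabs (f p) + f p)) as (S2 & H2 & _).
  - intros p. unfold Rabs; destruct Rcase_abs; lra.
  - apply summable_plus; auto using summable_abs.
  - exists (S2 + -1 * S1). apply has_sum_ext with (fun p => (Rabs (f p) + f p) + -1 * Rabs (f p)).
    + intros; ring.
    + apply has_sum_plus; auto using has_sum_scal.
Qed.

Definition Tsum (f : site -> R) : R := epsilon (inhabits 0) (has_sum f).

Lemma Tsum_correct f : summable f -> has_sum f (Tsum f).
Proof. intros H. unfold Tsum. apply (epsilon_spec (inhabits 0) (has_sum f)). now apply summable_has_sum. Qed.

Lemma Tsum_unique f S : has_sum f S -> Tsum f = S.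
Proof.
  intros H. eapply has_sum_unique; eauto. unfold Tsum.
  apply (epsilon_spec (inhabits 0) (has_sum f)). eauto.
Qed.

Lemma Tsum_ext f g : (forall p, f p = g p) -> Tsum f = Tsum g.
Proof.
  intros H. assert (f = g) as ->; auto. apply FunctionalExtensionality.functional_extensionality; auto.
Qed.

Lemma Tsum_plus f g : summable f -> summable g -> Tsum (fun p => f p + g p) = Tsum f + Tsum g.
Proof. intros. apply Tsum_unique, has_sum_plus; now apply Tsum_correct. Qed.

Lemma Tsum_scal c f : summable f -> Tsum (fun p => c * f p) = c * Tsum f.
Proof. intros. apply Tsum_unique, has_sum_scal; now apply Tsum_correct. Qed.

Lemma Tsum_minus f g : summable f -> summable g -> Tsum (fun p => f p - g p) = Tsum f - Tsum g.
Proof.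
  intros. rewrite (Tsum_ext _ (fun p => f p + -1 * g p)) by (intros; ring).
  rewrite Tsum_plus, Tsum_scal; auto using summable_scal. ring.
Qed.

Lemma Tsum_ge f l B : summable f -> (forall k, NoDup k -> incl l k -> B <= lsum f k) -> B <= Tsum f.
Proof.
  intros Hf H. apply Rnot_lt_le. intros Hlt.
  destruct (Tsum_correct f Hf (B - Tsum f)) as (l0 & Hl0); [lra|].
  specialize (Hl0 (lunion l l0) (lunion_NoDup _ _) (lunion_r _ _)).
  specialize (H (lunion l l0) (lunion_NoDup _ _) (lunion_l _ _)).
  revert Hl0. unfold Rabs; destruct Rcase_abs; lra.
Qed.

Lemma Tsum_le_bound f l B : summable f -> (forall k, NoDup k -> incl l k -> lsum f k <= B) -> Tsum f <= B.
Proof.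
  intros Hf H. assert (- B <= -1 * Tsum f); [|lra].
  rewrite <- Tsum_scal by auto. apply (Tsum_ge _ l).
  - now apply summable_scal.
  - intros k Hk Hi. rewrite lsum_scal. specialize (H k Hk Hi). lra.
Qed.

Lemma Tsum_le f g : summable f -> summable g -> (forall p, f p <= g p) -> Tsum f <= Tsum g.
Proof.
  intros Hf Hg H. assert (0 <= Tsum (fun p => g p - f p)).
  - apply (Tsum_ge _ nil); auto using summable_minus. intros k _ _. apply lsum_nonneg.
    intros p _. specialize (H p); lra.
  - rewrite Tsum_minus in H0; auto. lra.
Qed.

Lemma lsum_le_Tsum f l : summable f -> (forall p, 0 <= f p) -> NoDup l -> lsum f l <= Tsum f.
Proof.
  intros Hf H Hl. apply (Tsum_ge f l); auto. intros k Hk Hi. now apply lsum_incl.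
Qed.

Lemma summable_fin f l : (forall p, f p <> 0 -> In p l) -> summable f.
Proof.
  intros H. exists (lsum (fun p => Rabs (f p)) (nodup site_eq_dec l)). intros k Hk.
  rewrite (lsum_incl_eq _ (nodup site_eq_dec l) (lunion (nodup site_eq_dec l) k)).
  - apply lsum_incl; auto using Rabs_pos, lunion_r.
  - apply NoDup_nodup.
  - apply lunion_NoDup.
  - apply lunion_l.
  - intros a _ Ha. destruct (Req_dec (f a) 0) as [->|Hne]; [apply Rabs_R0|].
    exfalso. apply Ha, nodup_In; auto.
Qed.

Lemma Tsum_fin f l : NoDup l -> (forall p, f p <> 0 -> In p l) -> Tsum f = lsum f l.
Proof.
  intros Hl H. apply Tsum_unique. intros eps He. exists l. intros k Hk Hi.
  rewrite (lsum_incl_eq f l k); auto.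
  - rewrite Rminus_diag, Rabs_R0; auto.
  - intros a _ Ha. destruct (Req_dec (f a) 0); auto. exfalso; auto.
Qed.

Lemma has_sum_bij f S (s s' : site -> site) : (forall p, s (s' p) = p) -> (forall p, s' (s p) = p) ->
  has_sum f S -> has_sum (fun p => f (s p)) S.
Proof.
  intros H1 H2 Hf eps He. destruct (Hf eps He) as (l & Hl). exists (map s' l). intros k Hk Hi.
  rewrite <- (lsum_map s f). apply Hl.
  - apply FinFun.Injective_map_NoDup; auto. intros x y Hxy. now rewrite <- (H2 x), Hxy, H2.
  - intros x Hx. apply in_map_iff. exists (s' x). split; auto. apply Hi. now apply in_map.
Qed.

Lemma summable_bij f (s s' : site -> site) : (forall p, s' (s p) = p) ->
  summable f -> summable (fun p => f (s p)).
Proof.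
  intros H2 (C & HC). exists C. intros l Hl.
  rewrite <- (lsum_map s (fun p => Rabs (f p))). apply HC.
  apply FinFun.Injective_map_NoDup; auto. intros x y Hxy. now rewrite <- (H2 x), Hxy, H2.
Qed.

Lemma Tsum_bij f (s s' : site -> site) : (forall p, s (s' p) = p) -> (forall p, s' (s p) = p) ->
  summable f -> Tsum (fun p => f (s p)) = Tsum f.
Proof.
  intros H1 H2 Hf. apply Tsum_unique. eapply has_sum_bij; eauto. now apply Tsum_correct.
Qed.

Lemma Tsum_tail f eps : summable f -> 0 < eps ->
  exists l0, NoDup l0 /\ forall l, NoDup l -> (forall p, In p l -> ~ In p l0) ->
    lsum (fun p => Rabs (f p)) l <= eps.
Proof.
  intros Hf He. destruct (Tsum_correct _ (summable_abs _ Hf) (eps/2)) as (l0 & Hl0); [lra|].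
  exists (nodup site_eq_dec l0). split; [apply NoDup_nodup|]. intros l Hl Hd.
  assert (Hi : incl l0 (nodup site_eq_dec l0)) by (intros x Hx; apply nodup_In; auto).
  assert (A := Hl0 _ (NoDup_nodup _ _) Hi).
  assert (HN : NoDup (l ++ nodup site_eq_dec l0)).
  { apply NoDup_app; auto. apply NoDup_nodup. }
  assert (B := Hl0 _ HN (fun x Hx => in_or_app _ _ _ (or_intror (Hi x Hx)))).
  rewrite lsum_app in B. apply Rabs_def2 in A. apply Rabs_def2 in B. lra.
Qed.

(** * Boxes *)

Definition zr (N : nat) : list Z := map (fun k => (Z.of_nat k - Z.of_nat N)%Z) (seq 0 (2 * N + 1)).

Lemma in_zr N m : In m (zr N) <-> (Z.abs m <= Z.of_nat N)%Z.
Proof.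
  unfold zr. rewrite in_map_iff. split.
  - intros (k & <- & Hk). apply in_seq in Hk. lia.
  - intros H. exists (Z.to_nat (m + Z.of_nat N)). split; [lia|]. apply in_seq. lia.
Qed.

Lemma zr_NoDup N : NoDup (zr N).
Proof. apply FinFun.Injective_map_NoDup; [|apply seq_NoDup]. intros x y H. cbv beta in H. lia. Qed.

Definition box (N : nat) : list site := list_prod (zr N) (zr N).

Lemma in_box N p : In p (box N) <-> (Z.abs (fst p) <= Z.of_nat N /\ Z.abs (snd p) <= Z.of_nat N)%Z.
Proof.
  destruct p as [m n]. pose proof (in_prod_iff (zr N) (zr N) m n) as H. rewrite !in_zr in H. exact H.
Qed.

Lemma NoDup_list_prod {A B} (l : list A) (l' : list B) : NoDup l -> NoDup l' -> NoDup (list_prod l l').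
Proof.
  intros Hl Hl'. induction l as [|a l IH]; simpl; [constructor|].
  inversion Hl; subst. apply NoDup_app; auto.
  - apply FinFun.Injective_map_NoDup; auto. intros x y; congruence.
  - intros [x y] Hx Hy. apply in_map_iff in Hx. destruct Hx as (z & Hz & _). inversion Hz; subst.
    apply in_prod_iff in Hy. tauto.
Qed.

Lemma box_NoDup N : NoDup (box N).
Proof. apply NoDup_list_prod; apply zr_NoDup. Qed.

Lemma length_box N : INR (length (box N)) = (2 * INR N + 1) ^ 2.
Proof.
  unfold box, site. rewrite length_prod. unfold zr. rewrite length_map, length_seq.
  rewrite mult_INR, plus_INR, mult_INR. simpl; ring.
Qed.

Lemma box_incl N M : (N <= M)%nat -> incl (box N) (box M).
Proof. intros H p Hp. apply in_box in Hp. apply in_box. lia. Qed.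

Lemma in_some_box (l : list site) : exists N, incl l (box N).
Proof.
  induction l as [|[m n] l (N & HN)].
  - exists O. intros x [].
  - exists (N + Z.to_nat (Z.abs m) + Z.to_nat (Z.abs n))%nat. intros x [<-|Hx].
    + apply in_box; simpl; lia.
    + eapply box_incl; [|apply HN; auto]. lia.
Qed.

Lemma Tsum_box_lim f eps : summable f -> 0 < eps ->
  exists N0, forall N, (N0 <= N)%nat -> Rabs (lsum f (box N) - Tsum f) < eps.
Proof.
  intros Hf He. destruct (Tsum_correct f Hf eps He) as (l0 & Hl0).
  destruct (in_some_box l0) as (N0 & HN0). exists N0. intros N HN. apply Hl0; [apply box_NoDup|].
  intros x Hx. eapply box_incl; eauto.
Qed.

(** * The weight measuring distance from the origin, and its summable powers *)

Definition w (p : site) : R := 1 + Rabs (IZR (fst p)) + Rabs (IZR (snd p)).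

Lemma w_ge1 p : 1 <= w p.
Proof. unfold w. pose proof (Rabs_pos (IZR (fst p))). pose proof (Rabs_pos (IZR (snd p))). lra. Qed.

Lemma w_pos p : 0 < w p.
Proof. pose proof (w_ge1 p); lra. Qed.

Lemma w_out_box N p : ~ In p (box N) -> INR N < w p.
Proof.
  intros H. rewrite in_box in H. unfold w. rewrite INR_IZR_INZ, <- !abs_IZR.
  rewrite <- !plus_IZR. apply IZR_lt. lia.
Qed.

Lemma lsum_inv_sq_seq n k : lsum (fun j => / (INR j + 1) ^ 2) (seq (S k) n) <= / (INR k + 1) - / (INR k + INR n + 1).
Proof.
  revert k. induction n as [|n IH]; intros k; cbn [seq lsum].
  - simpl INR. right. rewrite Rplus_0_r. ring.
  - specialize (IH (S k)). rewrite !S_INR in *. pose proof (pos_INR k). pose proof (pos_INR n).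
    replace (INR k + 1 + INR n + 1) with (INR k + (INR n + 1) + 1) in IH by ring.
    assert (/ (INR k + 1 + 1) ^ 2 <= / (INR k + 1) - / (INR k + 1 + 1)).
    { replace (/ (INR k + 1) - / (INR k + 1 + 1)) with (/ ((INR k + 1) * (INR k + 1 + 1))) by (field; lra).
      apply Rinv_le_contravar; nra. }
    lra.
Qed.

Lemma lsum_zr_inv_sq N : lsum (fun m => / (1 + Rabs (IZR m)) ^ 2) (zr N) <= 4.
Proof.
  assert (Hn : lsum (fun m => / (1 + Rabs (IZR m)) ^ 2)
     (map (fun k => Z.of_nat k) (seq 0 (S N)) ++ map (fun k => (- Z.of_nat k)%Z) (seq 0 (S N))) <= 4).
  { rewrite lsum_app, !lsum_map.
    assert (forall k, / (1 + Rabs (IZR (Z.of_nat k))) ^ 2 = / (INR k + 1) ^ 2).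
    { intros k. rewrite <- INR_IZR_INZ, Rabs_pos_eq by apply pos_INR. f_equal. ring. }
    rewrite (lsum_ext _ (fun j => / (INR j + 1) ^ 2)) by auto.
    rewrite (lsum_ext (fun a => / (1 + Rabs (IZR (- Z.of_nat a))) ^ 2) (fun j => / (INR j + 1) ^ 2)).
    2:{ intros k _. rewrite opp_IZR, Rabs_Ropp; auto. }
    cbn [seq lsum]. assert (A := lsum_inv_sq_seq N 0). simpl INR in *.
    assert (0 < / (0 + INR N + 1)). { apply Rinv_0_lt_compat. pose proof (pos_INR N); lra. }
    rewrite Rplus_0_l, pow1, Rinv_1. rewrite Rplus_0_l, Rinv_1 in A. lra. }
  eapply Rle_trans; [|exact Hn]. apply lsum_incl.
  - apply zr_NoDup.
  - intros m Hm. apply in_zr in Hm. apply in_app_iff.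
    destruct (Z_le_gt_dec 0 m).
    + left. apply in_map_iff. exists (Z.to_nat m). split; [lia|]. apply in_seq. lia.
    + right. apply in_map_iff. exists (Z.to_nat (-m)). split; [lia|]. apply in_seq. lia.
  - intros m. left. apply Rinv_0_lt_compat, pow_lt. pose proof (Rabs_pos (IZR m)); lra.
Qed.

(** Since [w^2 >= (1 + |m|) (1 + |n|)], the sum is dominated by a product of two one-dimensional
    sums, each at most 4. The fourth power is the one that recurs: squares of [/ w^2] terms and
    products of a [/ w^3] with a [/ w] term become summable. *)
Lemma lsum_w4 l : NoDup l -> lsum (fun p => / w p ^ 4) l <= 16.
Proof.
  intros Hl. destruct (in_some_box l) as (N & HN).
  assert (Hw : forall p, 0 <= / w p ^ 4).
  { intros p. left. apply Rinv_0_lt_compat, pow_lt, w_pos. }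
  apply Rle_trans with (lsum (fun p => / w p ^ 4) (box N)); [now apply lsum_incl|].
  apply Rle_trans with (lsum (fun p : site => / (1 + Rabs (IZR (fst p))) ^ 2 * / (1 + Rabs (IZR (snd p))) ^ 2) (box N)).
  - apply lsum_le. intros p _. rewrite <- Rinv_mult. unfold w.
    pose proof (Rabs_pos (IZR (fst p))). pose proof (Rabs_pos (IZR (snd p))).
    set (a := Rabs (IZR (fst p))) in *. set (b := Rabs (IZR (snd p))) in *.
    apply Rinv_le_contravar.
    + apply Rmult_lt_0_compat; apply pow_lt; lra.
    + rewrite <- Rpow_mult_distr. replace 4%nat with (2 * 2)%nat by reflexivity. rewrite pow_mult.
      apply pow_incr. nra.
  - unfold box, site. rewrite lsum_list_prod. simpl fst; simpl snd.
    rewrite (lsum_ext _ (fun a => lsum (fun m => / (1 + Rabs (IZR m)) ^ 2) (zr N) * / (1 + Rabs (IZR a)) ^ 2)).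
    2:{ intros a _. rewrite lsum_scal. ring. }
    rewrite lsum_scal. assert (A := lsum_zr_inv_sq N).
    assert (0 <= lsum (fun m => / (1 + Rabs (IZR m)) ^ 2) (zr N)).
    { apply lsum_nonneg. intros m _. left. apply Rinv_0_lt_compat, pow_lt. pose proof (Rabs_pos (IZR m)); lra. }
    nra.
Qed.

Lemma summable_w4 : summable (fun p => / w p ^ 4).
Proof.
  exists 16. intros l Hl. rewrite (lsum_ext _ (fun p => / w p ^ 4)); [now apply lsum_w4|].
  intros p _. apply Rabs_pos_eq. left. apply Rinv_0_lt_compat, pow_lt, w_pos.
Qed.

(** Asymptotic estimates are proved away from the core only; the finitely many remaining sites
    merely enlarge the constant. *)
Lemma extend_bound (k K : nat) (f : site -> R) C :
  (forall p, INR K <= w p -> Rabs (f p) <= C / w p ^ k) ->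
  exists C', 0 < C' /\ forall p, Rabs (f p) <= C' / w p ^ k.
Proof.
  intros H.
  assert (Hb : exists B, 0 <= B /\ forall p, In p (box K) -> Rabs (f p) * w p ^ k <= B).
  { induction (box K) as [|a l (B & HB & IH)].
    - exists 0. split; [lra|intros p []].
    - exists (Rmax B (Rabs (f a) * w a ^ k)). split; [eapply Rle_trans; [|apply Rmax_l]; auto|].
      intros p [->|Hp]; [apply Rmax_r|]. eapply Rle_trans; [apply IH; auto|apply Rmax_l]. }
  destruct Hb as (B & HB0 & HB). exists (B + Rabs C + 1). split; [pose proof (Rabs_pos C); lra|].
  intros p. assert (Hw : 0 < w p ^ k) by apply pow_lt, w_pos.
  assert (Rabs (f p) * w p ^ k <= B + Rabs C + 1).
  { destruct (in_dec site_eq_dec p (box K)) as [Hp|Hp].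
    - specialize (HB p Hp). pose proof (Rabs_pos C); lra.
    - apply w_out_box in Hp. specialize (H p (Rlt_le _ _ Hp)).
      apply (Rmult_le_compat_r (w p ^ k)) in H; [|lra].
      replace (C / w p ^ k * w p ^ k) with C in H by (field; lra).
      pose proof (Rle_abs C); lra. }
  apply (Rmult_le_reg_r (w p ^ k)); auto.
  replace ((B + Rabs C + 1) / w p ^ k * w p ^ k) with (B + Rabs C + 1) by (field; lra). auto.
Qed.

(** * Bonds, faces and summation by parts *)

(* The cell at p carries the three bonds p -> p+a1, p -> p+a2 and p+a1 -> p+a2,
   every unordered bond belonging to exactly one cell. *)
Inductive dir := d1 | d2 | d3.

Definition sh (a b : Z) (p : site) : site := (fst p + a, snd p + b)%Z.

Definition bs (i : dir) (p : site) : site := match i with d3 => sh 1 0 p | _ => p end.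
Definition be (i : dir) (p : site) : site := match i with d1 => sh 1 0 p | _ => sh 0 1 p end.

Definition field := dir -> site -> R.

Definition grad (u : site -> R) : field := fun i p => u (be i p) - u (bs i p).

(* U p is the triangle (p, p+a1, p+a2) and V p the triangle (p+a1, p+a1+a2, p+a2);
   the triangle around the origin is V (-1,-1). *)
Definition face := (site * bool)%type.
Definition U (p : site) : face := (p, false).
Definition V (p : site) : face := (p, true).
Definition f0 : face := V (-1, -1)%Z.

(** Left and right refer to the direction from [bs i p] to [be i p]. *)
Definition lf (i : dir) (p : site) : face :=
  match i with d1 => U p | d2 => V (sh (-1) 0 p) | d3 => U p end.
Definition rf (i : dir) (p : site) : face :=
  match i with d1 => V (sh 0 (-1) p) | d2 => U p | d3 => V p end.

(** The discrete rotated gradient, formal adjoint of [curl]. *)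
Definition rot (h : face -> R) : field := fun i p => h (lf i p) - h (rf i p).

(** Both kinds of triangle are traversed counterclockwise, so a bond enters the circulation of its
    left face with sign + and that of its right face with sign -. *)
Definition curl (b : field) (f : face) : R :=
  if snd f then b d2 (sh 1 0 (fst f)) - b d1 (sh 0 1 (fst f)) - b d3 (fst f)
  else b d1 (fst f) + b d3 (fst f) - b d2 (fst f).

Definition S3 (b : field) (p : site) : R := b d1 p + b d2 p + b d3 p.
Definition F2 (h : face -> R) (p : site) : R := h (U p) + h (V p).

Lemma sh_sh a b c d p : sh a b (sh c d p) = sh (c + a) (d + b) p.
Proof. unfold sh; simpl. f_equal; lia. Qed.
Lemma sh_0 p : sh 0 0 p = p.
Proof. destruct p; unfold sh; simpl; f_equal; lia. Qed.

Lemma sh_inv a b p : sh a b (sh (-a) (-b) p) = p.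
Proof. rewrite sh_sh, !Z.add_opp_diag_l. apply sh_0. Qed.
Lemma sh_inv' a b p : sh (-a) (-b) (sh a b p) = p.
Proof. rewrite sh_sh, !Z.add_opp_diag_r. apply sh_0. Qed.

Lemma summable_sh a b f : summable f -> summable (fun p => f (sh a b p)).
Proof. intros. apply (summable_bij f (sh a b) (sh (-a) (-b))); auto using sh_inv'. Qed.

Lemma Tsum_sh a b f : summable f -> Tsum (fun p => f (sh a b p)) = Tsum f.
Proof. intros. apply (Tsum_bij f (sh a b) (sh (-a) (-b))); auto using sh_inv, sh_inv'. Qed.

Definition fsummable (b : field) : Prop := forall i, summable (b i).

Lemma summable_S3 b : fsummable b -> summable (S3 b).
Proof. intros H. unfold S3. repeat apply summable_plus; apply H. Qed.

Lemma fsummable_plus a b : fsummable a -> fsummable b -> fsummable (fun i p => a i p + b i p).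
Proof. intros Ha Hb i. apply summable_plus; auto. Qed.
Lemma fsummable_minus a b : fsummable a -> fsummable b -> fsummable (fun i p => a i p - b i p).
Proof. intros Ha Hb i. apply summable_minus; auto. Qed.
Lemma fsummable_scal c b : fsummable b -> fsummable (fun i p => c * b i p).
Proof. intros Hb i. apply summable_scal; auto. Qed.
Lemma fsummable_le a b : (forall i p, Rabs (a i p) <= b i p) -> fsummable b -> fsummable a.
Proof. intros H Hb i. apply (summable_le _ (b i)); auto. Qed.
Lemma fsummable_ext a b : (forall i p, a i p = b i p) -> fsummable a -> fsummable b.
Proof. intros H Hb i. apply (summable_ext (a i)); auto. Qed.

Lemma S3_le a b p : (forall i p, a i p <= b i p) -> S3 a p <= S3 b p.
Proof. intros H. unfold S3. pose proof (H d1 p); pose proof (H d2 p); pose proof (H d3 p). lra. Qed.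

Lemma S3_nonneg a p : (forall i p, 0 <= a i p) -> 0 <= S3 a p.
Proof. intros H. unfold S3. pose proof (H d1 p); pose proof (H d2 p); pose proof (H d3 p). lra. Qed.

Lemma S3_comp a p i : (forall i p, 0 <= a i p) -> a i p <= S3 a p.
Proof. intros H. unfold S3. pose proof (H d1 p); pose proof (H d2 p); pose proof (H d3 p). destruct i; lra. Qed.

Definition fsum (b : field) : R := Tsum (S3 b).

Lemma fsum_ext a b : (forall i p, a i p = b i p) -> fsum a = fsum b.
Proof. intros H. apply Tsum_ext. intros p. unfold S3. now rewrite !H. Qed.

Lemma fsum_plus a b : fsummable a -> fsummable b -> fsum (fun i p => a i p + b i p) = fsum a + fsum b.
Proof.
  intros Ha Hb. unfold fsum. rewrite <- Tsum_plus; auto using summable_S3.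
  apply Tsum_ext. intros; unfold S3; ring.
Qed.
Lemma fsum_minus a b : fsummable a -> fsummable b -> fsum (fun i p => a i p - b i p) = fsum a - fsum b.
Proof.
  intros Ha Hb. unfold fsum. rewrite <- Tsum_minus; auto using summable_S3.
  apply Tsum_ext. intros; unfold S3; ring.
Qed.
Lemma fsum_scal c b : fsummable b -> fsum (fun i p => c * b i p) = c * fsum b.
Proof.
  intros Hb. unfold fsum. rewrite <- Tsum_scal; auto using summable_S3.
  apply Tsum_ext. intros; unfold S3; ring.
Qed.
Lemma fsum_le a b : fsummable a -> fsummable b -> (forall i p, a i p <= b i p) -> fsum a <= fsum b.
Proof. intros Ha Hb H. apply Tsum_le; auto using summable_S3. intros p; now apply S3_le. Qed.
Lemma fsum_abs b : fsummable b -> Rabs (fsum b) <= fsum (fun i p => Rabs (b i p)).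
Proof.
  intros Hb. assert (Ha : fsummable (fun i p => Rabs (b i p))) by (intros i; apply summable_abs, Hb).
  apply Rabs_le. split.
  - assert (-1 * fsum b <= fsum (fun i p => Rabs (b i p))); [|lra].
    rewrite <- fsum_scal by auto. apply fsum_le; auto using fsummable_scal.
    intros; unfold Rabs; destruct Rcase_abs; lra.
  - apply fsum_le; auto. intros; apply Rle_abs.
Qed.

Definition fsupp (b : field) (l : list site) : Prop := forall i p, b i p <> 0 -> In p l.
Definition hsupp (h : face -> R) (l : list site) : Prop := forall p s, h (p, s) <> 0 -> In p l.

Lemma fsupp_summable b l : fsupp b l -> fsummable b.
Proof. intros H i. apply (summable_fin _ l). intros p; apply H. Qed.

Lemma fsum_fin b l : NoDup l -> fsupp b l -> fsum b = lsum (S3 b) l.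
Proof.
  intros Hl H. apply Tsum_fin; auto. intros p Hp. unfold S3 in Hp.
  destruct (Req_dec (b d1 p) 0); [|now apply (H d1)].
  destruct (Req_dec (b d2 p) 0); [|now apply (H d2)].
  destruct (Req_dec (b d3 p) 0); [|now apply (H d3)]. lra.
Qed.

(* X is paired with the face on the left of a bond and Y with the face on its right. *)
Lemma bond_face_sum (a : face -> R) (X Y : field) :
  fsummable (fun i p => a (lf i p) * X i p) -> fsummable (fun i p => a (rf i p) * Y i p) ->
  fsum (fun i p => a (lf i p) * X i p + a (rf i p) * Y i p) =
  Tsum (F2 (fun f => a f * (if snd f then X d2 (sh 1 0 (fst f)) + Y d1 (sh 0 1 (fst f)) + Y d3 (fst f)
                            else X d1 (fst f) + X d3 (fst f) + Y d2 (fst f)))).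
Proof.
  intros HX HY. rewrite fsum_plus by auto. unfold fsum, S3, F2.
  pose proof (HX d1) as X1. pose proof (HX d2) as X2. pose proof (HX d3) as X3.
  pose proof (HY d1) as Y1. pose proof (HY d2) as Y2. pose proof (HY d3) as Y3.
  repeat rewrite Tsum_plus by auto using summable_plus.
  rewrite <- (Tsum_sh 1 0 (fun p => a (lf d2 p) * X d2 p)) by auto.
  rewrite <- (Tsum_sh 0 1 (fun p => a (rf d1 p) * Y d1 p)) by auto.
  apply (summable_sh 1 0) in X2. apply (summable_sh 0 1) in Y1.
  repeat rewrite <- Tsum_plus by auto using summable_plus.
  apply Tsum_ext. intros p. simpl. rewrite !sh_sh; simpl; rewrite !sh_0. ring.
Qed.

(** Regrouping the bond sum by faces turns the signs of [rot] into those of [curl]. It is applied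
    with one factor of finite support, the field in [sbp_field_fin] and the face function in
    [sbp_face_fin], so no term at infinity arises. *)
Lemma sbp_gen (h : face -> R) (b : field) :
  fsummable (fun i p => h (lf i p) * b i p) -> fsummable (fun i p => h (rf i p) * b i p) ->
  fsum (fun i p => rot h i p * b i p) = Tsum (F2 (fun f => h f * curl b f)).
Proof.
  intros H1 H2.
  rewrite (fsum_ext _ (fun i p => h (lf i p) * b i p + h (rf i p) * (- b i p))) by (intros; unfold rot; ring).
  assert (H3 : fsummable (fun i p => h (rf i p) * - b i p)).
  { apply (fsummable_ext (fun i p => -1 * (h (rf i p) * b i p))); [intros; ring|]. now apply fsummable_scal. }
  rewrite (bond_face_sum h b (fun i p => - b i p) H1 H3).
  apply Tsum_ext. intros p. unfold F2, curl; simpl; ring.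
Qed.

Lemma sbp_field_fin h b l : fsupp b l ->
  fsum (fun i p => rot h i p * b i p) = Tsum (F2 (fun f => h f * curl b f)).
Proof.
  intros H. apply sbp_gen; apply (fsupp_summable _ l); intros i p Hp; apply (H i); intros E; apply Hp; rewrite E; ring.
Qed.

Definition nbhd (l : list site) : list site :=
  l ++ map (sh 1 0) l ++ map (sh 0 1) l ++ map (sh (-1) 0) l ++ map (sh 0 (-1)) l.

Lemma nbhd_cases l p : In p l -> In p (nbhd l) /\ In (sh 1 0 p) (nbhd l) /\ In (sh 0 1 p) (nbhd l)
  /\ In (sh (-1) 0 p) (nbhd l) /\ In (sh 0 (-1) p) (nbhd l).
Proof.
  intros H. unfold nbhd. rewrite !in_app_iff.
  repeat split; auto using in_map; rewrite ?in_app_iff; auto 10 using in_map.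
Qed.

Lemma nbhd_back a b l p : In (a, b) [(1, 0); (0, 1); (-1, 0); (0, -1); (0, 0)]%Z -> In (sh a b p) l -> In p (nbhd l).
Proof.
  intros Hab H. apply nbhd_cases in H. destruct H as (H0 & H1 & H2 & H3 & H4).
  rewrite sh_sh in *. destruct Hab as [E|[E|[E|[E|[E|[]]]]]]; inversion E; subst; simpl in *;
  rewrite ?sh_0 in *; auto.
Qed.

Lemma lf_supp l i p : In (fst (lf i p)) l -> In p (nbhd l).
Proof.
  destruct i; simpl; intros H.
  - now apply nbhd_cases.
  - apply (nbhd_back (-1) 0); simpl; auto 10.
  - now apply nbhd_cases.
Qed.
Lemma rf_supp l i p : In (fst (rf i p)) l -> In p (nbhd l).
Proof.
  destruct i; simpl; intros H.
  - apply (nbhd_back 0 (-1)); simpl; auto 10.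
  - now apply nbhd_cases.
  - now apply nbhd_cases.
Qed.

Lemma hsupp_lf h l i p : hsupp h l -> h (lf i p) <> 0 -> In p (nbhd l).
Proof. intros H Hn. apply (lf_supp l i). destruct (lf i p) as [q s]. simpl. now apply (H q s). Qed.
Lemma hsupp_rf h l i p : hsupp h l -> h (rf i p) <> 0 -> In p (nbhd l).
Proof. intros H Hn. apply (rf_supp l i). destruct (rf i p) as [q s]. simpl. now apply (H q s). Qed.

Lemma rot_supp h l : hsupp h l -> fsupp (rot h) (nbhd l).
Proof.
  intros H i p Hp. unfold rot in Hp. destruct (Req_dec (h (lf i p)) 0).
  - apply (hsupp_rf h l i p H). lra.
  - now apply (hsupp_lf h l i p H).
Qed.

Lemma sbp_face_fin h b l : hsupp h l ->
  fsum (fun i p => rot h i p * b i p) = Tsum (F2 (fun f => h f * curl b f)).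
Proof.
  intros H. apply sbp_gen; apply (fsupp_summable _ (nbhd l)); intros i p Hp.
  - apply (hsupp_lf h l i p H). intros E; apply Hp; rewrite E; ring.
  - apply (hsupp_rf h l i p H). intros E; apply Hp; rewrite E; ring.
Qed.

Lemma curl_grad u f : curl (grad u) f = 0.
Proof.
  destruct f as [p []]; unfold curl, grad; simpl; rewrite ?sh_sh; simpl; ring.
Qed.

Lemma curl_plus a b f : curl (fun i p => a i p + b i p) f = curl a f + curl b f.
Proof. unfold curl; destruct (snd f); ring. Qed.
Lemma curl_minus a b f : curl (fun i p => a i p - b i p) f = curl a f - curl b f.
Proof. unfold curl; destruct (snd f); ring. Qed.
Lemma curl_scal c b f : curl (fun i p => c * b i p) f = c * curl b f.
Proof. unfold curl; destruct (snd f); ring. Qed.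

(** * Curl-free fields are gradients *)

Lemma Z_primitive (f : Z -> R) : exists F : Z -> R, F 0%Z = 0 /\ forall k, F (k + 1)%Z - F k = f k.
Proof.
  exists (fun k => if Z_le_dec 0 k then lsum (fun j => f (Z.of_nat j)) (seq 0 (Z.to_nat k))
                   else - lsum (fun j => f (- Z.of_nat j - 1)%Z) (seq 0 (Z.to_nat (- k)))).
  split; [destruct Z_le_dec; [reflexivity|lia]|].
  intros k. destruct (Z_le_dec 0 (k + 1)), (Z_le_dec 0 k); try lia.
  - replace (Z.to_nat (k + 1)) with (S (Z.to_nat k)) by lia.
    rewrite seq_S, lsum_app. simpl. replace (Z.of_nat (Z.to_nat k)) with k by lia. ring.
  - assert (k = -1)%Z as -> by lia. simpl. ring.
  - replace (Z.to_nat (- k)) with (S (Z.to_nat (- (k + 1)))) by lia.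
    rewrite seq_S, lsum_app. simpl. replace (- Z.of_nat (Z.to_nat (- (k + 1))) - 1)%Z with k by lia. ring.
Qed.

Lemma Z_bi_ind (P : Z -> Prop) : P 0%Z -> (forall k, P k <-> P (k + 1)%Z) -> forall k, P k.
Proof.
  intros H0 HS. apply Z.bi_induction; auto.
  intros x y ->; reflexivity.
Qed.

(** The potential integrates [b d1] along the row [n = 0] and then [b d2] up each column. *)
Lemma curl_free_grad (b : field) : (forall f, curl b f = 0) ->
  exists u, u xi0 = 0 /\ forall i p, grad u i p = b i p.
Proof.
  intros H.
  destruct (Z_primitive (fun k => b d1 (k, 0%Z))) as (F & F0 & HF).
  assert (HG : forall m, exists G : Z -> R, G 0%Z = 0 /\ forall k, G (k + 1)%Z - G k = b d2 (m, k)).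
  { intros m. apply Z_primitive. }
  destruct (choice _ HG) as (G & HG'). clear HG.
  set (u := fun p : site => F (fst p) + G (fst p) (snd p)).
  assert (U2 : forall m n, u (m, n + 1)%Z - u (m, n) = b d2 (m, n)).
  { intros m n. unfold u; simpl. destruct (HG' m) as (_ & HGm). rewrite <- HGm. ring. }
  (* On the other rows, zero circulation around [U (m, n)] and [V (m, n)] carries the identity from
     row [n] to row [n + 1] and back. *)
  assert (U1 : forall m n, u (m + 1, n)%Z - u (m, n) = b d1 (m, n)).
  { intros m. apply Z_bi_ind.
    - unfold u; simpl. destruct (HG' m) as (-> & _), (HG' (m+1)%Z) as (-> & _). rewrite <- HF. ring.
    - intros n. pose proof (U2 m n). pose proof (U2 (m + 1)%Z n).
      pose proof (H (U (m, n))) as HU. pose proof (H (V (m, n))) as HV.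
      unfold curl, sh in HU, HV; simpl in HU, HV. rewrite !Z.add_0_r in HV. split; lra. }
  exists (fun p => u p - u xi0). split; [ring|].
  intros i [m n]. pose proof (U1 m n). pose proof (U2 m n). pose proof (H (U (m, n))) as HU.
  unfold curl in HU; simpl in HU. unfold grad.
  destruct i; unfold be, bs, sh; simpl; rewrite ?Z.add_0_r; lra.
Qed.

(** * Cancelling the integer circulations of a field of bounded energy *)

Lemma lsum_cs {A} (f : A -> R) l : (lsum f l) ^ 2 <= INR (length l) * lsum (fun a => f a ^ 2) l.
Proof.
  induction l as [|a l IH]; [simpl; lra|]. cbn [lsum length]. rewrite S_INR.
  set (s := lsum f l) in *. set (t := lsum (fun a => f a ^ 2) l) in *. set (n := INR (length l)) in *.
  assert (Hn : 0 <= n) by apply pos_INR.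
  assert (Ht : 0 <= t) by (apply lsum_nonneg; intros; nra).
  assert (2 * f a * s <= n * f a ^ 2 + t); [|nra].
  destruct (Req_dec n 0) as [H0|H0].
  - assert (l = nil) as ->. { destruct l; auto. unfold n in H0. simpl length in H0. rewrite S_INR in H0. pose proof (pos_INR (length l)); lra. }
    unfold s; simpl; nra.
  - assert (Hn' : 0 < n) by (destruct Hn; [auto|congruence]).
    assert (s ^ 2 / n <= t).
    { apply (Rmult_le_reg_l n); [lra|]. replace (n * (s ^ 2 / n)) with (s ^ 2) by (field; lra). lra. }
    assert (0 <= (n * f a - s) ^ 2 / n) by (apply Rdiv_le_0_compat; [apply pow2_ge_0|lra]).
    replace ((n * f a - s) ^ 2 / n) with (n * f a ^ 2 - 2 * f a * s + s ^ 2 / n) in H1 by (field; lra). lra.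
Qed.

Lemma lsum_swap {A B} (f : A -> B -> R) la lb :
  lsum (fun a => lsum (fun b => f a b) lb) la = lsum (fun b => lsum (fun a => f a b) la) lb.
Proof.
  induction la as [|a la IH]; simpl.
  - symmetry. now apply lsum_0.
  - rewrite IH, <- lsum_plus. reflexivity.
Qed.

Lemma lsum_zr_telescope (g : Z -> R) k :
  lsum (fun n => g n - g (n + 1)%Z) (zr k) = g (- Z.of_nat k)%Z - g (Z.of_nat k + 1)%Z.
Proof.
  unfold zr. rewrite lsum_map.
  assert (H : forall j, lsum (fun a => g (Z.of_nat a - Z.of_nat k)%Z - g (Z.of_nat a - Z.of_nat k + 1)%Z) (seq 0 j)
     = g (- Z.of_nat k)%Z - g (Z.of_nat j - Z.of_nat k)%Z).
  { induction j as [|j IH]; [simpl; ring|]. rewrite seq_S, lsum_app, IH. cbn [lsum].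
    replace (Z.of_nat (S j) - Z.of_nat k)%Z with (Z.of_nat (0 + j) - Z.of_nat k + 1)%Z by lia. simpl. ring. }
  rewrite H. do 2 f_equal. lia.
Qed.

(** Discrete Stokes: the diagonal bond cancels between the two faces of its cell, and the other
    bonds telescope to the four sides of the box. *)
Lemma stokes_box (b : field) k :
  lsum (F2 (curl b)) (box k) =
    lsum (fun m => b d1 (m, - Z.of_nat k)%Z) (zr k) - lsum (fun m => b d1 (m, Z.of_nat k + 1)%Z) (zr k)
    + lsum (fun n => b d2 (Z.of_nat k + 1, n)%Z) (zr k) - lsum (fun n => b d2 (- Z.of_nat k, n)%Z) (zr k).
Proof.
  unfold box, site. rewrite lsum_list_prod.
  rewrite (lsum_ext _ (fun m => lsum (fun n => b d1 (m, n) - b d1 (m, n + 1)%Z) (zr k)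
      + lsum (fun n => -1 * (b d2 (m, n) - b d2 (m + 1, n)%Z)) (zr k))).
  2:{ intros m _. rewrite <- lsum_plus. apply lsum_ext. intros n _.
      unfold F2, curl, sh; simpl. rewrite !Z.add_0_r. ring. }
  rewrite lsum_plus, (lsum_swap (fun m n => -1 * (b d2 (m, n) - b d2 (m + 1, n)%Z))).
  rewrite (lsum_ext _ (fun m => b d1 (m, - Z.of_nat k)%Z - b d1 (m, Z.of_nat k + 1)%Z)).
  2:{ intros m _. apply (lsum_zr_telescope (fun n => b d1 (m, n))). }
  rewrite (lsum_ext (fun b0 => lsum _ _) (fun n => b d2 (Z.of_nat k + 1, n)%Z - b d2 (- Z.of_nat k, n)%Z)).
  2:{ intros n _. rewrite lsum_scal, (lsum_zr_telescope (fun m => b d2 (m, n))). ring. }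
  rewrite !lsum_minus. ring.
Qed.

Definition fsq (b : field) : field := fun i p => b i p ^ 2.

(** The lines are opposite sides of the boundary of [box (S j)]. Their labels are [- (j + 1)] and
    [j + 2], so they avoid [box j] but fit only into [box (j + 2)]; hence the step of two between
    boxes. *)
Lemma two_lines_energy (g : site -> R) (line : Z -> Z -> site) j : (forall p, 0 <= g p) ->
  (forall t t' m m', line t m = line t' m' -> t = t' /\ m = m') ->
  (forall t m n, In (line t m) (box n) <-> (Z.abs t <= Z.of_nat n /\ Z.abs m <= Z.of_nat n)%Z) ->
  lsum (fun m => g (line (- Z.of_nat (S j))%Z m)) (zr (S j)) + lsum (fun m => g (line (Z.of_nat (S j) + 1)%Z m)) (zr (S j))
    + lsum g (box j) <= lsum g (box (S (S j))).
Proof.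
  intros Hg Hinj Hbox. set (k := S j).
  rewrite <- (lsum_map (line (- Z.of_nat k)%Z) g), <- (lsum_map (line (Z.of_nat k + 1)%Z) g), <- !lsum_app.
  assert (HN : forall t, NoDup (map (line t) (zr k))).
  { intros t. apply FinFun.Injective_map_NoDup; [intros x y H; now apply Hinj in H|apply zr_NoDup]. }
  apply lsum_incl; auto.
  - apply NoDup_app; [apply NoDup_app; auto|apply box_NoDup|].
    + intros p Hp Hq. apply in_map_iff in Hp, Hq. destruct Hp as (m & <- & _), Hq as (m' & E & _). apply Hinj in E. lia.
    + intros p Hp Hq. apply in_app_iff in Hp. rewrite !in_map_iff in Hp.
      destruct Hp as [(m & <- & _)|(m & <- & _)]; apply Hbox in Hq; lia.
  - intros p Hp. rewrite !in_app_iff, !in_map_iff in Hp.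
    destruct Hp as [[(m & <- & Hm)|(m & <- & Hm)]|Hp]; [apply in_zr in Hm; apply Hbox; lia|apply in_zr in Hm; apply Hbox; lia|].
    apply (box_incl j); auto. lia.
Qed.

(** Cauchy-Schwarz on the boundary, whose four sides have [2 j + 3] bonds each. *)
Lemma ring_energy (b : field) j :
  (lsum (F2 (curl b)) (box (S j))) ^ 2 <=
  (8 * INR j + 12) * (lsum (S3 (fsq b)) (box (S (S j))) - lsum (S3 (fsq b)) (box j)).
Proof.
  rewrite stokes_box. set (k := S j).
  set (A1 := lsum (fun m => b d1 (m, - Z.of_nat k)%Z) (zr k)).
  set (A2 := lsum (fun m => b d1 (m, Z.of_nat k + 1)%Z) (zr k)).
  set (A3 := lsum (fun n => b d2 (Z.of_nat k + 1, n)%Z) (zr k)).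
  set (A4 := lsum (fun n => b d2 (- Z.of_nat k, n)%Z) (zr k)).
  assert (HL : INR (length (zr k)) = 2 * INR j + 3).
  { unfold zr. rewrite length_map, length_seq. replace (2 * k + 1)%nat with (2 * j + 3)%nat by lia.
    rewrite plus_INR, mult_INR. simpl; ring. }
  assert (B1 := lsum_cs (fun m => b d1 (m, - Z.of_nat k)%Z) (zr k)).
  assert (B2 := lsum_cs (fun m => b d1 (m, Z.of_nat k + 1)%Z) (zr k)).
  assert (B3 := lsum_cs (fun n => b d2 (Z.of_nat k + 1, n)%Z) (zr k)).
  assert (B4 := lsum_cs (fun n => b d2 (- Z.of_nat k, n)%Z) (zr k)).
  rewrite HL in *. fold A1 in B1. fold A2 in B2. fold A3 in B3. fold A4 in B4.
  set (C1 := lsum _ _) in B1. set (C2 := lsum _ _) in B2. set (C3 := lsum _ _) in B3. set (C4 := lsum _ _) in B4.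
  assert (D1 : C1 + C2 + lsum (fun p => b d1 p ^ 2) (box j) <= lsum (fun p => b d1 p ^ 2) (box (S k))).
  { apply (two_lines_energy (fun p => b d1 p ^ 2) (fun t m => (m, t)) j); auto using pow2_ge_0.
    - intros t t' m m' E. injection E; auto.
    - intros t m n. rewrite in_box. simpl. tauto. }
  assert (D2 : C4 + C3 + lsum (fun p => b d2 p ^ 2) (box j) <= lsum (fun p => b d2 p ^ 2) (box (S k))).
  { apply (two_lines_energy (fun p => b d2 p ^ 2) (fun t m => (t, m)) j); auto using pow2_ge_0.
    - intros t t' m m' E. injection E; auto.
    - intros t m n. rewrite in_box. simpl. tauto. }
  assert (D3 : lsum (fun p => b d3 p ^ 2) (box j) <= lsum (fun p => b d3 p ^ 2) (box (S (S j)))).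
  { apply lsum_incl; [apply box_NoDup|apply box_incl; lia|intros; nra]. }
  assert (ES : forall l, lsum (S3 (fsq b)) l = lsum (fun p => b d1 p ^ 2) l + lsum (fun p => b d2 p ^ 2) l + lsum (fun p => b d3 p ^ 2) l).
  { intros l. rewrite <- !lsum_plus. reflexivity. }
  rewrite !ES. pose proof (pos_INR j).
  apply Rle_trans with (4 * (A1 ^ 2 + A2 ^ 2 + A3 ^ 2 + A4 ^ 2)).
  { assert (0 <= (A1 + A2) ^ 2 + (A1 - A3) ^ 2 + (A1 + A4) ^ 2 + (A2 + A3) ^ 2 + (A2 - A4) ^ 2 + (A3 + A4) ^ 2) by
      (repeat apply Rplus_le_le_0_compat; apply pow2_ge_0). nra. }
  apply Rle_trans with (4 * ((2 * INR j + 3) * (C1 + C2 + C3 + C4))); [lra|].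
  replace (4 * ((2 * INR j + 3) * (C1 + C2 + C3 + C4))) with ((8 * INR j + 12) * (C1 + C2 + C3 + C4)) by ring.
  apply Rmult_le_compat_l; [lra|]. fold k in D3. lra.
Qed.

Lemma ln_succ_le x : 0 < x -> ln (1 + x) <= x.
Proof.
  intros Hx. rewrite <- (ln_exp x) at 2. left. apply ln_increasing; [lra|]. apply exp_ineq1. now apply Rgt_not_eq.
Qed.

Lemma harmonic_lower K : ln (INR K + 1) <= 12 * lsum (fun j => / (8 * INR j + 12)) (seq 0 K).
Proof.
  induction K as [|K IH]; [simpl; rewrite Rplus_0_l, ln_1; lra|].
  rewrite seq_S, lsum_app, S_INR. cbn [lsum Nat.add]. pose proof (pos_INR K).
  assert (ln (INR K + 1 + 1) - ln (INR K + 1) <= / (INR K + 1)).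
  { rewrite <- ln_div by lra. replace ((INR K + 1 + 1) / (INR K + 1)) with (1 + / (INR K + 1)) by (field; lra).
    apply ln_succ_le. apply Rinv_0_lt_compat; lra. }
  assert (/ (INR K + 1) <= 12 * / (8 * INR K + 12)).
  { replace (/ (INR K + 1)) with (12 * / (12 * INR K + 12)) by (field; lra).
    apply Rmult_le_compat_l; [lra|]. apply Rinv_le_contravar; lra. }
  lra.
Qed.

Definition int_valued {A} (h : A -> R) : Prop := forall a, exists k : Z, h a = IZR k.

Lemma int_valued_sum {A} (h : A -> R) l : int_valued h -> exists k : Z, lsum h l = IZR k.
Proof.
  intros H. induction l as [|a l (k & IH)]; [exists 0%Z; reflexivity|].
  destruct (H a) as (k' & Hk'). exists (k' + k)%Z. simpl. rewrite IH, Hk', plus_IZR. reflexivity.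
Qed.

Lemma neutral_box_exists C : exists K1 : nat, forall b : field,
  int_valued (curl b) -> (forall l, NoDup l -> lsum (S3 (fsq b)) l <= C) ->
  exists k, (k <= K1)%nat /\ lsum (F2 (curl b)) (box k) = 0.
Proof.
  destruct (INR_unbounded (exp (24 * C))) as (K & HK). exists K. intros b Hint HC.
  destruct (classic (exists k, (k <= K)%nat /\ lsum (F2 (curl b)) (box k) = 0)) as [|Hno]; auto. exfalso.
  assert (Hk : forall j, (j < K)%nat -> / (8 * INR j + 12) <= lsum (S3 (fsq b)) (box (S (S j))) - lsum (S3 (fsq b)) (box j)).
  { intros j Hj. assert (Hr := ring_energy b j).
    destruct (int_valued_sum (F2 (curl b)) (box (S j))) as (z & Hz).
    { intros p. destruct (Hint (U p)) as (a & Ha), (Hint (V p)) as (c & Hc). exists (a + c)%Z. unfold F2. now rewrite Ha, Hc, plus_IZR. }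
    assert (z <> 0)%Z. { intros ->. apply Hno. exists (S j). split; [lia|auto]. }
    rewrite Hz in Hr. assert (1 <= IZR z ^ 2).
    { rewrite pow_IZR. apply IZR_le. simpl Z.of_nat. nia. }
    pose proof (pos_INR j). apply (Rmult_le_reg_l (8 * INR j + 12)); [lra|].
    rewrite Rinv_r by lra. lra. }
  assert (Hs : lsum (fun j => / (8 * INR j + 12)) (seq 0 K) <=
    lsum (S3 (fsq b)) (box K) + lsum (S3 (fsq b)) (box (S K)) - lsum (S3 (fsq b)) (box 0) - lsum (S3 (fsq b)) (box 1)).
  { clear - Hk. induction K as [|K IH]; [simpl seq; simpl (lsum _ nil); lra|].
    rewrite seq_S, lsum_app. cbn [lsum]. specialize (IH (fun j Hj => Hk j (Nat.lt_lt_succ_r _ _ Hj))).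
    specialize (Hk K (Nat.lt_succ_diag_r K)). simpl (0 + K)%nat. lra. }
  assert (Hpos : forall l, 0 <= lsum (S3 (fsq b)) l).
  { intros l. apply lsum_nonneg. intros; apply S3_nonneg. intros; unfold fsq; nra. }
  pose proof (Hpos (box 0)). pose proof (Hpos (box 1)).
  pose proof (HC _ (box_NoDup K)). pose proof (HC _ (box_NoDup (S K))).
  pose proof (harmonic_lower K).
  assert (24 * C < ln (INR K + 1)); [|lra].
  rewrite <- (ln_exp (24 * C)). apply ln_increasing; [apply exp_pos|lra].
Qed.

(** * Integer fields that transport charge between faces *)

Definition face_eq_dec (f g : face) : {f = g} + {f <> g}.
Proof. decide equality; [apply Bool.bool_dec|apply site_eq_dec]. Defined.

Definition ind (g f : face) : R := if face_eq_dec g f then 1 else 0.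

Definition dir_eq_dec (i j : dir) : {i = j} + {i <> j}.
Proof. decide equality. Defined.

Definition unit_field (i : dir) (p : site) : field :=
  fun i' p' => if dir_eq_dec i i' then if site_eq_dec p p' then 1 else 0 else 0.

Lemma curl_unit_field i p f : curl (unit_field i p) f = ind (lf i p) f - ind (rf i p) f.
Proof.
  destruct f as [q s]. unfold curl, unit_field, ind.
  destruct i; destruct s; cbn [snd fst lf rf]; repeat destruct dir_eq_dec; try congruence;
  repeat destruct site_eq_dec; repeat destruct face_eq_dec; try ring; exfalso;
  destruct p as [a b], q as [c d]; unfold U, V, sh in *; simpl in *;
  repeat match goal with
  | H : (_, _) = (_, _) |- _ => discriminate H
  | H : (_, _) = (_, _) |- _ => injection H; clear H; intros
  | H : _ <> _ |- _ => apply H; f_equal; try f_equal; lia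
  end; lia.
Qed.

Definition fabs (b : field) : field := fun i p => Rabs (b i p).

(** A finitely supported integer flow carrying one unit of charge, with l1 norm at most [K]. Integer
    values are what [psi] does not see. *)
Definition joined (f g : face) (K : R) : Prop :=
  exists (N : field) (l : list site), fsupp N l /\ (forall i, int_valued (N i)) /\
    (forall x, curl N x = ind f x - ind g x) /\ (forall k, NoDup k -> lsum (S3 (fabs N)) k <= K).

Lemma joined_trans f g h K K' : joined f g K -> joined g h K' -> joined f h (K + K').
Proof.
  intros (N & l & H1 & H2 & H3 & H4) (N' & l' & H1' & H2' & H3' & H4').
  exists (fun i p => N i p + N' i p), (l ++ l'). repeat split.
  - intros i p Hp. apply in_app_iff. destruct (Req_dec (N i p) 0); [right; apply (H1' i); lra|left; now apply (H1 i)].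
  - intros i p. destruct (H2 i p) as (a & Ha), (H2' i p) as (b & Hb). exists (a + b)%Z. now rewrite Ha, Hb, plus_IZR.
  - intros x. rewrite curl_plus, H3, H3'. ring.
  - intros k Hk. apply Rle_trans with (lsum (fun p => S3 (fabs N) p + S3 (fabs N') p) k).
    + apply lsum_le. intros p _. unfold S3, fabs.
      pose proof (Rabs_triang (N d1 p) (N' d1 p)). pose proof (Rabs_triang (N d2 p) (N' d2 p)).
      pose proof (Rabs_triang (N d3 p) (N' d3 p)). lra.
    + rewrite lsum_plus. specialize (H4 k Hk). specialize (H4' k Hk). lra.
Qed.

Lemma joined_sym f g K : joined f g K -> joined g f K.
Proof.
  intros (N & l & H1 & H2 & H3 & H4). exists (fun i p => -1 * N i p), l. repeat split.
  - intros i p Hp. apply (H1 i). lra.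
  - intros i p. destruct (H2 i p) as (a & Ha). exists (- a)%Z. rewrite Ha, opp_IZR. ring.
  - intros x. rewrite curl_scal, H3. ring.
  - intros k Hk. rewrite (lsum_ext _ (S3 (fabs N))); auto. intros p _. unfold S3, fabs.
    rewrite !Rabs_mult. replace (Rabs (-1)) with 1 by (rewrite Rabs_left; lra). ring.
Qed.

Lemma joined_refl f : joined f f 0.
Proof.
  exists (fun _ _ => 0), nil. repeat split.
  - intros i p H; lra.
  - intros i p. now exists 0%Z.
  - intros x. unfold curl. destruct (snd x); ring.
  - intros k _. right. apply lsum_0. intros; unfold S3, fabs. rewrite Rabs_R0; ring.
Qed.

Lemma joined_weaken f g K K' : K <= K' -> joined f g K -> joined f g K'.
Proof.
  intros H (N & l & H1 & H2 & H3 & H4). exists N, l. repeat split; auto. intros k Hk. specialize (H4 k Hk). lra.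
Qed.

Lemma joined_bond i p : joined (lf i p) (rf i p) 1.
Proof.
  exists (unit_field i p), [p]. repeat split.
  - intros i' p'. unfold unit_field. destruct dir_eq_dec; [destruct site_eq_dec; [intros _; left; auto|lra]|lra].
  - intros i' p'. unfold unit_field. destruct dir_eq_dec; [destruct site_eq_dec; [now exists 1%Z|now exists 0%Z]|now exists 0%Z].
  - apply curl_unit_field.
  - intros k Hk. apply Rle_trans with (lsum (S3 (fabs (unit_field i p))) [p]).
    + assert (Hz : forall a, ~ In a [p] -> S3 (fabs (unit_field i p)) a = 0).
      { intros a Ha. assert (p <> a) by (intros ->; apply Ha; now left). unfold S3, fabs, unit_field.
        repeat destruct dir_eq_dec; repeat destruct site_eq_dec; try congruence; rewrite ?Rabs_R0; ring. }
      assert (Hnn : forall a, 0 <= S3 (fabs (unit_field i p)) a).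
      { intros a. apply S3_nonneg. intros; apply Rabs_pos. }
      rewrite (lsum_incl_eq _ [p] (lunion [p] k)).
      * apply lsum_incl; auto using lunion_r.
      * constructor; [intros []|constructor].
      * apply lunion_NoDup.
      * apply lunion_l.
      * intros a _; auto.
    + simpl. unfold S3, fabs, unit_field. repeat destruct dir_eq_dec; repeat destruct site_eq_dec; try congruence;
      rewrite ?Rabs_R0, ?Rabs_R1; lra.
Qed.

Lemma joined_step1 p : joined (U p) (U (sh 1 0 p)) 2.
Proof.
  replace 2 with (1 + 1) by ring. apply joined_trans with (V p); [apply (joined_bond d3 p)|].
  pose proof (joined_bond d2 (sh 1 0 p)) as H. simpl in H. rewrite sh_sh in H. simpl in H. now rewrite sh_0 in H.
Qed.
Lemma joined_step2 p : joined (U p) (U (sh 0 1 p)) 2.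
Proof.
  replace 2 with (1 + 1) by ring. apply joined_trans with (V p); [apply (joined_bond d3 p)|].
  pose proof (joined_bond d1 (sh 0 1 p)) as H. simpl in H. rewrite sh_sh in H. simpl in H. rewrite sh_0 in H.
  now apply joined_sym.
Qed.

Lemma joined_line (a b : Z) (n : nat) p : (forall p, joined (U p) (U (sh a b p)) 2) ->
  joined (U p) (U (sh (Z.of_nat n * a) (Z.of_nat n * b) p)) (2 * INR n).
Proof.
  intros H. induction n as [|n IH].
  - simpl. rewrite sh_0, Rmult_0_r. apply joined_refl.
  - rewrite S_INR. replace (2 * (INR n + 1)) with (2 * INR n + 2) by ring.
    eapply joined_trans; [apply IH|]. specialize (H (sh (Z.of_nat n * a) (Z.of_nat n * b) p)). rewrite sh_sh in H.
    replace (Z.of_nat (S n) * a)%Z with (Z.of_nat n * a + a)%Z by lia.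
    replace (Z.of_nat (S n) * b)%Z with (Z.of_nat n * b + b)%Z by lia. auto.
Qed.

Lemma joined_back (a b : Z) : (forall p, joined (U p) (U (sh a b p)) 2) -> forall p, joined (U p) (U (sh (-a) (-b) p)) 2.
Proof. intros H p. apply joined_sym. rewrite <- (sh_inv a b p) at 2. apply H. Qed.

Lemma joined_box (p q : site) s t k : (Z.abs (fst q - fst p) <= Z.of_nat k)%Z -> (Z.abs (snd q - snd p) <= Z.of_nat k)%Z ->
  joined (p, s) (q, t) (4 * INR k + 2).
Proof.
  intros H1 H2.
  assert (HU : joined (U p) (U q) (4 * INR k)).
  { set (a := (fst q - fst p)%Z) in *. set (b := (snd q - snd p)%Z) in *.
    assert (Hq : q = sh 0 b (sh a 0 p)).
    { rewrite sh_sh. unfold a, b, sh. destruct p, q; simpl. f_equal; lia. }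
    rewrite Hq. replace (4 * INR k) with (2 * INR k + 2 * INR k) by ring.
    apply joined_trans with (U (sh a 0 p)).
    - assert (Hk : INR (Z.abs_nat a) <= INR k) by (apply le_INR; lia).
      apply joined_weaken with (2 * INR (Z.abs_nat a)); [lra|].
      destruct (Z_le_dec 0 a).
      + pose proof (joined_line 1 0 (Z.abs_nat a) p joined_step1) as H.
        replace (Z.of_nat (Z.abs_nat a) * 1)%Z with a in H by lia. rewrite Z.mul_0_r in H. auto.
      + pose proof (joined_line (-1) (-0) (Z.abs_nat a) p (joined_back 1 0 joined_step1)) as H.
        replace (Z.of_nat (Z.abs_nat a) * -1)%Z with a in H by lia. rewrite Z.mul_0_r in H. auto.
    - assert (Hk : INR (Z.abs_nat b) <= INR k) by (apply le_INR; lia).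
      apply joined_weaken with (2 * INR (Z.abs_nat b)); [lra|].
      destruct (Z_le_dec 0 b).
      + pose proof (joined_line 0 1 (Z.abs_nat b) (sh a 0 p) joined_step2) as H.
        replace (Z.of_nat (Z.abs_nat b) * 1)%Z with b in H by lia. rewrite Z.mul_0_r in H. auto.
      + pose proof (joined_line (-0) (-1) (Z.abs_nat b) (sh a 0 p) (joined_back 0 1 joined_step2)) as H.
        replace (Z.of_nat (Z.abs_nat b) * -1)%Z with b in H by lia. rewrite Z.mul_0_r in H. auto. }
  replace (4 * INR k + 2) with (1 + (4 * INR k + 1)) by ring.
  apply joined_trans with (U p); [|apply joined_trans with (U q); auto].
  - destruct s; [apply joined_sym, (joined_bond d3 p)|apply joined_weaken with 0; [lra|apply joined_refl]].
  - destruct t; [apply (joined_bond d3 q)|apply joined_weaken with 0; [lra|apply joined_refl]].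
Qed.

(** Superposes the flows between each [f] and the common face [g] with multiplicity [z f]. When the
    [z f] sum to zero the contributions at [g] cancel, and the field carries exactly the charges
    [z]. *)
Lemma move_charges (g : face) (L : list face) (z : face -> Z) K Zb :
  0 <= K -> (forall f, In f L -> joined f g K) -> (forall f, In f L -> Rabs (IZR (z f)) <= Zb) -> 
  exists (N : field) (l : list site), fsupp N l /\ (forall i, int_valued (N i)) /\
    (forall x, curl N x = lsum (fun f => IZR (z f) * (ind f x - ind g x)) L) /\
    (forall k, NoDup k -> lsum (S3 (fabs N)) k <= INR (length L) * (Zb * K)).
Proof.
  intros HK. induction L as [|f L IH]; intros HJ HZ.
  - exists (fun _ _ => 0), nil. repeat split.
    + intros i p H; lra.
    + intros i p. now exists 0%Z.
    + intros x. unfold curl. simpl. destruct (snd x); ring.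
    + intros k _. simpl. rewrite Rmult_0_l. right. apply lsum_0. intros; unfold S3, fabs. rewrite Rabs_R0; ring.
  - destruct IH as (N & l & H1 & H2 & H3 & H4); [intros; apply HJ; now right|intros; apply HZ; now right|].
    destruct (HJ f (or_introl eq_refl)) as (N' & l' & H1' & H2' & H3' & H4').
    specialize (HZ f (or_introl eq_refl)).
    exists (fun i p => IZR (z f) * N' i p + N i p), (l' ++ l). repeat split.
    + intros i p Hp. apply in_app_iff. destruct (Req_dec (N' i p) 0) as [E|E]; [right; apply (H1 i); rewrite E in Hp; lra|left; now apply (H1' i)].
    + intros i p. destruct (H2 i p) as (a & Ha), (H2' i p) as (b & Hb). exists (z f * b + a)%Z. now rewrite Ha, Hb, plus_IZR, mult_IZR.
    + intros x. rewrite curl_plus, curl_scal, H3, H3'. reflexivity.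
    + intros k Hk. cbn [length]. rewrite S_INR.
      apply Rle_trans with (lsum (fun p => Rabs (IZR (z f)) * S3 (fabs N') p + S3 (fabs N) p) k).
      * apply lsum_le. intros p _. unfold S3, fabs.
        pose proof (Rabs_triang (IZR (z f) * N' d1 p) (N d1 p)). pose proof (Rabs_triang (IZR (z f) * N' d2 p) (N d2 p)).
        pose proof (Rabs_triang (IZR (z f) * N' d3 p) (N d3 p)). rewrite !Rabs_mult in *. lra.
      * rewrite lsum_plus, lsum_scal. specialize (H4 k Hk). specialize (H4' k Hk).
        assert (Rabs (IZR (z f)) * lsum (S3 (fabs N')) k <= Zb * K); [|lra].
        apply Rmult_le_compat; auto using Rabs_pos. apply lsum_nonneg. intros; apply S3_nonneg; intros; apply Rabs_pos.
Qed.

Lemma lsum_F2_faces (h : face -> R) l : lsum (F2 h) l = lsum h (flat_map (fun p => [U p; V p]) l).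
Proof. rewrite lsum_flat_map. apply lsum_ext. intros p _. simpl. unfold F2. ring. Qed.

Lemma faces_NoDup l : NoDup l -> NoDup (flat_map (fun p : site => [U p; V p]) l).
Proof.
  induction l as [|p l IH]; intros H; [constructor|]. inversion H; subst.
  assert (Hi : forall s, ~ In (p, s) (flat_map (fun p : site => [U p; V p]) l)).
  { intros s Hs. apply in_flat_map in Hs. destruct Hs as (q & Hq & [E|[E|[]]]); inversion E; subst; auto. }
  simpl. constructor; [|constructor; auto; apply Hi].
  intros [E|E]; [discriminate|]. now apply (Hi false).
Qed.

Lemma in_faces l p s : In (p, s) (flat_map (fun p : site => [U p; V p]) l) <-> In p l.
Proof.
  rewrite in_flat_map. split.
  - intros (q & Hq & [E|[E|[]]]); inversion E; subst; auto.
  - intros H. exists p. split; auto. destruct s; [right; left|left]; reflexivity.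
Qed.

Lemma lsum_ind (h : face -> R) L x : NoDup L ->
  lsum (fun f => h f * ind f x) L = if in_dec face_eq_dec x L then h x else 0.
Proof.
  intros HL. induction L as [|f L IH]; [reflexivity|]. inversion HL; subst. cbn [lsum]. rewrite IH by auto.
  unfold ind at 1. destruct (face_eq_dec f x) as [->|Hne].
  - destruct (in_dec face_eq_dec x L); [contradiction|].
    destruct (in_dec face_eq_dec x (x :: L)) as [|Hn]; [ring|]. exfalso; apply Hn; now left.
  - destruct (in_dec face_eq_dec x L), (in_dec face_eq_dec x (f :: L)) as [Hi|Hi]; try ring.
    + exfalso; apply Hi; now right.
    + destruct Hi; [contradiction|contradiction].
Qed.

(** The l1 bound also bounds [N] pointwise by [K], whence [N^2 <= K |N|]. *)
Lemma fsq_diff_bound (b N : field) C K : 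
  (forall l, NoDup l -> lsum (S3 (fsq b)) l <= C) -> (forall l, NoDup l -> lsum (S3 (fabs N)) l <= K) -> 0 <= K ->
  (forall l, NoDup l -> lsum (S3 (fsq (fun i p => b i p - N i p))) l <= 2 * C + 2 * (K * K)).
Proof.
  intros Hb HN HK l Hl.
  assert (HNp : forall i p, Rabs (N i p) <= K).
  { intros i p. specialize (HN [p] (NoDup_cons _ (in_nil (a:=p)) (NoDup_nil _))). simpl in HN. 
    eapply Rle_trans; [apply (S3_comp (fabs N) p i)|lra]. intros; apply Rabs_pos. }
  apply Rle_trans with (lsum (fun p => 2 * S3 (fsq b) p + (2 * K) * S3 (fabs N) p) l).
  - apply lsum_le. intros p _. unfold S3, fsq, fabs.
    assert (A : forall i, (b i p - N i p) ^ 2 <= 2 * b i p ^ 2 + 2 * K * Rabs (N i p)).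
    { intros i. assert (N i p ^ 2 <= K * Rabs (N i p)).
      { rewrite <- pow2_abs. specialize (HNp i p). pose proof (Rabs_pos (N i p)). nra. }
      assert (0 <= (b i p + N i p) ^ 2) by apply pow2_ge_0. nra. }
    pose proof (A d1); pose proof (A d2); pose proof (A d3). lra.
  - rewrite lsum_plus, !lsum_scal. specialize (Hb l Hl). specialize (HN l Hl).
    assert (2 * K * lsum (S3 (fabs N)) l <= 2 * K * K) by (apply Rmult_le_compat_l; lra). lra.
Qed.

(** Induction on the number of charged faces. Around one of them there is a neutral box of bounded
    size; gathering its charges at that face annihilates them, at an l1 cost depending on [m] and
    [C] only. The energy of the remainder is worse but still controlled, so the induction hypothesis
    is used with a larger [C]. *)
Lemma integer_correction (m : nat) : forall C, exists K, 0 <= K /\ forall (b : field) (L : list face),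
  (length L <= m)%nat -> NoDup L -> (forall f, curl b f <> 0 -> In f L) -> int_valued (curl b) ->
  (forall l, NoDup l -> lsum (S3 (fsq b)) l <= C) ->
  exists (N : field) (l : list site), fsupp N l /\ (forall i, int_valued (N i)) /\
    (forall x, curl N x = curl b x) /\ (forall k, NoDup k -> lsum (S3 (fabs N)) k <= K).
Proof.
  induction m as [|m IH]; intros C.
  - exists 0. split; [lra|]. intros b L HL _ Hc _ _. exists (fun _ _ => 0), nil. repeat split.
    + intros i p H; lra.
    + intros i p. now exists 0%Z.
    + intros x. destruct (Req_dec (curl b x) 0) as [->|Hn].
      * unfold curl. destruct (snd x); ring.
      * apply Hc in Hn. destruct L; [destruct Hn|simpl in HL; lia].
    + intros k _. right. apply lsum_0. intros; unfold S3, fabs. rewrite Rabs_R0; ring.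
  - destruct (neutral_box_exists C) as (K1 & HK1).
    (* [KJ] bounds a face path inside the box, [Zb] a single charge (three bonds of modulus at most
       [1 + |C|]), and [KN] the l1 norm of the correction. *)
    set (KJ := 4 * INR K1 + 2). set (Zb := 3 * (1 + Rabs C)).
    set (KN := INR (S m) * (Zb * KJ)).
    assert (HKJ : 0 <= KJ) by (unfold KJ; pose proof (pos_INR K1); lra).
    assert (HZb : 0 <= Zb) by (unfold Zb; pose proof (Rabs_pos C); lra).
    assert (HKN : 0 <= KN) by (unfold KN; apply Rmult_le_pos; [apply pos_INR|nra]).
    destruct (IH (2 * C + 2 * (KN * KN))) as (K & HK0 & HK).
    exists (KN + K). split; [lra|]. intros b L HL HLn Hc Hint HC.
    destruct (classic (forall f, curl b f = 0)) as [Hz|Hnz].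
    { exists (fun _ _ => 0), nil. repeat split.
      + intros i p H; lra.
      + intros i p. now exists 0%Z.
      + intros x. rewrite Hz. unfold curl. destruct (snd x); ring.
      + intros k _. apply Rle_trans with 0; [|lra]. right. apply lsum_0. intros; unfold S3, fabs. rewrite Rabs_R0; ring. }
    apply not_all_ex_not in Hnz. destruct Hnz as ([p0 s0] & Hg). set (g := (p0, s0) : face) in *.
    set (b' := fun i p => b i (sh (fst p0) (snd p0) p)).
    assert (Hcb : forall p s, curl b' (p, s) = curl b (sh (fst p0) (snd p0) p, s)).
    { intros p s. unfold curl, b'; simpl. rewrite !sh_sh. rewrite !(Z.add_comm 1), !(Z.add_comm 0). reflexivity. }
    destruct (HK1 b') as (k & Hk & Hq).
    { intros [p s]. rewrite Hcb. apply Hint. }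
    { intros l Hl. rewrite <- (lsum_map (sh (fst p0) (snd p0)) (S3 (fsq b))). apply HC.
      apply FinFun.Injective_map_NoDup; auto. intros x y Hxy. now rewrite <- (sh_inv' (fst p0) (snd p0) x), Hxy, sh_inv'. }
    set (inb := fun f : face => in_dec site_eq_dec (sh (- fst p0) (- snd p0) (fst f)) (box k)).
    set (Lk := filter (fun f => if inb f then true else false) L).
    set (Lr := filter (fun f => if inb f then false else true) L).
    assert (HLk : forall f, In f Lk <-> In f L /\ In (sh (- fst p0) (- snd p0) (fst f)) (box k)).
    { intros f. unfold Lk. rewrite filter_In. destruct (inb f); intuition congruence. }
    assert (HLr : forall f, In f Lr <-> In f L /\ ~ In (sh (- fst p0) (- snd p0) (fst f)) (box k)).
    { intros f. unfold Lr. rewrite filter_In. destruct (inb f); intuition congruence. }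
    assert (HLkn : NoDup Lk) by (apply NoDup_filter; auto).
    assert (Hlen : (length Lk + length Lr = length L)%nat).
    { unfold Lk, Lr. clear. induction L as [|f L IH]; simpl; auto. destruct (inb f); simpl; lia. }
    assert (HgL : In g Lk).
    { apply HLk. split; auto. apply in_box. simpl. lia. }
    destruct (choice _ Hint) as (z & Hz).
    assert (HqL : lsum (curl b) Lk = 0).
    { rewrite <- Hq, lsum_F2_faces.
      assert (E : lsum (curl b') (flat_map (fun p => [U p; V p]) (box k)) =
        lsum (curl b) (flat_map (fun p => [U p; V p]) (map (sh (fst p0) (snd p0)) (box k)))).
      { rewrite !lsum_flat_map, lsum_map. apply lsum_ext. intros p _. simpl. unfold U, V. now rewrite !Hcb. }
      rewrite E. apply lsum_incl_eq; auto.
      - apply faces_NoDup. apply FinFun.Injective_map_NoDup; [|apply box_NoDup].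
        intros x y Hxy. now rewrite <- (sh_inv' (fst p0) (snd p0) x), Hxy, sh_inv'.
      - intros [p s] Hf. apply HLk in Hf. apply in_faces. apply in_map_iff. exists (sh (- fst p0) (- snd p0) p).
        split; [apply sh_inv|tauto].
      - intros [p s] Hf Hn. apply in_faces in Hf. apply in_map_iff in Hf. destruct Hf as (q & <- & Hq').
        destruct (Req_dec (curl b (sh (fst p0) (snd p0) q, s)) 0) as [|Hne]; auto. exfalso. apply Hn, HLk.
        split; auto. simpl. now rewrite sh_inv'. }
    destruct (move_charges g Lk z KJ Zb HKJ) as (N1 & l1 & A1 & A2 & A3 & A4).
    { intros [p s] Hf. apply HLk in Hf. destruct Hf as [_ Hf]. apply in_box in Hf. simpl in Hf.
      apply joined_weaken with (4 * INR k + 2); [unfold KJ; apply le_INR in Hk; lra|].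
      apply joined_box; lia. }
    { intros f _. rewrite <- Hz.
      assert (Hb1 : forall i p, Rabs (b i p) <= 1 + Rabs C).
      { intros i p. specialize (HC [p] (NoDup_cons _ (in_nil (a:=p)) (NoDup_nil _))). simpl in HC.
        assert (b i p ^ 2 <= C).
        { eapply Rle_trans; [apply (S3_comp (fsq b) p i)|lra]. intros; unfold fsq; nra. }
        rewrite <- pow2_abs in H. pose proof (Rle_abs C). pose proof (Rabs_pos (b i p)). nra. }
      unfold Zb, curl. destruct (snd f).
      - pose proof (Hb1 d2 (sh 1 0 (fst f))). pose proof (Hb1 d1 (sh 0 1 (fst f))). pose proof (Hb1 d3 (fst f)).
        revert H H0 H1. unfold Rabs. repeat destruct Rcase_abs; lra.
      - pose proof (Hb1 d2 (fst f)). pose proof (Hb1 d1 (fst f)). pose proof (Hb1 d3 (fst f)).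
        revert H H0 H1. unfold Rabs. repeat destruct Rcase_abs; lra. }
    assert (A4' : forall k, NoDup k -> lsum (S3 (fabs N1)) k <= KN).
    { intros j Hj. eapply Rle_trans; [apply (A4 j Hj)|]. unfold KN. apply Rmult_le_compat_r; [nra|].
      apply le_INR. lia. }
    (* Neutrality removes the term at [g]: [N1] reproduces the charges of the box and nothing
       else. *)
    assert (HcN : forall x, curl N1 x = if in_dec face_eq_dec x Lk then curl b x else 0).
    { intros x. rewrite A3, <- lsum_ind by auto.
      rewrite (lsum_ext _ (fun f => curl b f * ind f x - ind g x * curl b f)).
      2:{ intros f _. rewrite <- Hz. ring. }
      rewrite lsum_minus, lsum_scal, HqL. ring. }
    destruct (HK (fun i p => b i p - N1 i p) Lr) as (N2 & l2 & B1 & B2 & B3 & B4).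
    { assert (length Lk <> 0)%nat by (destruct Lk; [destruct HgL|simpl; lia]). lia. }
    { apply NoDup_filter; auto. }
    { intros f Hf. rewrite curl_minus, HcN in Hf. destruct (in_dec face_eq_dec f Lk) as [|Hn]; [lra|].
      apply HLr. assert (curl b f <> 0) by lra. split; auto. intros Hi. apply Hn, HLk. auto. }
    { intros f. rewrite curl_minus, HcN. destruct (Hint f) as (a & Ha). destruct in_dec.
      - exists 0%Z. lra.
      - exists a. lra. }
    { intros l Hl. apply fsq_diff_bound; auto. }
    exists (fun i p => N1 i p + N2 i p), (l1 ++ l2). repeat split.
    + intros i p Hp. apply in_app_iff. destruct (Req_dec (N1 i p) 0); [right; apply (B1 i); lra|left; now apply (A1 i)].
    + intros i p. destruct (A2 i p) as (x & Hx), (B2 i p) as (y & Hy). exists (x + y)%Z. now rewrite Hx, Hy, plus_IZR.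
    + intros x. rewrite curl_plus, B3, curl_minus. ring.
    + intros j Hj. apply Rle_trans with (lsum (fun p => S3 (fabs N1) p + S3 (fabs N2) p) j).
      * apply lsum_le. intros p _. unfold S3, fabs.
        pose proof (Rabs_triang (N1 d1 p) (N2 d1 p)). pose proof (Rabs_triang (N1 d2 p) (N2 d2 p)).
        pose proof (Rabs_triang (N1 d3 p) (N2 d3 p)). lra.
      * rewrite lsum_plus. specialize (A4' j Hj). specialize (B4 j Hj). lra.
Qed.

(** * Distances between faces *)

(* Face centres in the basis (a1,a2), multiplied by 3 to be integral. *)
Definition fx (f : face) : Z := (3 * fst (fst f) + if snd f then 3 else 2)%Z.
Definition fy (f : face) : Z := (3 * snd (fst f) + if snd f then 3 else 2)%Z.

Definition NZ (x y : Z) : Z := (x * x + x * y + y * y)%Z.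
Definition NR (x y : R) : R := x * x + x * y + y * y.

(** Nine times the squared distance of the centres, kept in [Z] so that clustering scales are
    integers. Its values are 0 or 3 modulo 9: faces sharing a bond have [D2 = 3], the next value is
    9, and [D2 <= 8] therefore means equal or adjacent. *)
Definition D2 (f g : face) : Z := NZ (fx f - fx g) (fy f - fy g).
Definition dist (f g : face) : R := sqrt (IZR (D2 f g)) / 3.

Lemma NR_nonneg x y : 0 <= NR x y.
Proof. unfold NR. nra. Qed.

Lemma NZ_nonneg x y : (0 <= NZ x y)%Z.
Proof. unfold NZ. nia. Qed.

Lemma IZR_NZ x y : IZR (NZ x y) = NR (IZR x) (IZR y).
Proof. unfold NZ, NR. now rewrite !plus_IZR, !mult_IZR. Qed.

Lemma D2_sym f g : D2 f g = D2 g f.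
Proof. unfold D2, NZ. ring. Qed.

Lemma dist_refl f : dist f f = 0.
Proof. unfold dist, D2. rewrite !Z.sub_diag. unfold NZ; simpl. rewrite sqrt_0. lra. Qed.

Lemma NR_triangle x y x' y' : sqrt (NR (x + x') (y + y')) <= sqrt (NR x y) + sqrt (NR x' y').
Proof.
  pose proof (NR_nonneg x y) as H1. pose proof (NR_nonneg x' y') as H2. pose proof (NR_nonneg (x + x') (y + y')) as H3.
  pose proof (sqrt_pos (NR x y)). pose proof (sqrt_pos (NR x' y')).
  rewrite <- (sqrt_Rsqr (sqrt (NR x y) + sqrt (NR x' y'))) by lra.
  apply sqrt_le_1; auto; [apply Rle_0_sqr|]. unfold Rsqr.
  set (a := sqrt (NR x y)) in *. set (b := sqrt (NR x' y')) in *.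
  assert (Ha : a * a = NR x y) by (apply sqrt_sqrt; auto).
  assert (Hb : b * b = NR x' y') by (apply sqrt_sqrt; auto).
  set (B := 2 * x * x' + x * y' + x' * y + 2 * y * y').
  assert (HB : B <= 2 * (a * b)).
  { apply Rsqr_incr_0_var; [|nra]. unfold Rsqr.
    replace (2 * (a * b) * (2 * (a * b))) with (4 * (a * a) * (b * b)) by ring. rewrite Ha, Hb.
    pose proof (pow2_ge_0 (x * y' - x' * y)).
    replace (4 * NR x y * NR x' y') with (B * B + 3 * (x * y' - x' * y) ^ 2) by (unfold NR, B; ring). lra. }
  replace ((a + b) * (a + b)) with (a * a + b * b + 2 * (a * b)) by ring. rewrite Ha, Hb.
  replace (NR (x + x') (y + y')) with (NR x y + NR x' y' + B) by (unfold NR, B; ring). lra.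
Qed.

Lemma dist_triangle f g h : dist f h <= dist f g + dist g h.
Proof.
  unfold dist, D2. rewrite !IZR_NZ.
  replace (IZR (fx f - fx h)) with (IZR (fx f - fx g) + IZR (fx g - fx h)) by (rewrite !minus_IZR; ring).
  replace (IZR (fy f - fy h)) with (IZR (fy f - fy g) + IZR (fy g - fy h)) by (rewrite !minus_IZR; ring).
  pose proof (NR_triangle (IZR (fx f - fx g)) (IZR (fy f - fy g)) (IZR (fx g - fx h)) (IZR (fy g - fy h))). lra.
Qed.

(** * Choice of the centre of the dislocation *)

(* The logarithmic growth rate of the energy of a unit circulation. *)
Definition Alog : R := sqrt 3 / (2 * PI).

Lemma sqrt3_bounds : 1.73 < sqrt 3 < 1.7321.
Proof.
  split.
  - rewrite <- (sqrt_Rsqr 1.73) by lra. apply sqrt_lt_1; unfold Rsqr; lra.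
  - rewrite <- (sqrt_Rsqr 1.7321) by lra. apply sqrt_lt_1; unfold Rsqr; lra.
Qed.

Lemma PI_gt_3 : 3 < PI.
Proof. pose proof PI2_3_2. lra. Qed.

Lemma Alog_pos : 0 < Alog.
Proof. unfold Alog. pose proof sqrt3_bounds. pose proof PI_gt_3. apply Rdiv_lt_0_compat; lra. Qed.

Lemma Alog_lt : Alog < 0.28869.
Proof.
  unfold Alog. pose proof sqrt3_bounds. pose proof PI_gt_3.
  apply (Rmult_lt_reg_r (2 * PI)); [lra|]. replace (sqrt 3 / (2 * PI) * (2 * PI)) with (sqrt 3) by (field; lra). lra.
Qed.

Lemma exp_INR_mult n x : exp (INR n * x) = exp x ^ n.
Proof.
  induction n as [|n IH]; [rewrite Rmult_0_l, exp_0; reflexivity|].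
  rewrite S_INR, Rmult_plus_distr_r, Rmult_1_l, exp_plus, IH. simpl; ring.
Qed.

Lemma exp1_lower : 2.67 < exp 1.
Proof.
  assert (H : 1 + /32 < exp (/32)) by (apply exp_ineq1; apply Rgt_not_eq; lra).
  assert (E : exp 1 = exp (/32) ^ 32).
  { rewrite <- exp_INR_mult. f_equal. simpl INR. lra. }
  rewrite E. apply Rlt_le_trans with ((1 + /32) ^ 32); [lra|]. apply pow_incr. lra.
Qed.

Lemma ln_le_div_e x : 0 < x -> ln x <= x / exp 1.
Proof.
  intros Hx. pose proof (exp_pos 1).
  assert (Hp : 0 < x / exp 1) by (apply Rdiv_lt_0_compat; auto).
  assert (E : ln x = ln (x / exp 1) + 1).
  { rewrite ln_div by auto. rewrite ln_exp. ring. }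
  assert (ln (x / exp 1) <= x / exp 1 - 1); [|lra].
  replace (x / exp 1) with (1 + (x / exp 1 - 1)) at 1 by ring.
  rewrite <- (ln_exp (x / exp 1 - 1)) at 2.
  destruct (Req_dec (x / exp 1 - 1) 0) as [E0|E0].
  - rewrite E0, Rplus_0_r, exp_0. lra.
  - left. apply ln_increasing; [lra|]. now apply exp_ineq1.
Qed.

(** The tangent to [ln] through the origin has slope [/ e], and 0.10813 exceeds 0.28869 / 2.67. The
    digits matter for [log_cost_drop]. *)
Lemma Alog_ln_le x : 0 < x -> Alog * ln x <= 0.10813 * x.
Proof.
  intros Hx. pose proof (ln_le_div_e x Hx). pose proof Alog_pos. pose proof Alog_lt. pose proof exp1_lower.
  assert (x / exp 1 <= x / 2.67).
  { unfold Rdiv. apply Rmult_le_compat_l; [lra|]. apply Rinv_le_contravar; lra. }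
  apply Rle_trans with (Alog * (x / 2.67)); [apply Rmult_le_compat_l; lra|].
  apply Rle_trans with (0.28869 * (x / 2.67)); [apply Rmult_le_compat_r; lra|]. lra.
Qed.

(** * Single-linkage clusters of charges *)

Definition closed (K : Z) (B P : list face) : Prop :=
  forall f g, In f B -> In g P -> (D2 f g <= K)%Z -> In g B.

(** Connectedness of the graph with links [D2 <= K], phrased without paths. *)
Definition conn (K : Z) (B : list face) : Prop :=
  forall S, incl S B -> S <> nil -> closed K S B -> incl B S.

Definition inb (B : list face) (f : face) : bool := if in_dec face_eq_dec f B then true else false.
Definition ninb (B : list face) (f : face) : bool := if in_dec face_eq_dec f B then false else true.

Lemma inb_In B S f : In f (filter (inb S) B) <-> In f B /\ In f S.
Proof. rewrite filter_In. unfold inb. destruct in_dec; intuition congruence. Qed.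
Lemma ninb_In B S f : In f (filter (ninb S) B) <-> In f B /\ ~ In f S.
Proof. rewrite filter_In. unfold ninb. destruct in_dec; intuition congruence. Qed.

Lemma lsum_split (h : face -> R) S B : lsum h B = lsum h (filter (inb S) B) + lsum h (filter (ninb S) B).
Proof.
  induction B as [|f B IH]; simpl; [lra|]. unfold inb at 1, ninb at 1. destruct in_dec; simpl; lra.
Qed.

Lemma length_split S (B : list face) : (length (filter (inb S) B) + length (filter (ninb S) B) = length B)%nat.
Proof.
  induction B as [|f B IH]; simpl; auto. unfold inb at 1, ninb at 1. destruct in_dec; simpl; lia.
Qed.

Lemma In_length {A} (x : A) l : In x l -> (length l <> 0)%nat.
Proof. destruct l; simpl; [tauto|lia]. Qed.

(** A disconnected list splits into two shorter parts without links between them. As the charges are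
    integers of total at least 1, one part has charge at least 1 and is kept. *)
Lemma component_exists (q : face -> R) K n : int_valued q -> forall B, (length B <= n)%nat -> NoDup B -> 1 <= lsum q B ->
  exists B', NoDup B' /\ incl B' B /\ conn K B' /\ closed K B' B /\ 1 <= lsum q B'.
Proof.
  intros Hq. induction n as [|n IH]; intros B Hn HB HQ.
  - destruct B; [simpl in HQ; lra|simpl in Hn; lia].
  - destruct (classic (conn K B)) as [Hc|Hc].
    { exists B. repeat split; auto; [intros x; auto|]. intros f g _ Hg _; auto. }
    unfold conn in Hc. apply not_all_ex_not in Hc. destruct Hc as (S & Hc).
    apply imply_to_and in Hc. destruct Hc as (HS1 & Hc). apply imply_to_and in Hc. destruct Hc as (HS2 & Hc).
    apply imply_to_and in Hc. destruct Hc as (HS3 & HS4).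
    assert (Hsp := lsum_split q S B). assert (Hlen := length_split S B).
    assert (H1 : (length (filter (inb S) B) <> 0)%nat).
    { destruct S as [|s S']; [congruence|]. assert (Hs : In s (filter (inb (s :: S')) B)).
      { apply inb_In. split; [apply HS1|]; now left. } now apply In_length in Hs. }
    assert (H2 : (length (filter (ninb S) B) <> 0)%nat).
    { intros E. apply HS4. intros x Hx. destruct (in_dec face_eq_dec x S) as [|Hn']; auto.
      assert (Hs : In x (filter (ninb S) B)) by (apply ninb_In; auto). now apply In_length in Hs. }
    assert (Hone : 1 <= lsum q (filter (inb S) B) \/ 1 <= lsum q (filter (ninb S) B)).
    { destruct (int_valued_sum q (filter (inb S) B) Hq) as (a & Ha), (int_valued_sum q (filter (ninb S) B) Hq) as (b & Hb).
      rewrite Ha, Hb in *. rewrite Hsp, <- plus_IZR in HQ. apply le_IZR in HQ.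
      destruct (Z_le_dec 1 a); [left; now apply IZR_le|right; apply IZR_le; lia]. }
    assert (HcS : closed K (filter (inb S) B) B).
    { intros f g Hf Hg HD. apply inb_In in Hf. apply inb_In. split; auto. apply (HS3 f); tauto. }
    assert (HcN : closed K (filter (ninb S) B) B).
    { intros f g Hf Hg HD. apply ninb_In in Hf. apply ninb_In. split; auto. intros Hgs. apply (proj2 Hf).
      apply (HS3 g); auto; [tauto|]. now rewrite D2_sym. }
    destruct Hone as [Hone|Hone].
    + destruct (IH (filter (inb S) B)) as (B' & B1 & B2 & B3 & B4 & B5); auto using NoDup_filter; [lia|].
      exists B'. repeat split; auto.
      * intros x Hx. apply B2, inb_In in Hx. tauto.
      * intros f g Hf Hg HD. apply (B4 f); auto. apply (HcS f); auto.
    + destruct (IH (filter (ninb S) B)) as (B' & B1 & B2 & B3 & B4 & B5); auto using NoDup_filter; [lia|].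
      exists B'. repeat split; auto.
      * intros x Hx. apply B2, ninb_In in Hx. tauto.
      * intros f g Hf Hg HD. apply (B4 f); auto. apply (HcN f); auto.
Qed.

Definition farb (z : face) (x : R) (f : face) : bool := if Rle_dec (dist f z) x then false else true.
Definition nearb (z : face) (x : R) (f : face) : bool := if Rle_dec (dist f z) x then true else false.

Lemma farb_In B z x f : In f (filter (farb z x) B) <-> In f B /\ x < dist f z.
Proof.
  rewrite filter_In. unfold farb. destruct Rle_dec; split; intros [H1 H2]; split; auto; try lra; congruence.
Qed.
Lemma nearb_In B z x f : In f (filter (nearb z x) B) <-> In f B /\ dist f z <= x.
Proof.
  rewrite filter_In. unfold nearb. destruct Rle_dec; split; intros [H1 H2]; split; auto; try lra; congruence.
Qed.

Lemma D2_le_dist K f g : (D2 f g <= K)%Z -> dist f g <= sqrt (IZR K) / 3.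
Proof.
  intros H. unfold dist. apply Rmult_le_compat_r; [lra|]. apply sqrt_le_1_alt. now apply IZR_le.
Qed.

Lemma D2_ge_dist K f g : (0 <= K)%Z -> (K < D2 f g)%Z -> sqrt (IZR (K + 1)) / 3 <= dist f g.
Proof.
  intros H0 H. unfold dist. apply Rmult_le_compat_r; [lra|]. apply sqrt_le_1_alt. apply IZR_le. lia.
Qed.

(** Grow the disc one link at a time: either the faces inside form a closed set, hence all of [B],
    or some face lies between radius [x] and [x + ell] and the number of faces outside drops. *)
Lemma conn_radius K B z n : NoDup B -> conn K B -> In z B -> forall x, 0 <= x ->
  (length (filter (farb z x) B) <= n)%nat ->
  forall f, In f B -> dist f z <= x + INR n * (sqrt (IZR K) / 3).
Proof.
  intros HBn HB Hz. set (ell := sqrt (IZR K) / 3).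
  assert (Hell : 0 <= ell) by (unfold ell; pose proof (sqrt_pos (IZR K)); lra).
  induction n as [|n IH]; intros x Hx Hn f Hf.
  - simpl. rewrite Rmult_0_l, Rplus_0_r. apply Rnot_lt_le. intros Hlt.
    assert (Hi : In f (filter (farb z x) B)) by (apply farb_In; auto).
    apply In_length in Hi. lia.
  - destruct (classic (closed K (filter (nearb z x) B) B)) as [Hc|Hc].
    { assert (Hi : In f (filter (nearb z x) B)).
      { apply (HB (filter (nearb z x) B)); auto.
        - intros y Hy. apply nearb_In in Hy. tauto.
        - intros E. assert (Hi : In z (filter (nearb z x) B)) by (apply nearb_In; rewrite dist_refl; auto).
          rewrite E in Hi. destruct Hi. }
      apply nearb_In in Hi. pose proof (pos_INR (S n)). nra. }
    unfold closed in Hc. apply not_all_ex_not in Hc. destruct Hc as (y & Hc). apply not_all_ex_not in Hc. destruct Hc as (g & Hc).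
    apply imply_to_and in Hc. destruct Hc as (H1 & Hc). apply imply_to_and in Hc. destruct Hc as (H2 & Hc).
    apply imply_to_and in Hc. destruct Hc as (H3 & H4).
    apply nearb_In in H1.
    assert (Hg1 : x < dist g z). { apply Rnot_le_lt. intros Hle. apply H4, nearb_In; auto. }
    assert (Hg2 : dist g z <= x + ell).
    { pose proof (dist_triangle g y z). rewrite D2_sym in H3. pose proof (D2_le_dist K g y H3). fold ell in H0. lra. }
    rewrite S_INR. replace (x + (INR n + 1) * ell) with ((x + ell) + INR n * ell) by ring.
    apply IH; auto; [lra|].
    assert (Hl : (length (g :: filter (farb z (x + ell)) B) <= length (filter (farb z x) B))%nat); [|simpl in Hl; lia].
    apply NoDup_incl_length.
    + constructor; [|apply NoDup_filter; auto]. intros Hi. apply farb_In in Hi. lra.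
    + intros h [<-|Hh]; apply farb_In; [auto|]. apply farb_In in Hh. split; [tauto|lra].
Qed.

(** Declares the radii from [l] to [Rr] bad: the profile is frozen there and resumes logarithmic
    growth beyond. *)
Definition extend (m : R -> R) (l Rr r : R) : R :=
  if Rle_dec r Rr then m (Rmin r l) else m l + ln (r / Rr).

(** This is what places [jm m] between 0 and [cfield] on every bond; the value 0 up to radius 1
    matches the cutoff in [phi]. *)
Definition log_growth (m : R -> R) : Prop :=
  (forall r, r <= 1 -> m r = 0) /\ (forall r r', 1 <= r -> r <= r' -> 0 <= m r' - m r <= ln r' - ln r).

Lemma log_growth_nonneg m x : log_growth m -> 0 <= m x.
Proof.
  intros (H0 & H1). destruct (Rle_dec x 1) as [Hx|Hx]; [rewrite H0; lra|].
  assert (H := H1 1 x (Rle_refl 1) (Rlt_le _ _ (Rnot_le_lt _ _ Hx))). rewrite (H0 1) in H; lra.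
Qed.

Lemma log_growth_extend m l Rr : log_growth m -> 1 <= l -> l <= Rr -> log_growth (extend m l Rr).
Proof.
  intros (H0 & H1) Hl HR. split.
  - intros r Hr. unfold extend. destruct Rle_dec; [|lra]. rewrite Rmin_left by lra. now apply H0.
  - intros r r' Hr Hrr. unfold extend.
    assert (Hln : forall a b, 0 < a -> a <= b -> ln a <= ln b) by (intros; now apply ln_le).
    destruct (Rle_dec r Rr), (Rle_dec r' Rr); try lra.
    + pose proof (H1 (Rmin r l) (Rmin r' l)) as Hm.
      assert (ln (Rmin r' l) - ln (Rmin r l) <= ln r' - ln r).
      { unfold Rmin; destruct (Rle_dec r' l), (Rle_dec r l); try lra.
        - pose proof (Hln l r'). lra.
        - pose proof (Hln r r'). lra. }
      assert (1 <= Rmin r l) by (apply Rmin_glb; lra).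
      assert (Rmin r l <= Rmin r' l) by (apply Rle_min_compat_r; auto). lra.
    + pose proof (H1 (Rmin r l) l) as Hm.
      assert (1 <= Rmin r l) by (apply Rmin_glb; lra). assert (Rmin r l <= l) by apply Rmin_r.
      rewrite ln_div by lra. pose proof (Hln Rr r').
      assert (ln l - ln (Rmin r l) + ln r' - ln Rr <= ln r' - ln r); [|lra].
      unfold Rmin; destruct Rle_dec.
      * pose proof (Hln l Rr). lra.
      * pose proof (Hln r Rr). lra.
    + rewrite !ln_div by lra. pose proof (Hln r r'). lra.
Qed.

(* m r is the logarithmic measure of the set of good radii below r; every disc of good radius
   around z contains a total charge at least 1, which is what the first item expresses. *)
Definition good_centre (q : face -> R) (B : list face) (lvl : Z) (z : face) (Rr : R) (m : R -> R) (Lam : R) : Prop :=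
  (forall x, 1 <= x -> lsum (fun f => q f * m (Rmin (dist f z) x)) B <= (lsum q B - 1) * m x) /\
  1 <= Rr /\ (forall f, In f B -> dist f z <= Rr) /\ log_growth m /\
  (forall r, Rr <= r -> m r = ln r - Lam) /\
  (forall r, sqrt (IZR lvl) / 3 <= r <= Rr -> m r = m Rr).

(** The tight case is [d = 2], where it rests on 0.32439 <= 49/150. For [d = 1] and [S = / 2] it
    would be false, since A ln 2 is about 0.2 and 49/300 about 0.163; hence the last hypothesis. *)
Lemma log_cost_drop (d : nat) (S : R) : (1 <= d)%nat -> INR d / 2 <= S -> (d = 1%nat -> 1 <= S) ->
  Alog * ln (1 + INR d) <= 49 / 50 * (S / 3).
Proof.
  intros Hd H1 H2. pose proof (Alog_ln_le (1 + INR d)). pose proof (pos_INR d).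
  destruct (Nat.eq_dec d 1) as [->|Hne].
  - specialize (H2 eq_refl). simpl INR in *. lra.
  - assert (INR 2 <= INR d) by (apply le_INR; lia). simpl INR in H3. lra.
Qed.

(** Induction on the linkage scale. At scale 8 the radius of a component is at most its number of
    charges, and all smaller radii are given up. From scale [K] to [K + 1], a [K]-component [B'] of
    charge at least 1 is kept together with its centre; the dropped charges are at distance at least
    [ell], so smaller discs see only [B'], and the radii from [ell] to [Rn] are given up. By
    summation by parts in the radius, the first clause of [good_centre] says that the charge in the
    disc minus 1 has nonnegative integral against dm. *)
Lemma good_centre_exists (q a : face -> R) (P : list face) :
  int_valued q -> (forall f, In f P -> / 2 <= a f) ->
  (forall f, In f P -> (forall g, In g P -> g <> f -> (8 < D2 f g)%Z) -> a f = 1) ->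
  forall (j : nat) B, NoDup B -> incl B P -> closed (8 + Z.of_nat j) B P -> conn (8 + Z.of_nat j) B -> 1 <= lsum q B ->
  exists z Rr m Lam, In z B /\ good_centre q B (8 + Z.of_nat j) z Rr m Lam /\
    Alog * Lam <= 1 + 49 / 50 * (lsum a B / 3).
Proof.
  intros Hq Ha1 Ha2. induction j as [|j IH]; intros B HBn HBP HBc HBk HQ.
  - destruct B as [|z B0] eqn:EB; [simpl in HQ; lra|]. rewrite <- EB in *.
    assert (Hz : In z B) by (rewrite EB; now left).
    set (Rr := 1 + INR (length B)).
    assert (HR1 : 1 <= Rr) by (unfold Rr; pose proof (pos_INR (length B)); lra).
    exists z, Rr, (extend (fun _ => 0) 1 Rr), (ln Rr). split; [auto|].
    assert (Hd : forall f, In f B -> dist f z <= Rr).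
    { intros f Hf. pose proof (conn_radius (8 + Z.of_nat 0) B z (length B) HBn HBk Hz 0 (Rle_refl 0) (filter_length_le _ _) f Hf) as H.
      assert (sqrt (IZR (8 + Z.of_nat 0)) <= 3).
      { rewrite <- (sqrt_Rsqr 3) by lra. apply sqrt_le_1_alt. unfold Rsqr. simpl. lra. }
      pose proof (pos_INR (length B)).
      assert (INR (length B) * (sqrt (IZR (8 + Z.of_nat 0)) / 3) <= INR (length B) * 1) by (apply Rmult_le_compat_l; lra).
      unfold Rr. lra. }
    assert (H0 : forall r, r <= Rr -> extend (fun _ => 0) 1 Rr r = 0).
    { intros r Hr. unfold extend. destruct Rle_dec; lra. }
    assert (H1 : forall r, Rr <= r -> extend (fun _ => 0) 1 Rr r = ln r - ln Rr).
    { intros r Hr. unfold extend. destruct Rle_dec; [|rewrite ln_div by lra; lra].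
      replace r with Rr by lra. lra. }
    assert (Hg : log_growth (extend (fun _ => 0) 1 Rr)).
    { apply log_growth_extend; try lra. split; auto. intros r r' Hr Hrr. pose proof (ln_le r r'). lra. }
    split.
    + repeat split; auto.
      * intros x Hx. rewrite lsum_0.
        2:{ intros f Hf. rewrite H0; [ring|]. eapply Rle_trans; [apply Rmin_l|auto]. }
        apply Rmult_le_pos; [lra|]. now apply log_growth_nonneg.
      * apply Hg.
      * apply (proj2 Hg); auto.
      * apply (proj2 Hg); auto.
      * intros r Hr. rewrite !H0; lra.
    + assert (INR (length B) * / 2 <= lsum a B).
      { rewrite Rmult_comm, <- lsum_const. apply lsum_le. auto. }
      pose proof (Alog_ln_le Rr). pose proof (pos_INR (length B)). unfold Rr in *. lra.
  - set (K := (8 + Z.of_nat j)%Z) in *.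
    assert (EK : (8 + Z.of_nat (S j) = K + 1)%Z) by lia. rewrite EK in *.
    destruct (component_exists q K (length B) Hq B (le_n _) HBn HQ) as (B' & B1 & B2 & B3 & B4 & B5).
    set (ell := sqrt (IZR (K + 1)) / 3).
    assert (Hell : 1 <= ell).
    { unfold ell. assert (3 <= sqrt (IZR (K + 1))); [|lra]. rewrite <- (sqrt_Rsqr 3) by lra.
      apply sqrt_le_1_alt. unfold Rsqr. replace (3 * 3) with (IZR 9) by lra. apply IZR_le. lia. }
    destruct (IH B') as (z & R' & m & Lam & Hz & Hg & HL); auto.
    { intros x Hx. apply HBP; auto. }
    { intros f g Hf Hg HD. apply (B4 f); auto. apply (HBc f); auto. lia. }
    destruct Hg as (G1 & G2 & G3 & G4 & G5 & G6).
    set (Dp := filter (ninb B') B).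
    assert (HDp : forall f, In f Dp <-> In f B /\ ~ In f B') by (intros; apply ninb_In).
    assert (Hperm : forall h, lsum h B = lsum h B' + lsum h Dp).
    { intros h. rewrite (lsum_split h B' B). f_equal.
      apply lsum_perm. apply NoDup_Permutation; auto using NoDup_filter.
      intros x. rewrite inb_In. split; [tauto|]. split; auto. }
    destruct (Nat.eq_dec (length Dp) 0) as [E0|E0].
    + assert (Dp = nil) as HD0 by (destruct Dp; [auto|discriminate]).
      assert (Hs : forall h, lsum h B = lsum h B') by (intros h; rewrite Hperm, HD0; simpl; ring).
      exists z, R', m, Lam. split; [auto|]. split; [|now rewrite Hs].
      split; [intros x Hx; rewrite !Hs; auto|]. repeat split; auto.
      * intros f Hf. apply G3. destruct (in_dec face_eq_dec f B') as [|Hn]; auto.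
        assert (Hi : In f Dp) by (apply HDp; auto). rewrite HD0 in Hi. destruct Hi.
      * apply G4.
      * apply (proj2 G4); auto.
      * apply (proj2 G4); auto.
      * intros r Hr. apply G6. split; [|lra]. apply Rle_trans with ell; [|unfold ell; lra].
        unfold ell. apply Rmult_le_compat_r; [lra|]. apply sqrt_le_1_alt, IZR_le. lia.
    + set (d := length Dp) in *.
      assert (Hd1 : 1 <= INR d). { replace 1 with (INR 1) by reflexivity. apply le_INR. lia. }
      set (M := Rmax R' ell). assert (HM : 1 <= M /\ R' <= M /\ ell <= M).
      { unfold M. pose proof (Rmax_l R' ell). pose proof (Rmax_r R' ell). lra. }
      (* [M] covers [B'] and is at least one link; each dropped charge lets the cluster reach at
         most one link further. *)
      set (Rn := (1 + INR d) * M).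
      assert (HRn : M <= Rn) by (unfold Rn; nra).
      assert (Hfar : forall f, In f Dp -> ell <= dist f z).
      { intros f Hf. apply HDp in Hf. unfold ell. apply D2_ge_dist; [lia|].
        apply Z.nle_gt. intros Hle. apply (proj2 Hf). apply (B4 z); auto; [tauto|]. now rewrite D2_sym. }
      assert (Hrad : forall f, In f B -> dist f z <= Rn).
      { intros f Hf. eapply Rle_trans.
        - apply (conn_radius (K + 1) B z d HBn HBk (B2 z Hz) M); auto; [lra|].
          apply NoDup_incl_length; [apply NoDup_filter; auto|]. intros g Hg. apply farb_In in Hg. apply HDp.
          split; [tauto|]. intros HgB. specialize (G3 g HgB). lra.
        - fold ell. unfold Rn. assert (INR d * ell <= INR d * M) by (apply Rmult_le_compat_l; lra). lra. }
      exists z, Rn, (extend m ell Rn), (ln Rn - m ell). split; [auto|].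
      assert (Hext : forall r, r <= Rn -> extend m ell Rn r = m (Rmin r ell)).
      { intros r Hr. unfold extend. destruct Rle_dec; [auto|lra]. }
      assert (Hext2 : forall r, Rn <= r -> extend m ell Rn r = ln r - (ln Rn - m ell)).
      { intros r Hr. unfold extend. destruct Rle_dec; [|rewrite ln_div by lra; lra].
        replace r with Rn by lra. rewrite Rmin_right by lra. lra. }
      assert (Hgr : log_growth (extend m ell Rn)) by (apply log_growth_extend; auto; lra).
      assert (Hmnn : forall x, 1 <= x -> 0 <= extend m ell Rn x).
      { intros x _. now apply log_growth_nonneg. }
      (* Up to radius [ell] each dropped charge contributes its charge times [m x], which is exactly
         what the right-hand side gains. *)
      assert (Hin : forall x, 1 <= x -> x <= ell ->
        lsum (fun f => q f * m (Rmin (dist f z) x)) B <= (lsum q B - 1) * m x).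
      { intros x Hx1 Hx2. rewrite !Hperm. specialize (G1 x Hx1).
        rewrite (lsum_ext _ (fun f => m x * q f) Dp).
        2:{ intros f Hf. rewrite Rmin_right; [ring|]. specialize (Hfar f Hf). lra. }
        rewrite lsum_scal. lra. }
      split.
      * split; [|repeat split; auto; try lra].
        -- intros x Hx.
           rewrite (lsum_ext _ (fun f => q f * m (Rmin (dist f z) (Rmin x ell)))).
           2:{ intros f Hf. rewrite Hext by (eapply Rle_trans; [apply Rmin_l|auto]). now rewrite Rmin_assoc. }
           assert (Hmin : 1 <= Rmin x ell) by (apply Rmin_glb; lra).
           eapply Rle_trans; [apply (Hin (Rmin x ell)); [auto|apply Rmin_r]|].
           apply Rmult_le_compat_l; [lra|]. destruct (Rle_dec x Rn).
           ++ rewrite Hext by auto. lra.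
           ++ rewrite Hext2 by lra. rewrite Rmin_right by lra. pose proof (ln_le Rn x). lra.
        -- apply Hgr.
        -- apply (proj2 Hgr); auto.
        -- apply (proj2 Hgr); auto.
        -- intros r Hr. fold ell in Hr. rewrite !Hext by lra. rewrite !Rmin_right by lra. reflexivity.
      * rewrite (Hperm a).
        (* The loss grows by exactly [ln (1 + d)]. When [R' > ell] this needs that [m] is already
           frozen from [ell] to [R'], the last clause of [good_centre]. *)
        assert (HLam : ln Rn - m ell = Lam + ln (1 + INR d)).
        { unfold Rn. rewrite ln_mult by lra. destruct (Rle_dec R' ell).
          - rewrite (G5 ell) by lra. unfold M. rewrite Rmax_right by lra. ring.
          - assert (Hml : m ell = m R').
            { apply G6. split; [|lra]. unfold ell. apply Rmult_le_compat_r; [lra|]. apply sqrt_le_1_alt, IZR_le. lia. }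
            rewrite Hml, (G5 R') by lra. unfold M. rewrite Rmax_left by lra. ring. }
        rewrite HLam.
        assert (Alog * ln (1 + INR d) <= 49 / 50 * (lsum a Dp / 3)); [|lra].
        apply log_cost_drop; [lia| |].
        -- unfold d. unfold Rdiv. rewrite (Rmult_comm (INR _)), <- lsum_const. apply lsum_le. intros f Hf.
           apply Ha1, HBP. apply HDp in Hf. tauto.
        (* A single dropped charge is isolated: an adjacent charge would belong to [B], hence to
           [B'], and would pull it into [B'] too. So its weight is 1. *)
        -- intros Hd. destruct Dp as [|f [|g t]] eqn:ED; try discriminate Hd. simpl.
           assert (Hf : In f B /\ ~ In f B') by (apply HDp; now left).
           rewrite Ha2; [lra|apply HBP; tauto|].
           intros g Hg Hne. apply Z.nle_gt. intros Hle.
           assert (HgB : In g B) by (apply (HBc f); auto; [tauto|lia]).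
           assert (HgB' : In g B').
           { destruct (in_dec face_eq_dec g B') as [|Hn]; auto. exfalso.
             assert (Hi : In g [f]) by (apply HDp; auto). destruct Hi as [|[]]; congruence. }
           apply (proj2 Hf). apply (B4 g); auto; [tauto|]. rewrite D2_sym. lia.
Qed.

(** At a scale beyond all mutual distances the whole list is one cluster. With total charge 1 the
    right-hand side of the first clause of [good_centre] vanishes. *)
Lemma centre_exists (q a : face -> R) (P : list face) :
  int_valued q -> (forall f, In f P -> / 2 <= a f) ->
  (forall f, In f P -> (forall g, In g P -> g <> f -> (8 < D2 f g)%Z) -> a f = 1) ->
  NoDup P -> lsum q P = 1 ->
  exists z Rr m Lam, In z P /\ 1 <= Rr /\ log_growth m /\ (forall r, Rr <= r -> m r = ln r - Lam) /\
    lsum (fun f => q f * m (dist f z)) P <= 0 /\ Alog * Lam <= 1 + 49 / 50 * (lsum a P / 3).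
Proof.
  intros Hq Ha1 Ha2 HP HQ.
  assert (HK : exists j : nat, forall f g, In f P -> In g P -> (D2 f g <= 8 + Z.of_nat j)%Z).
  { assert (H : forall l : list (face * face), exists j : nat, forall x, In x l -> (D2 (fst x) (snd x) <= 8 + Z.of_nat j)%Z).
    { induction l as [|x l (j & Hj)]; [exists 0%nat; intros x []|].
      exists (j + Z.to_nat (D2 (fst x) (snd x)))%nat. intros y [<-|Hy]; [lia|]. specialize (Hj y Hy). lia. }
    destruct (H (list_prod P P)) as (j & Hj). exists j. intros f g Hf Hg. apply (Hj (f, g)). now apply in_prod. }
  destruct HK as (j & Hj).
  destruct (good_centre_exists q a P Hq Ha1 Ha2 j P) as (z & Rr & m & Lam & Hz & (G1 & G2 & G3 & G4 & G5 & G6) & HL); auto.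
  - intros x; auto.
  - intros f g _ Hg _; auto.
  - intros S HS1 HS2 HS3 x Hx. destruct S as [|s S]; [congruence|].
    apply (HS3 s); auto; [now left|]. apply Hj; auto. apply HS1; now left.
  - lra.
  - exists z, Rr, m, Lam. do 4 (split; [auto|]). split; [|auto].
    specialize (G1 Rr G2). rewrite HQ in G1.
    rewrite (lsum_ext _ (fun f => q f * m (Rmin (dist f z) Rr))); [lra|].
    intros f Hf. rewrite Rmin_left; auto.
Qed.

(** * Reduction modulo 1 and the potential *)

(* Representative of x modulo 1 in [-1/2, 1/2], odd in x (hence not periodic at half-integers). *)
Definition red (x : R) : R :=
  if Rle_dec 0 x then x - IZR (Int_part (x + / 2)) else - (- x - IZR (Int_part (- x + / 2))).

Lemma red_frac x : -(/2) <= x - IZR (Int_part (x + / 2)) <= / 2.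
Proof. destruct (base_Int_part (x + / 2)). lra. Qed.

Lemma red_bound x : Rabs (red x) <= / 2.
Proof.
  apply Rabs_le. unfold red. pose proof (red_frac x). pose proof (red_frac (- x)). destruct Rle_dec; lra.
Qed.

Lemma red_mod x : exists k : Z, red x = x - IZR k.
Proof.
  unfold red. destruct Rle_dec.
  - eexists; reflexivity.
  - exists (- Int_part (- x + / 2))%Z. rewrite opp_IZR. ring.
Qed.

Lemma red_opp x : red (- x) = - red x.
Proof.
  unfold red. destruct (Rle_dec 0 x), (Rle_dec 0 (- x)); rewrite ?Ropp_involutive; try lra.
  assert (x = 0) as -> by lra. rewrite Ropp_0, Rplus_0_l.
  replace (Int_part (/ 2)) with 0%Z; [simpl; ring|]. apply Int_part_spec. lra.
Qed.

Lemma IZR_abs_lt1 k : Rabs (IZR k) < 1 -> k = 0%Z.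
Proof. rewrite <- abs_IZR. intros H. apply lt_IZR in H. lia. Qed.

Lemma red_unique x a (k : Z) : x = a + IZR k -> Rabs a < / 2 -> red x = a.
Proof.
  intros -> Ha. destruct (red_mod (a + IZR k)) as (j & Hj). pose proof (red_bound (a + IZR k)) as Hb.
  assert (k - j = 0)%Z.
  { apply IZR_abs_lt1. rewrite minus_IZR. replace (IZR k - IZR j) with (red (a + IZR k) - a) by (rewrite Hj; ring).
    eapply Rle_lt_trans; [apply Rabs_triang|]. rewrite Rabs_Ropp. lra. }
  rewrite Hj. replace k with j by lia. ring.
Qed.

Lemma ex_not_half_integer x : Rabs x <= / 4 -> ~ half_integer x.
Proof.
  intros Hx (k & ->). assert (H1 : -1 < IZR k + 0) by (apply Rabs_le_between in Hx; lra).
  assert (H2 : IZR k < 0) by (apply Rabs_le_between in Hx; lra).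
  rewrite Rplus_0_r in H1. apply lt_IZR in H1. apply lt_IZR in H2. lia.
Qed.

Lemma psi_shift psi : psi_hyp psi -> forall x (k : Z), psi (x + IZR k) = psi x.
Proof.
  intros (_ & _ & H & _). intros x. apply Z_bi_ind.
  - now rewrite Rplus_0_r.
  - intros k. rewrite plus_IZR, <- Rplus_assoc, H. reflexivity.
Qed.

Lemma psi_red psi : psi_hyp psi -> forall x, psi (red x) = psi x.
Proof.
  intros H x. destruct (red_mod x) as (k & Hk). rewrite <- (psi_shift psi H (red x) k), Hk. f_equal. ring.
Qed.

Lemma psi_lower psi : psi_hyp psi -> forall x, Rabs x <= / 2 -> / 2 * Derive_n psi 2 0 * x ^ 2 <= psi x.
Proof.
  intros (_ & _ & _ & _ & _ & _ & _ & H) x Hx. apply Rabs_le_between in Hx.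
  assert (psi x >= 1 / 2 * Derive_n psi 2 0 * x ^ 2) by (apply H; lra). lra.
Qed.

Lemma psi_mu psi : psi_hyp psi -> 0 < Derive_n psi 2 0.
Proof. intros (_ & _ & _ & _ & _ & _ & H & _). exact H. Qed.

Lemma psi_nonneg psi : psi_hyp psi -> forall x, 0 <= psi x.
Proof.
  intros H x. rewrite <- (psi_red psi H). eapply Rle_trans; [|apply psi_lower; auto; apply red_bound].
  pose proof (psi_mu psi H). pose proof (pow2_ge_0 (red x)). nra.
Qed.

Lemma continuous_bounded (f : R -> R) a b : a <= b -> (forall x, a <= x <= b -> continuous f x) ->
  exists M, 0 < M /\ forall x, a <= x <= b -> Rabs (f x) <= M.
Proof.
  intros Hab Hc.
  assert (Hc' : forall x, a <= x <= b -> continuity_pt (fun x => Rabs (f x)) x).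
  { intros x Hx. apply continuity_pt_filterlim. apply (continuous_comp f Rabs); [auto|apply continuous_Rabs]. }
  destruct (continuity_ab_maj (fun x => Rabs (f x)) a b Hab Hc') as (Mx & HM & _).
  exists (Rabs (f Mx) + 1). split; [pose proof (Rabs_pos (f Mx)); lra|].
  intros x Hx. specialize (HM x Hx). simpl in HM. lra.
Qed.

Lemma psi_bounded psi : psi_hyp psi -> exists M, 0 < M /\ forall x, psi x <= M.
Proof.
  intros H. destruct (continuous_bounded psi (- / 2) (/ 2)) as (M & HM & HB); [lra|intros x _; apply H|].
  exists M. split; auto. intros x. rewrite <- (psi_red psi H). eapply Rle_trans; [apply Rle_abs|].
  apply HB. apply Rabs_le_between, red_bound.
Qed.

Lemma psi_even_odd_derive psi : psi_hyp psi -> forall n, Nat.odd n = true -> (n <= 4)%nat -> Derive_n psi n 0 = 0.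
Proof.
  intros H n Hodd Hn.
  assert (E : Derive_n (fun x => psi (- x)) n 0 = (-1) ^ n * Derive_n psi n (- 0)).
  { apply Derive_n_comp_opp. rewrite Ropp_0. exists (mkposreal (/ 4) ltac:(lra)). intros y Hy k Hk.
    destruct H as (_ & H & _). apply H; [|lia]. apply ex_not_half_integer.
    change (Rabs (y - 0) < / 4) in Hy. rewrite Rminus_0_r in Hy. lra. }
  rewrite (Derive_n_ext (fun x => psi (- x)) psi) in E.
  2:{ intros x. destruct H as (_ & _ & _ & He & _). apply He. }
  rewrite Ropp_0 in E. replace ((-1) ^ n) with (-1) in E; [lra|].
  apply Nat.odd_spec in Hodd. destruct Hodd as (k & ->).
  rewrite pow_add, pow_mult. replace ((-1) ^ 2) with 1 by ring. rewrite pow1. ring.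
Qed.

(** Evenness kills the first and third Taylor coefficients at 0, and the fourth-order remainder is
    available on [|x| <= / 4], away from the half-integers. Farther out [psi] is bounded and
    [x^4 >= / 256]. *)
Lemma psi_quartic psi : psi_hyp psi ->
  exists C, 0 < C /\ forall x, Rabs (psi x - / 2 * Derive_n psi 2 0 * x ^ 2) <= C * x ^ 4.
Proof.
  intros H. pose proof (psi_mu psi H) as Hmu. set (mu := Derive_n psi 2 0) in *.
  destruct (psi_bounded psi H) as (M & HM & HB). pose proof (psi_nonneg psi H) as Hnn.
  destruct (continuous_bounded (Derive_n psi 4) (- / 4) (/ 4)) as (B4 & HB4 & HB4').
  { lra. } { intros x Hx. apply H. apply ex_not_half_integer. now apply Rabs_le_between. }
  assert (H0 : psi 0 = 0). { apply H. now exists 0%Z. }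
  assert (Hsmall : forall x, 0 < x <= / 4 -> Rabs (psi x - / 2 * mu * x ^ 2) <= B4 * x ^ 4).
  { intros x Hx. destruct (Taylor_Lagrange psi 3 0 x) as (z & Hz & E); [lra| |].
    { intros t Ht k Hk. destruct H as (_ & H & _). apply H; auto. apply ex_not_half_integer. apply Rabs_le. lra. }
    rewrite Rminus_0_r in E. cbn [sum_f_R0] in E.
    rewrite (psi_even_odd_derive psi H 1), (psi_even_odd_derive psi H 3) in E by (auto; lia).
    simpl (Derive_n psi 0 0) in E. rewrite H0 in E. fold mu in E.
    replace (psi x - / 2 * mu * x ^ 2) with (x ^ 4 / 24 * Derive_n psi 4 z).
    2:{ rewrite E. replace (INR (fact 4)) with 24 by (simpl; lra). replace (INR (fact 2)) with 2 by (simpl; lra). lra. }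
    assert (Hx4 : 0 <= x ^ 4) by (apply pow_le; lra).
    rewrite Rabs_mult, (Rabs_pos_eq (x ^ 4 / 24)) by lra.
    assert (Rabs (Derive_n psi 4 z) <= B4) by (apply HB4'; lra). pose proof (Rabs_pos (Derive_n psi 4 z)). nra. }
  exists (B4 + 256 * M + 8 * mu). split; [lra|]. intros x.
  assert (Hx4 : 0 <= x ^ 4) by (replace (x ^ 4) with ((x ^ 2) ^ 2) by ring; apply pow2_ge_0).
  destruct (Rle_dec (Rabs x) (/ 4)) as [Hx|Hx].
  - apply Rle_trans with (B4 * x ^ 4); [|nra].
    destruct (Rtotal_order x 0) as [Hn|[->|Hp]].
    + assert (He : psi x = psi (- x)) by (symmetry; apply H).
      rewrite He. replace (x ^ 2) with ((- x) ^ 2) by ring. replace (x ^ 4) with ((- x) ^ 4) by ring.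
      apply Hsmall. rewrite Rabs_left in Hx by auto. lra.
    + rewrite H0. replace (0 - / 2 * mu * 0 ^ 2) with 0 by ring. rewrite Rabs_R0. simpl; lra.
    + apply Hsmall. rewrite Rabs_pos_eq in Hx by lra. lra.
  - assert (Hx2 : / 16 <= x ^ 2). { rewrite <- pow2_abs. pose proof (Rabs_pos x). nra. }
    assert (x ^ 2 <= 16 * x ^ 4) by (replace (x ^ 4) with (x ^ 2 * x ^ 2) by ring; nra).
    assert (1 <= 256 * x ^ 4) by nra.
    pose proof (HB x). pose proof (Hnn x). apply Rabs_le. nra.
Qed.

(** * The reference strain *)

(** Coordinates in the basis [(a1, a2)], where the squared norm is [NR]. The origin is the centre of
    [f0] rather than a site, whence the shifts by 1/3 in [X] and [Y]. *)
Definition vv (x y : R) : vec := (x + y / 2, sqrt 3 / 2 * y).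
Definition X (p : site) : R := IZR (fst p) + / 3.
Definition Y (p : site) : R := IZR (snd p) + / 3.

Lemma pos_vv p : pos p = vv (X p) (Y p).
Proof.
  unfold pos, vv, X, Y, vadd, vscal, a2, a1, R6. rewrite cos_PI3, sin_PI3. simpl. f_equal; field.
Qed.

Lemma vnorm_vv x y : vnorm (vv x y) = sqrt (NR x y).
Proof.
  unfold vnorm, vv, NR. simpl. f_equal. assert (H : sqrt 3 * sqrt 3 = 3) by (apply sqrt_sqrt; lra). nra.
Qed.

Definition cross (x y x' y' : R) : R := sqrt 3 / 2 * (x * y' - x' * y).
Definition dot (x y x' y' : R) : R := x * x' + y * y' + (x * y' + x' * y) / 2.

Lemma polar v : 0 < vnorm v -> fst v = vnorm v * cos (arg v) /\ snd v = vnorm v * sin (arg v).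
Proof.
  destruct v as [a b]. unfold vnorm, arg. simpl. set (r := sqrt _). intros Hr.
  assert (Hr2 : r * r = a ^ 2 + b ^ 2). { apply sqrt_sqrt. nra. }
  simpl in Hr2. fold r. 
  change (fst (a, b)) with a in *. change (snd (a, b)) with b in *.
  assert (Hc : -1 <= a / r <= 1).
  { split; apply (Rmult_le_reg_r r); auto; replace (a / r * r) with a by (field; lra); nra. }
  assert (Hs : sqrt (1 - (a / r)²) = Rabs b / r).
  { rewrite <- (sqrt_Rsqr (Rabs b / r)).
    - f_equal. unfold Rsqr. replace (Rabs b / r * (Rabs b / r)) with ((Rabs b ^ 2) / (r * r)) by (field; lra).
      rewrite pow2_abs. replace (a / r * (a / r)) with (a ^ 2 / (r * r)) by (field; lra).
      replace (b ^ 2) with (r * r - a ^ 2) by (rewrite Hr2; ring). field. lra.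
    - apply Rdiv_le_0_compat; [apply Rabs_pos|auto]. }
  unfold vnorm. simpl. fold r. destruct Rle_dec.
  - rewrite cos_acos, sin_acos by auto. rewrite Hs, Rabs_pos_eq by auto. split; field; lra.
  - rewrite cos_minus, sin_minus, cos_2PI, sin_2PI, cos_acos, sin_acos by auto.
    rewrite Hs, Rabs_left by lra. split; field; lra.
Qed.

(** Comparing sums of squares forces [K] to be the product of the two norms, so the difference of
    arguments has the cosine and sine of [th]. The branch cut affects only [k]. *)
Lemma angle_mod x y x' y' K th : 0 < NR x y -> 0 < NR x' y' -> 0 < K ->
  K * cos th = dot x y x' y' -> K * sin th = cross x y x' y' ->
  exists k : Z, arg (vv x' y') - arg (vv x y) = th + 2 * PI * IZR k.
Proof.
  intros H H' HK Hc Hs.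
  set (r := vnorm (vv x y)). set (r' := vnorm (vv x' y')).
  assert (Hr : 0 < r) by (unfold r; rewrite vnorm_vv; now apply sqrt_lt_R0).
  assert (Hr' : 0 < r') by (unfold r'; rewrite vnorm_vv; now apply sqrt_lt_R0).
  destruct (polar (vv x y) Hr) as (P1 & P2). destruct (polar (vv x' y') Hr') as (Q1 & Q2).
  fold r in P1, P2. fold r' in Q1, Q2.
  set (t := arg (vv x y)) in *. set (t' := arg (vv x' y')) in *.
  assert (S3 : sqrt 3 * sqrt 3 = 3) by (apply sqrt_sqrt; lra).
  assert (Hd : dot x y x' y' = r * r' * cos (t' - t)).
  { rewrite cos_minus. replace (r * r' * (cos t' * cos t + sin t' * sin t)) with
      ((r * cos t) * (r' * cos t') + (r * sin t) * (r' * sin t')) by ring.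
    rewrite <- P1, <- P2, <- Q1, <- Q2. unfold vv, dot; simpl.
    replace (sqrt 3 / 2 * y * (sqrt 3 / 2 * y')) with (sqrt 3 * sqrt 3 * y * y' / 4) by field. rewrite S3. field. }
  assert (Hx : cross x y x' y' = r * r' * sin (t' - t)).
  { rewrite sin_minus. replace (r * r' * (sin t' * cos t - cos t' * sin t)) with
      ((r * cos t) * (r' * sin t') - (r * sin t) * (r' * cos t')) by ring.
    rewrite <- P1, <- P2, <- Q1, <- Q2. unfold vv, cross; simpl. field. }
  assert (HKr : K = r * r').
  { apply Rsqr_inj; [lra|nra|]. unfold Rsqr.
    pose proof (sin2_cos2 th) as E1. pose proof (sin2_cos2 (t' - t)) as E2. unfold Rsqr in E1, E2.
    replace (K * K) with ((K * sin th) * (K * sin th) + (K * cos th) * (K * cos th)) by (replace (K * K) with (K * K * 1) by ring; rewrite <- E1; ring).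
    rewrite Hs, Hc, Hd, Hx. replace (r * r' * (r * r')) with (r * r' * (r * r') * 1) by ring. rewrite <- E2. ring. }
  assert (Hcos : cos (t' - t - th) = 1).
  { rewrite cos_minus. apply (Rmult_eq_reg_l (K * K)); [|nra].
    replace (K * K * (cos (t' - t) * cos th + sin (t' - t) * sin th)) with
      ((K * cos (t' - t)) * (K * cos th) + (K * sin (t' - t)) * (K * sin th)) by ring.
    rewrite Hc, Hs, Hd, Hx, <- HKr. pose proof (sin2_cos2 (t' - t)) as E2. unfold Rsqr in E2.
    transitivity (K * K * (sin (t' - t) * sin (t' - t) + cos (t' - t) * cos (t' - t))); [ring|]. rewrite E2. ring. }
  assert (Hsin : sin ((t' - t - th) / 2) = 0).
  { assert (E := cos_2a_sin ((t' - t - th) / 2)). replace (2 * ((t' - t - th) / 2)) with (t' - t - th) in E by field.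
    rewrite Hcos in E. apply Rsqr_0_uniq. unfold Rsqr. lra. }
  destruct (sin_eq_0_0 _ Hsin) as (k & Hk). exists k. lra.
Qed.

Lemma arg_diff x y x' y' : 0 < NR x y -> 0 < NR x' y' -> 0 < dot x y x' y' ->
  exists k : Z, (arg (vv x' y') - arg (vv x y)) / (2 * PI) = atan (cross x y x' y' / dot x y x' y') / (2 * PI) + IZR k.
Proof.
  intros H H' Hd. set (t := cross x y x' y' / dot x y x' y').
  assert (Ht : 0 < 1 + t²) by (pose proof (Rle_0_sqr t); lra).
  pose proof (sqrt_lt_R0 _ Ht) as Hs.
  destruct (angle_mod x y x' y' (dot x y x' y' * sqrt (1 + t²)) (atan t)) as (k & Hk); auto.
  - now apply Rmult_lt_0_compat.
  - rewrite cos_atan. field. lra.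
  - rewrite sin_atan. replace (cross x y x' y') with (t * dot x y x' y') by (unfold t; field; lra). field. lra.
  - exists k. rewrite Hk. pose proof PI_gt_3. field. lra.
Qed.

Lemma mvt_bound (f df : R -> R) (t B : R) : 
  (forall x, Rabs x <= Rabs t -> is_derive f x (df x)) -> (forall x, Rabs x <= Rabs t -> Rabs (df x) <= B) ->
  f 0 = 0 -> Rabs (f t) <= B * Rabs t.
Proof.
  intros Hd HB H0.
  assert (Hx : forall x, Rmin 0 t <= x <= Rmax 0 t -> Rabs x <= Rabs t).
  { intros x. unfold Rmin, Rmax, Rabs. repeat destruct Rle_dec; repeat destruct Rcase_abs; lra. }
  destruct (MVT_gen f 0 t df) as (c & Hc & E).
  - intros x Hx'. apply Hd, Hx. lra.
  - intros x Hx'. apply continuity_pt_filterlim. apply (ex_derive_continuous f). eexists. apply Hd, Hx; auto.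
  - rewrite H0, !Rminus_0_r in E. rewrite E, Rabs_mult. apply Rmult_le_compat_r; auto using Rabs_pos.
Qed.

Lemma atan_cubic t : Rabs (atan t - t) <= Rabs t ^ 3.
Proof.
  replace (Rabs t ^ 3) with (t ^ 2 * Rabs t) by (rewrite <- pow2_abs; ring).
  apply (mvt_bound (fun t => atan t - t) (fun x => / (1 + x²) - 1)).
  - intros x _. auto_derive; auto. unfold Rsqr. field. nra.
  - intros x Hx. replace (/ (1 + x²) - 1) with (- (x ^ 2 / (1 + x ^ 2))) by (unfold Rsqr; field; nra).
    rewrite Rabs_Ropp, Rabs_pos_eq.
    + apply Rle_trans with (x ^ 2).
      * apply (Rmult_le_reg_r (1 + x ^ 2)); [nra|]. replace (x ^ 2 / (1 + x ^ 2) * (1 + x ^ 2)) with (x ^ 2) by (field; nra). nra.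
      * rewrite <- (pow2_abs x), <- (pow2_abs t). apply pow_incr. split; auto using Rabs_pos.
    + apply Rdiv_le_0_compat; nra.
  - rewrite atan_0. ring.
Qed.

Lemma log_ratio_cubic s : Rabs s <= / 2 -> Rabs (ln (1 + s) - ln (1 - s) - 2 * s) <= 3 * Rabs s ^ 3.
Proof.
  intros Hs. replace (3 * Rabs s ^ 3) with ((3 * s ^ 2) * Rabs s) by (rewrite <- pow2_abs; ring).
  assert (Hx2 : forall x, Rabs x <= Rabs s -> x ^ 2 <= s ^ 2 /\ x ^ 2 <= / 4 /\ -1 < x < 1).
  { intros x Hx. split; [|split].
    - rewrite <- (pow2_abs x), <- (pow2_abs s). apply pow_incr. split; auto using Rabs_pos.
    - rewrite <- (pow2_abs x). pose proof (Rabs_pos x). nra.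
    - assert (H : Rabs x <= / 2) by lra. apply Rabs_le_between in H. lra. }
  apply (mvt_bound (fun s => ln (1 + s) - ln (1 - s) - 2 * s) (fun x => / (1 + x) + / (1 - x) - 2)).
  - intros x Hx. destruct (Hx2 x Hx) as (_ & _ & H). auto_derive; [lra|]. field. lra.
  - intros x Hx. destruct (Hx2 x Hx) as (H1 & H2 & H3).
    replace (/ (1 + x) + / (1 - x) - 2) with (2 * x ^ 2 / (1 - x ^ 2)) by (field; split; [nra|lra]).
    rewrite Rabs_pos_eq by (apply Rdiv_le_0_compat; nra).
    apply (Rmult_le_reg_r (1 - x ^ 2)); [nra|].
    replace (2 * x ^ 2 / (1 - x ^ 2) * (1 - x ^ 2)) with (2 * x ^ 2) by (field; nra). nra.
  - rewrite Rplus_0_r, Rminus_0_r, ln_1. ring.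
Qed.

(* Midpoint zx, zy and direction ax, ay of a bond, in the basis (a1, a2). *)
Definition zx (i : dir) (p : site) : R := IZR (fst p) + match i with d2 => / 3 | _ => 5 / 6 end.
Definition zy (i : dir) (p : site) : R := IZR (snd p) + match i with d1 => / 3 | _ => 5 / 6 end.
Definition ax (i : dir) : R := match i with d1 => 1 | d2 => 0 | d3 => -1 end.
Definition ay (i : dir) : R := match i with d1 => 0 | d2 => 1 | d3 => 1 end.
Definition xi (i : dir) (x y : R) : R := x * ay i - y * ax i.

(** Fraction of a full turn under which the bond with midpoint [(x, y)] is seen from the origin: its
    endpoints have inner product [NR x y - / 4] and determinant [sqrt 3 / 2 * xi i x y]. *)
Definition ang (i : dir) (x y : R) : R := atan (sqrt 3 / 2 * xi i x y / (NR x y - / 4)) / (2 * PI).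

Lemma X_bs i p : X (bs i p) = zx i p - ax i / 2 /\ Y (bs i p) = zy i p - ay i / 2.
Proof. unfold X, Y, zx, zy. destruct i; unfold bs, sh; simpl; rewrite ?plus_IZR; split; field. Qed.
Lemma X_be i p : X (be i p) = zx i p + ax i / 2 /\ Y (be i p) = zy i p + ay i / 2.
Proof. unfold X, Y, zx, zy. destruct i; unfold be, sh; simpl; rewrite ?plus_IZR; split; field. Qed.

Lemma NR_zero x y : NR x y <= 0 -> x = 0 /\ y = 0.
Proof.
  unfold NR. intros H. assert (Hy : y = 0). { apply Rsqr_0_uniq. unfold Rsqr. pose proof (pow2_ge_0 (x + y / 2)). apply Rle_antisym; nra. }
  subst. split; auto. apply Rsqr_0_uniq. unfold Rsqr. apply Rle_antisym; nra.
Qed.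

Lemma ang_lt i x y : Rabs (ang i x y) < / 4.
Proof.
  unfold ang. set (t := sqrt 3 / 2 * xi i x y / (NR x y - / 4)). pose proof (atan_bound t). pose proof PI_gt_3.
  apply Rabs_def1; apply (Rmult_lt_reg_r (2 * PI)); try lra;
  replace (atan t / (2 * PI) * (2 * PI)) with (atan t) by (field; lra); lra.
Qed.

(** [T] stands for a translation or a point reflection. Both endpoints get the factor [sg], so inner
    product and determinant do not see it, and the strain is that of a dislocation at [(sx, sy)]. A
    midpoint at distance more than 1/2 makes the inner product positive, which makes [atan] the
    right inverse. *)
Lemma grad_yhat_angle (T : site -> site) sg sx sy i p : sg = 1 \/ sg = -1 ->
  (forall p, X (T p) = sg * (X p - sx) /\ Y (T p) = sg * (Y p - sy)) ->
  / 4 < NR (zx i p - sx) (zy i p - sy) ->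
  exists k : Z, grad (fun p => yhat (T p)) i p = ang i (zx i p - sx) (zy i p - sy) + IZR k.
Proof.
  intros Hsg HT HN.
  destruct (HT (bs i p)) as (B1 & B2). destruct (HT (be i p)) as (E1 & E2).
  destruct (X_bs i p) as (B3 & B4). destruct (X_be i p) as (E3 & E4).
  rewrite B3 in B1. rewrite B4 in B2. rewrite E3 in E1. rewrite E4 in E2.
  set (x := zx i p - sx) in *. set (y := zy i p - sy) in *.
  replace (zx i p - ax i / 2 - sx) with (x - ax i / 2) in B1 by (unfold x; ring).
  replace (zy i p - ay i / 2 - sy) with (y - ay i / 2) in B2 by (unfold y; ring).
  replace (zx i p + ax i / 2 - sx) with (x + ax i / 2) in E1 by (unfold x; ring).
  replace (zy i p + ay i / 2 - sy) with (y + ay i / 2) in E2 by (unfold y; ring).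
  assert (Hs2 : sg * sg = 1) by (destruct Hsg as [-> | ->]; ring).
  assert (Hdot : dot (X (T (bs i p))) (Y (T (bs i p))) (X (T (be i p))) (Y (T (be i p))) = NR x y - / 4).
  { rewrite B1, B2, E1, E2. unfold dot, NR.
    transitivity (sg * sg * (x * x + x * y + y * y - (ax i * ax i + ax i * ay i + ay i * ay i) / 4)); [field|].
    rewrite Hs2. destruct i; simpl; field. }
  assert (Hcr : cross (X (T (bs i p))) (Y (T (bs i p))) (X (T (be i p))) (Y (T (be i p))) = sqrt 3 / 2 * xi i x y).
  { rewrite B1, B2, E1, E2. unfold cross, xi.
    transitivity (sg * sg * (sqrt 3 / 2 * (x * ay i - y * ax i))); [field|]. rewrite Hs2. ring. }
  destruct (arg_diff (X (T (bs i p))) (Y (T (bs i p))) (X (T (be i p))) (Y (T (be i p)))) as (k & Hk).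
  - apply Rnot_le_lt. intros H. apply NR_zero in H. destruct H as (H1 & H2). rewrite H1, H2 in Hdot. unfold dot in Hdot. lra.
  - apply Rnot_le_lt. intros H. apply NR_zero in H. destruct H as (H1 & H2). rewrite H1, H2 in Hdot. unfold dot in Hdot. lra.
  - rewrite Hdot. lra.
  - exists k. unfold grad, yhat. rewrite !pos_vv. rewrite Hdot, Hcr in Hk. unfold ang. rewrite <- Hk.
    pose proof PI_gt_3. field. lra.
Qed.

Definition alpha : field := fun i p => red (grad yhat i p).

(** The sides of [f0]: each spans a third of a turn seen from the origin, every other bond less than
    a quarter. *)
Definition core (i : dir) : site := match i with d1 => (-1, 0)%Z | d2 => (0, -1)%Z | d3 => (-1, -1)%Z end.

(** In units of 1/6 the midpoint is integral. A norm at most 9 leaves few values for [a] and [b],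
    and their residues modulo 6 single out the core bond. *)
Lemma NR_noncore i p : p <> core i -> / 4 < NR (zx i p) (zy i p).
Proof.
  intros H.
  set (a := (6 * fst p + match i with d2 => 2 | _ => 5 end)%Z). set (b := (6 * snd p + match i with d1 => 2 | _ => 5 end)%Z).
  assert (Ea : zx i p = IZR a / 6). { unfold zx, a. rewrite plus_IZR, mult_IZR. destruct i; field. }
  assert (Eb : zy i p = IZR b / 6). { unfold zy, b. rewrite plus_IZR, mult_IZR. destruct i; field. }
  assert (E : NR (zx i p) (zy i p) = IZR (NZ a b) / 36). { rewrite Ea, Eb, IZR_NZ. unfold NR. field. }
  rewrite E. assert (9 < NZ a b)%Z; [|apply IZR_lt in H0; lra].
  apply Z.nle_gt. intros Hle. apply H. unfold NZ in Hle.
  assert (Ha : (-4 < a < 4)%Z).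
  { clear - Hle. pose proof (Z.square_nonneg (a + 2 * b)). assert (a * a <= 12)%Z by lia. nia. }
  assert (Hb : (-4 < b < 4)%Z).
  { clear - Hle. pose proof (Z.square_nonneg (2 * a + b)). assert (b * b <= 12)%Z by lia. nia. }
  unfold a, b in *. clear - Ha Hb. destruct p as [m n]. destruct i; cbn [fst snd core] in *; f_equal; lia.
Qed.

Lemma yhat_angle i p : p <> core i -> exists k : Z, grad yhat i p = ang i (zx i p) (zy i p) + IZR k.
Proof.
  intros H. destruct (grad_yhat_angle (fun p => p) 1 0 0 i p) as (k & Hk).
  - now left.
  - intros q. split; ring.
  - rewrite !Rminus_0_r. now apply NR_noncore.
  - exists k. rewrite !Rminus_0_r in Hk. exact Hk.
Qed.

Lemma alpha_noncore i p : p <> core i -> alpha i p = ang i (zx i p) (zy i p).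
Proof.
  intros H. destruct (yhat_angle i p H) as (k & Hk). apply (red_unique _ _ k); auto.
  pose proof (ang_lt i (zx i p) (zy i p)). lra.
Qed.

Definition core_val (i : dir) : R := match i with d2 => / 3 | _ => - / 3 end.

Lemma alpha_core i : alpha i (core i) = core_val i.
Proof.
  set (p := core i).
  destruct (X_bs i p) as (B1 & B2). destruct (X_be i p) as (E1 & E2).
  assert (Hc : cos (2 * PI * core_val i) = - / 2 /\ sin (2 * PI * core_val i) = match i with d2 => sqrt 3 / 2 | _ => - (sqrt 3 / 2) end).
  { assert (C1 : cos (2 * (PI / 3)) = - / 2) by (rewrite cos_2PI3; lra).
    assert (C2 : sin (2 * (PI / 3)) = sqrt 3 / 2) by (rewrite sin_2PI3; auto).
    unfold core_val. destruct i.
    - replace (2 * PI * - / 3) with (- (2 * (PI / 3))) by field. rewrite cos_neg, sin_neg, C1, C2. split; ring.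
    - replace (2 * PI * / 3) with (2 * (PI / 3)) by field. rewrite C1, C2. split; ring.
    - replace (2 * PI * - / 3) with (- (2 * (PI / 3))) by field. rewrite cos_neg, sin_neg, C1, C2. split; ring. }
  destruct Hc as (Hc & Hs).
  destruct (angle_mod (X (bs i p)) (Y (bs i p)) (X (be i p)) (Y (be i p)) (/ 3) (2 * PI * core_val i)) as (k & Hk);
  try (rewrite ?Hc, ?Hs, ?B1, ?B2, ?E1, ?E2; unfold NR, dot, cross, zx, zy, p, core, ax, ay; destruct i; simpl; lra).
  unfold alpha. apply (red_unique _ _ k).
  - unfold grad, yhat. rewrite !pos_vv. pose proof PI_gt_3.
    replace (arg (vv (X (be i p)) (Y (be i p))) / (2 * PI) - arg (vv (X (bs i p)) (Y (bs i p))) / (2 * PI)) with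
      ((arg (vv (X (be i p)) (Y (be i p))) - arg (vv (X (bs i p)) (Y (bs i p)))) / (2 * PI)) by (field; lra).
    rewrite Hk. field. lra.
  - unfold core_val. apply Rabs_def1; destruct i; lra.
Qed.

Lemma alpha_le i p : Rabs (alpha i p) <= / 3.
Proof.
  destruct (site_eq_dec p (core i)) as [->|H].
  - rewrite alpha_core. apply Rabs_le. unfold core_val; destruct i; lra.
  - rewrite alpha_noncore by auto. pose proof (ang_lt i (zx i p) (zy i p)). lra.
Qed.

Lemma curl_int (y : site -> R) : int_valued (curl (fun i p => red (grad y i p))).
Proof.
  intros f. pose proof (curl_grad y f) as H.
  assert (A : forall i p, exists k : Z, red (grad y i p) = grad y i p - IZR k) by (intros; apply red_mod).
  unfold curl in *. destruct (snd f).
  - destruct (A d2 (sh 1 0 (fst f))) as (a & Ea), (A d1 (sh 0 1 (fst f))) as (b & Eb), (A d3 (fst f)) as (c & Ec).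
    exists (- a + b + c)%Z. rewrite !plus_IZR, opp_IZR, Ea, Eb, Ec. lra.
  - destruct (A d1 (fst f)) as (a & Ea), (A d3 (fst f)) as (b & Eb), (A d2 (fst f)) as (c & Ec).
    exists (- a - b + c)%Z. rewrite plus_IZR, minus_IZR, opp_IZR, Ea, Eb, Ec. lra.
Qed.

(** The circulation is an integer, so off [f0] it suffices that its modulus is below 1: a triangle
    other than [f0] has at most one core bond, carrying 1/3, and the others carry less than 1/4. *)
Lemma curl_alpha f : curl alpha f = ind f0 f.
Proof.
  destruct (curl_int yhat f) as (k & Hk). change (curl alpha f = IZR k) in Hk.
  assert (Hnc : forall i p, p <> core i -> Rabs (alpha i p) < / 4).
  { intros i p H. rewrite alpha_noncore by auto. apply ang_lt. }
  unfold ind. destruct (face_eq_dec f0 f) as [<-|Hf].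
  - unfold curl, f0, V; simpl. unfold sh; simpl.
    change (0%Z, (-1)%Z) with (core d2). change ((-1)%Z, 0%Z) with (core d1). change ((-1)%Z, (-1)%Z) with (core d3).
    rewrite !alpha_core. simpl. field.
  - assert (k = 0%Z) as ->; [|exact Hk]. apply IZR_abs_lt1. rewrite <- Hk. clear k Hk.
    destruct f as [p s]. unfold curl; simpl. destruct s.
    + assert (Hp : p <> (-1, -1)%Z) by (intros ->; apply Hf; reflexivity).
      assert (H1 : Rabs (alpha d2 (sh 1 0 p)) < / 4).
      { apply Hnc. intros E. apply Hp. destruct p as [m n]; unfold sh in E; simpl in E. inversion E. f_equal; lia. }
      assert (H2 : Rabs (alpha d1 (sh 0 1 p)) < / 4).
      { apply Hnc. intros E. apply Hp. destruct p as [m n]; unfold sh in E; simpl in E. inversion E. f_equal; lia. }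
      assert (H3 : Rabs (alpha d3 p) < / 4) by (apply Hnc; auto).
      apply Rabs_def2 in H1. apply Rabs_def2 in H2. apply Rabs_def2 in H3. apply Rabs_def1; lra.
    + pose proof (alpha_le d1 p) as L1. pose proof (alpha_le d2 p) as L2. pose proof (alpha_le d3 p) as L3.
      apply Rabs_le_between in L1. apply Rabs_le_between in L2. apply Rabs_le_between in L3.
      pose proof (Hnc d1 p) as N1. pose proof (Hnc d2 p) as N2. pose proof (Hnc d3 p) as N3.
      destruct (site_eq_dec p (core d1)) as [E1|E1].
      * assert (E2 : p <> core d2) by (rewrite E1; discriminate). assert (E3 : p <> core d3) by (rewrite E1; discriminate).
        specialize (N2 E2). specialize (N3 E3). apply Rabs_def2 in N2. apply Rabs_def2 in N3. apply Rabs_def1; lra.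
      * specialize (N1 E1). apply Rabs_def2 in N1. destruct (site_eq_dec p (core d2)) as [E2|E2].
        -- assert (E3 : p <> core d3) by (rewrite E2; discriminate).
           specialize (N3 E3). apply Rabs_def2 in N3. apply Rabs_def1; lra.
        -- specialize (N2 E2). apply Rabs_def2 in N2. apply Rabs_def1; lra.
Qed.

(** * Comparison with the rotated gradient of a logarithm *)

Definition phi (f : face) : R := - Alog * ln (Rmax 1 (dist f f0)).
Definition cfield : field := rot phi.

Lemma dist_f0 f : dist f f0 = sqrt (NR (IZR (fx f) / 3) (IZR (fy f) / 3)).
Proof.
  unfold dist, D2, f0, fx at 2, fy at 2, V; simpl. rewrite !Z.sub_0_r, IZR_NZ.
  replace (NR (IZR (fx f) / 3) (IZR (fy f) / 3)) with (NR (IZR (fx f)) (IZR (fy f)) / 9) by (unfold NR; field).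
  rewrite sqrt_div_alt by lra. replace 9 with (3 * 3) by ring. now rewrite sqrt_square by lra.
Qed.

(** The two adjacent centres are the midpoint of the bond plus and minus a vector of squared length
    1/12 orthogonal to it. This symmetry removes the even terms from the expansion of [cfield]. *)
Lemma NR_lf i p : NR (IZR (fx (lf i p)) / 3) (IZR (fy (lf i p)) / 3) = NR (zx i p) (zy i p) + / 12 - xi i (zx i p) (zy i p) / 2.
Proof.
  unfold fx, fy, zx, zy, xi. destruct i; unfold lf, U, V, sh, ax, ay; simpl fst; simpl snd; cbv iota;
  rewrite ?plus_IZR, ?mult_IZR, ?plus_IZR; unfold NR; field.
Qed.
Lemma NR_rf i p : NR (IZR (fx (rf i p)) / 3) (IZR (fy (rf i p)) / 3) = NR (zx i p) (zy i p) + / 12 + xi i (zx i p) (zy i p) / 2.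
Proof.
  unfold fx, fy, zx, zy, xi. destruct i; unfold rf, U, V, sh, ax, ay; simpl fst; simpl snd; cbv iota;
  rewrite ?plus_IZR, ?mult_IZR, ?plus_IZR; unfold NR; field.
Qed.

Lemma xi_bound i x y : Rabs (xi i x y) <= 1.2 * sqrt (NR x y).
Proof.
  pose proof (NR_nonneg x y). pose proof (sqrt_pos (NR x y)).
  assert (H1 : 3 * (xi i x y) ^ 2 <= 4 * NR x y).
  { unfold xi, NR. destruct i; simpl.
    - pose proof (pow2_ge_0 (2 * x + y)). nra.
    - pose proof (pow2_ge_0 (2 * y + x)). nra.
    - pose proof (pow2_ge_0 (x - y)). nra. }
  assert (Hs : sqrt (NR x y) * sqrt (NR x y) = NR x y) by (apply sqrt_sqrt; auto).
  set (s := sqrt (NR x y)) in *. rewrite <- pow2_abs in H1. pose proof (Rabs_pos (xi i x y)). nra.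
Qed.

(** Common leading term of [ang] and [cfield]: the gradient of the angle over 2 PI, in the direction
    of the bond. *)
Definition lead (i : dir) (x y : R) : R := Alog * xi i x y / (2 * NR x y).

Lemma inv_cube_le r K a : 0 < r -> Rabs a * r ^ 3 <= K -> Rabs a <= K / r ^ 3.
Proof.
  intros Hr H. assert (0 < r ^ 3) by now apply pow_lt. apply (Rmult_le_reg_r (r ^ 3)); auto.
  replace (K / r ^ 3 * r ^ 3) with K by (field; lra). auto.
Qed.

(** Two errors of third order: [atan t - t], and the replacement of [NR - / 4] by [NR]. *)
Lemma ang_lead i x y : 1 <= NR x y -> Rabs (ang i x y - lead i x y) <= 1 / sqrt (NR x y) ^ 3.
Proof.
  intros HN. pose proof (xi_bound i x y) as Hxi. set (s := xi i x y) in *. set (N := NR x y) in *.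
  set (r := sqrt N) in *. assert (Hr2 : r * r = N) by (apply sqrt_sqrt; lra).
  assert (Hr : 1 <= r). { unfold r. rewrite <- sqrt_1. apply sqrt_le_1_alt; auto. }
  pose proof sqrt3_bounds as H3. pose proof PI_gt_3 as Hpi.
  set (t := sqrt 3 / 2 * s / (N - / 4)).
  assert (Hu : Rabs (sqrt 3 / 2 * s) <= 1.04 * r).
  { rewrite Rabs_mult, (Rabs_pos_eq (sqrt 3 / 2)) by lra. pose proof (Rabs_pos s). nra. }
  set (u := sqrt 3 / 2 * s) in *.
  assert (Hden : 3 / 4 * N <= N - / 4) by lra.
  assert (Ht : Rabs t * r <= 1.4).
  { unfold t. unfold Rdiv. rewrite Rabs_mult, (Rabs_pos_eq (/ _)) by (left; apply Rinv_0_lt_compat; lra).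
    apply Rle_trans with ((1.04 * r) * / (3 / 4 * N) * r).
    - apply Rmult_le_compat_r; [lra|]. apply Rmult_le_compat; auto using Rabs_pos.
      + left; apply Rinv_0_lt_compat; lra.
      + apply Rinv_le_contravar; lra.
    - rewrite <- Hr2. replace (1.04 * r * / (3 / 4 * (r * r)) * r) with (1.04 * 4 / 3) by (field; lra). lra. }
  assert (E1 : Rabs (atan t - t) * r ^ 3 <= 2.8).
  { apply Rle_trans with ((Rabs t * r) ^ 3).
    - rewrite Rpow_mult_distr. apply Rmult_le_compat_r; [apply pow_le; lra|]. apply atan_cubic.
    - apply Rle_trans with (1.4 ^ 3); [|lra]. apply pow_incr. split; auto. apply Rmult_le_pos; [apply Rabs_pos|lra]. }
  assert (E2 : Rabs (t - u / N) * r ^ 3 <= 0.4).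
  { replace (t - u / N) with (u * / (4 * N * (N - / 4))) by (unfold t; field; lra).
    rewrite Rabs_mult, (Rabs_pos_eq (/ _)) by (left; apply Rinv_0_lt_compat; nra).
    apply Rle_trans with ((1.04 * r) * / (4 * N * (3 / 4 * N)) * r ^ 3).
    - apply Rmult_le_compat_r; [apply pow_le; lra|]. apply Rmult_le_compat; auto using Rabs_pos.
      + left; apply Rinv_0_lt_compat; nra.
      + apply Rinv_le_contravar; nra.
    - rewrite <- Hr2. replace (1.04 * r * / (4 * (r * r) * (3 / 4 * (r * r))) * r ^ 3) with (1.04 / 3) by (field; lra). lra. }
  apply inv_cube_le; [lra|].
  assert (Hr3 : 0 < r ^ 3) by (apply pow_lt; lra).
  replace (ang i x y - lead i x y) with (((atan t - t) + (t - u / N)) / (2 * PI)).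
  2:{ unfold ang, lead. fold N s u t. unfold Alog, u. field. lra. }
  unfold Rdiv. rewrite Rabs_mult, (Rabs_pos_eq (/ (2 * PI))) by (left; apply Rinv_0_lt_compat; lra).
  pose proof (Rabs_triang (atan t - t) (t - u / N)) as Htr.
  apply (Rmult_le_reg_r (2 * PI)); [lra|].
  replace (Rabs (atan t - t + (t - u * / N)) * / (2 * PI) * r ^ 3 * (2 * PI)) with (Rabs (atan t - t + (t - u * / N)) * r ^ 3) by (field; lra).
  unfold Rdiv in *. nra.
Qed.

(** [ln (1 + e) - ln (1 - e)] is odd in [e], so its first correction is cubic; the shift by 1/12 in
    [M] is again of third order. *)
Lemma cfield_lead i p : 4 <= NR (zx i p) (zy i p) ->
  Rabs (cfield i p - lead i (zx i p) (zy i p)) <= 1 / sqrt (NR (zx i p) (zy i p)) ^ 3.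
Proof.
  intros HN. pose proof (xi_bound i (zx i p) (zy i p)) as Hxi. unfold cfield, rot, phi, lead. rewrite !dist_f0, NR_lf, NR_rf.
  set (s := xi i (zx i p) (zy i p)) in *. set (N := NR (zx i p) (zy i p)) in *.
  set (r := sqrt N) in *. assert (Hr2 : r * r = N) by (apply sqrt_sqrt; lra).
  assert (Hr : 2 <= r). { unfold r. rewrite <- (sqrt_square 2) by lra. apply sqrt_le_1_alt. lra. }
  set (M := N + / 12). assert (HM : N <= M <= N + / 12) by (unfold M; lra).
  assert (Hs : Rabs s / 2 <= 0.6 * r) by lra.
  assert (Hs' : - (0.6 * r) <= s / 2 <= 0.6 * r). { apply Rabs_le_between. unfold Rdiv. rewrite Rabs_mult, (Rabs_pos_eq (/ 2)); lra. }
  assert (HL : 1 <= M - s / 2) by nra. assert (HR : 1 <= M + s / 2) by nra.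
  assert (Hmax : forall a, 1 <= a -> ln (Rmax 1 (sqrt a)) = / 2 * ln a).
  { intros a Ha. rewrite Rmax_right by (rewrite <- sqrt_1; apply sqrt_le_1_alt; auto).
    assert (Hsa : 0 < sqrt a) by (apply sqrt_lt_R0; lra).
    rewrite <- (sqrt_sqrt a) at 2 by lra. rewrite ln_mult by auto. field. }
  rewrite !Hmax by auto. set (e := s / (2 * M)).
  replace (M - s / 2) with (M * (1 - e)) by (unfold e; field; lra).
  replace (M + s / 2) with (M * (1 + e)) by (unfold e; field; lra).
  assert (He : Rabs e * r <= 0.6).
  { unfold e, Rdiv. rewrite Rabs_mult, (Rabs_pos_eq (/ _)) by (left; apply Rinv_0_lt_compat; lra).
    apply Rle_trans with ((1.2 * r) * / (2 * N) * r).
    - apply Rmult_le_compat_r; [lra|]. apply Rmult_le_compat; auto using Rabs_pos.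
      + left; apply Rinv_0_lt_compat; lra.
      + apply Rinv_le_contravar; lra.
    - rewrite <- Hr2. replace (1.2 * r * / (2 * (r * r)) * r) with (1.2 / 2) by (field; lra). lra. }
  assert (He2 : Rabs e <= / 2) by (pose proof (Rabs_pos e); nra).
  assert (He3 := Rabs_le_between e (/ 2)). apply He3 in He2 as He4.
  rewrite !ln_mult by lra.
  replace (- Alog * (/ 2 * (ln M + ln (1 - e))) - - Alog * (/ 2 * (ln M + ln (1 + e))) - Alog * s / (2 * N))
    with (Alog * (/ 2 * (ln (1 + e) - ln (1 - e) - 2 * e) + (e - s / (2 * N)))) by (field; lra).
  assert (E1 : Rabs (ln (1 + e) - ln (1 - e) - 2 * e) * r ^ 3 <= 0.65).
  { apply Rle_trans with (3 * (Rabs e * r) ^ 3).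
    - rewrite Rpow_mult_distr, <- Rmult_assoc. apply Rmult_le_compat_r; [apply pow_le; lra|]. now apply log_ratio_cubic.
    - apply Rle_trans with (3 * 0.6 ^ 3); [|lra]. apply Rmult_le_compat_l; [lra|]. apply pow_incr. split; auto.
      apply Rmult_le_pos; [apply Rabs_pos|lra]. }
  assert (E2 : Rabs (e - s / (2 * N)) * r ^ 3 <= 0.1).
  { replace (e - s / (2 * N)) with (- (s * / (24 * (M * N)))) by (unfold e, M; field; split; nra).
    rewrite Rabs_Ropp, Rabs_mult, (Rabs_pos_eq (/ _)) by (left; apply Rinv_0_lt_compat; nra).
    apply Rle_trans with ((1.2 * r) * / (24 * (N * N)) * r ^ 3).
    - apply Rmult_le_compat_r; [apply pow_le; lra|]. apply Rmult_le_compat; auto using Rabs_pos.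
      + left; apply Rinv_0_lt_compat; nra.
      + apply Rinv_le_contravar; nra.
    - rewrite <- Hr2. replace (1.2 * r * / (24 * (r * r * (r * r))) * r ^ 3) with (1.2 / 24) by (field; lra). lra. }
  apply inv_cube_le; [lra|]. pose proof Alog_pos. pose proof Alog_lt.
  rewrite Rabs_mult, (Rabs_pos_eq Alog) by lra.
  assert (Hr3 : 0 < r ^ 3) by (apply pow_lt; lra).
  pose proof (Rabs_triang (/ 2 * (ln (1 + e) - ln (1 - e) - 2 * e)) (e - s / (2 * N))) as Htr.
  rewrite Rabs_mult, (Rabs_pos_eq (/ 2)) in Htr by lra.
  set (T := Rabs (/ 2 * (ln (1 + e) - ln (1 - e) - 2 * e) + (e - s / (2 * N)))) in *.
  assert (HT : T * r ^ 3 <= 1) by nra.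
  assert (0 <= T) by apply Rabs_pos. rewrite Rmult_assoc. nra.
Qed.

Lemma NR_coord x y : Rabs x <= 1.2 * sqrt (NR x y) /\ Rabs y <= 1.2 * sqrt (NR x y).
Proof.
  split.
  - pose proof (xi_bound d2 x y) as H. unfold xi in H; simpl in H. now replace (x * 1 - y * 0) with x in H by ring.
  - pose proof (xi_bound d1 x y) as H. unfold xi in H; simpl in H. replace (x * 0 - y * 1) with (- y) in H by ring.
    now rewrite Rabs_Ropp in H.
Qed.

(** * Decay of the strain, of its distance to the logarithmic field, and of its shifts *)

Definition rho (i : dir) (p : site) : R := sqrt (NR (zx i p) (zy i p)).

Lemma w_rho i p : w p <= 3 + 2.4 * rho i p.
Proof.
  unfold w, rho. destruct (NR_coord (zx i p) (zy i p)) as (H1 & H2). set (r := sqrt _) in *.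
  assert (A : Rabs (IZR (fst p)) <= Rabs (zx i p) + 5 / 6).
  { unfold zx. unfold Rabs; repeat destruct Rcase_abs; destruct i; lra. }
  assert (B : Rabs (IZR (snd p)) <= Rabs (zy i p) + 5 / 6).
  { unfold zy. unfold Rabs; repeat destruct Rcase_abs; destruct i; lra. }
  lra.
Qed.

Lemma rho_far i p : 8 <= w p -> 2 <= rho i p /\ w p <= 4 * rho i p /\ 4 <= NR (zx i p) (zy i p).
Proof.
  intros H. pose proof (w_rho i p). assert (Hr : 2 <= rho i p) by lra. repeat split; try lra.
  rewrite <- (sqrt_sqrt (NR (zx i p) (zy i p))) by apply NR_nonneg. fold (rho i p). nra.
Qed.

Lemma far_noncore i p : 8 <= w p -> p <> core i.
Proof.
  intros H ->. unfold w in H. destruct i; simpl in H; unfold Rabs in H; repeat destruct Rcase_abs; lra.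
Qed.

Lemma extend_bound_field (k K : nat) (b : field) C :
  (forall i p, INR K <= w p -> Rabs (b i p) <= C / w p ^ k) ->
  exists C', 0 < C' /\ forall i p, Rabs (b i p) <= C' / w p ^ k.
Proof.
  intros H.
  destruct (extend_bound k K (b d1) C (H d1)) as (C1 & P1 & H1).
  destruct (extend_bound k K (b d2) C (H d2)) as (C2 & P2 & H2).
  destruct (extend_bound k K (b d3) C (H d3)) as (C3 & P3 & H3).
  exists (C1 + C2 + C3). split; [lra|]. intros i p.
  assert (Hw : 0 < / w p ^ k) by (apply Rinv_0_lt_compat, pow_lt, w_pos).
  unfold Rdiv in *. specialize (H1 p). specialize (H2 p). specialize (H3 p). destruct i; nra.
Qed.

Lemma rho_pow_w i p k : 8 <= w p -> / rho i p ^ k <= 4 ^ k / w p ^ k.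
Proof.
  intros H. destruct (rho_far i p H) as (H1 & H2 & _). pose proof (w_pos p).
  assert (Hi : / rho i p <= 4 * / w p).
  { apply (Rmult_le_reg_r (rho i p * w p)); [nra|].
    replace (/ rho i p * (rho i p * w p)) with (w p) by (field; lra).
    replace (4 * / w p * (rho i p * w p)) with (4 * rho i p) by (field; lra). auto. }
  rewrite <- pow_inv. unfold Rdiv. rewrite <- pow_inv, <- Rpow_mult_distr. apply pow_incr. split; auto.
  left. apply Rinv_0_lt_compat. lra.
Qed.

Lemma lead_bound i x y : 1 <= NR x y -> Rabs (lead i x y) <= 1 / sqrt (NR x y).
Proof.
  intros HN. pose proof (xi_bound i x y) as Hx. unfold lead.
  set (s := xi i x y) in *. set (N := NR x y) in *. set (r := sqrt N) in *.
  assert (Hr2 : r * r = N) by (apply sqrt_sqrt; lra).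
  assert (Hr : 1 <= r). { unfold r. rewrite <- sqrt_1. apply sqrt_le_1_alt; auto. }
  pose proof Alog_pos. pose proof Alog_lt. rewrite <- Hr2. unfold Rdiv.
  rewrite !Rabs_mult, (Rabs_pos_eq Alog), (Rabs_pos_eq (/ _)) by (try lra; left; apply Rinv_0_lt_compat; nra).
  apply (Rmult_le_reg_r (r * r)); [nra|].
  replace (Alog * Rabs s * / (2 * (r * r)) * (r * r)) with (Alog * Rabs s / 2) by (field; lra).
  replace (1 * / r * (r * r)) with r by (field; lra). pose proof (Rabs_pos s). nra.
Qed.

(** 128 is twice 4^3: two third-order errors, and [w <= 4 * rho]. *)
Lemma alpha_c_far i p : 8 <= w p -> Rabs (alpha i p - cfield i p) <= 128 / w p ^ 3.
Proof.
  intros H. destruct (rho_far i p H) as (_ & _ & H4). rewrite alpha_noncore by now apply far_noncore.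
  pose proof (ang_lead i (zx i p) (zy i p)) as A. pose proof (cfield_lead i p H4) as B.
  pose proof (rho_pow_w i p 3 H) as Cc. unfold rho in Cc.
  assert (A' := A ltac:(lra)). clear A. unfold Rdiv in *.
  replace (ang i (zx i p) (zy i p) - cfield i p) with
    ((ang i (zx i p) (zy i p) - lead i (zx i p) (zy i p)) + - (cfield i p - lead i (zx i p) (zy i p))) by ring.
  eapply Rle_trans; [apply Rabs_triang|]. rewrite Rabs_Ropp. lra.
Qed.

Lemma c_far i p : 8 <= w p -> Rabs (cfield i p) <= 68 / w p.
Proof.
  intros H. destruct (rho_far i p H) as (H2 & _ & H4).
  pose proof (cfield_lead i p H4) as B. pose proof (lead_bound i (zx i p) (zy i p)) as A.
  assert (A' := A ltac:(lra)). clear A.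
  pose proof (rho_pow_w i p 3 H) as C3. pose proof (rho_pow_w i p 1 H) as C1. unfold rho in C3, C1.
  assert (Hw : / w p ^ 3 <= / w p).
  { apply Rinv_le_contravar; [apply w_pos|]. pose proof (w_ge1 p). simpl. nra. }
  rewrite !pow_1 in C1. unfold Rdiv in *.
  replace (cfield i p) with ((cfield i p - lead i (zx i p) (zy i p)) + lead i (zx i p) (zy i p)) by ring.
  eapply Rle_trans; [apply Rabs_triang|]. lra.
Qed.

Lemma alpha_c_bound : exists C, 0 < C /\ forall i p, Rabs (alpha i p - cfield i p) <= C / w p ^ 3.
Proof.
  apply (extend_bound_field 3 8 (fun i p => alpha i p - cfield i p) 128).
  intros i p H. apply alpha_c_far. replace 8 with (INR 8) by (simpl; lra). auto.
Qed.

Lemma c_bound : exists C, 0 < C /\ forall i p, Rabs (cfield i p) <= C / w p.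
Proof.
  destruct (extend_bound_field 1 8 cfield 68) as (C & HC & H).
  - intros i p H. rewrite pow_1. apply c_far. replace 8 with (INR 8) by (simpl; lra). auto.
  - exists C. split; auto. intros i p. rewrite <- (pow_1 (w p)). auto.
Qed.

Lemma alpha_bound : exists C, 0 < C /\ forall i p, Rabs (alpha i p) <= C / w p.
Proof.
  destruct alpha_c_bound as (C1 & H1 & B1). destruct c_bound as (C2 & H2 & B2).
  exists (C1 + C2). split; [lra|]. intros i p. specialize (B1 i p). specialize (B2 i p).
  assert (Hw : / w p ^ 3 <= / w p).
  { apply Rinv_le_contravar; [apply w_pos|]. pose proof (w_ge1 p). simpl. nra. }
  replace (alpha i p) with ((alpha i p - cfield i p) + cfield i p) by ring.
  eapply Rle_trans; [apply Rabs_triang|]. unfold Rdiv in *. nra.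
Qed.

Lemma lead_shift i x y sx sy : let s := sqrt (NR sx sy) in
  1 <= NR x y -> 4 * s + 4 <= sqrt (NR x y) -> 
  Rabs (lead i (x - sx) (y - sy) - lead i x y) <= (10 * s) / sqrt (NR x y) ^ 2.
Proof.
  intros s HN Hs. pose proof (sqrt_pos (NR sx sy)) as Hs0. fold s in Hs0.
  pose proof (xi_bound i x y) as Hx. pose proof (xi_bound i (x - sx) (y - sy)) as Hx'. pose proof (xi_bound i sx sy) as Hxs.
  fold s in Hxs.
  assert (E : xi i (x - sx) (y - sy) = xi i x y - xi i sx sy) by (unfold xi; ring).
  pose proof (NR_triangle (x - sx) (y - sy) sx sy) as T1.
  replace (x - sx + sx) with x in T1 by ring. replace (y - sy + sy) with y in T1 by ring.
  pose proof (NR_triangle x y (- sx) (- sy)) as T2.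
  replace (NR (- sx) (- sy)) with (NR sx sy) in T2 by (unfold NR; ring).
  replace (x + - sx) with (x - sx) in T2 by ring. replace (y + - sy) with (y - sy) in T2 by ring.
  fold s in T1, T2. unfold lead.
  set (a := xi i x y) in *. set (a' := xi i (x - sx) (y - sy)) in *. set (b := xi i sx sy) in *.
  set (N := NR x y) in *. set (N' := NR (x - sx) (y - sy)) in *.
  set (r := sqrt N) in *. set (r' := sqrt N') in *.
  assert (Hr2 : r * r = N) by (apply sqrt_sqrt; lra).
  assert (Hr2' : r' * r' = N') by (apply sqrt_sqrt; apply NR_nonneg).
  assert (Hr' : r / 2 <= r') by lra.
  assert (Hrp : 4 <= r) by lra.
  pose proof Alog_pos. pose proof Alog_lt.
  rewrite <- Hr2, <- Hr2'.
  replace (Alog * a' / (2 * (r' * r')) - Alog * a / (2 * (r * r))) with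
    (Alog / 2 * (- (b / (r * r)) + a' * (r * r - r' * r') / (r * r * (r' * r')))) by (rewrite E; field; lra).
  assert (HA : Rabs (- (b / (r * r))) * r ^ 2 <= 1.2 * s).
  { rewrite Rabs_Ropp. unfold Rdiv. rewrite Rabs_mult, (Rabs_pos_eq (/ _)) by (left; apply Rinv_0_lt_compat; nra).
    replace (Rabs b * / (r * r) * r ^ 2) with (Rabs b) by (field; lra). auto. }
  assert (HD : Rabs (r * r - r' * r') <= s * (2.5 * r)).
  { replace (r * r - r' * r') with ((r - r') * (r + r')) by ring. rewrite Rabs_mult.
    apply Rmult_le_compat; auto using Rabs_pos.
    - apply Rabs_le. lra.
    - rewrite Rabs_pos_eq; lra. }
  assert (HB : Rabs (a' * (r * r - r' * r') / (r * r * (r' * r'))) * r ^ 2 <= 6 * s).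
  { unfold Rdiv. rewrite !Rabs_mult, (Rabs_pos_eq (/ _)) by (left; apply Rinv_0_lt_compat; nra).
    apply Rle_trans with ((1.2 * r') * (s * (2.5 * r)) * / (r * r * (r' * r')) * r ^ 2).
    - apply Rmult_le_compat_r; [nra|]. apply Rmult_le_compat_r; [left; apply Rinv_0_lt_compat; nra|].
      apply Rmult_le_compat; auto using Rabs_pos.
    - replace (1.2 * r' * (s * (2.5 * r)) * / (r * r * (r' * r')) * r ^ 2) with (1.2 * 2.5 * s * (r / r')) by (field; lra).
      assert (r / r' <= 2). { apply (Rmult_le_reg_r r'); [lra|]. replace (r / r' * r') with r by (field; lra). lra. }
      nra. }
  set (P := - (b / (r * r))) in *. set (Q := a' * (r * r - r' * r') / (r * r * (r' * r'))) in *.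
  assert (Hr3 : 0 < r ^ 2) by nra. apply (Rmult_le_reg_r (r ^ 2)); auto.
  replace (10 * s / r ^ 2 * r ^ 2) with (10 * s) by (field; lra).
  rewrite Rabs_mult, (Rabs_pos_eq (Alog / 2)) by lra. pose proof (Rabs_triang P Q).
  assert (HPQ : Rabs (P + Q) * r ^ 2 <= 7.2 * s) by nra. pose proof (Rabs_pos (P + Q)).
  rewrite Rmult_assoc. assert (0 <= Rabs (P + Q) * r ^ 2) by (apply Rmult_le_pos; lra). nra.
Qed.

Definition strain (y : site -> R) : field := fun i p => red (grad y i p).

(** Moving the centre changes the leading term by order [/ r^2], which is square summable in the
    plane although [/ r] is not. So a moved configuration stays at finite l2 distance from the
    reference. *)
Lemma shifted_strain_bound (T : site -> site) sg sx sy : sg = 1 \/ sg = -1 ->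
  (forall p, X (T p) = sg * (X p - sx) /\ Y (T p) = sg * (Y p - sy)) ->
  exists C, 0 < C /\ forall i p, Rabs (strain (fun p => yhat (T p)) i p - alpha i p) <= C / w p ^ 2.
Proof.
  intros Hsg HT. set (s := sqrt (NR sx sy)). assert (Hs0 : 0 <= s) by apply sqrt_pos.
  (* Far enough that [r >= 4 * s + 4], so the shifted distance is at least [r / 2]. *)
  destruct (INR_unbounded (20 * s + 20)) as (K & HK).
  apply (extend_bound_field 2 K (fun i p => strain (fun p => yhat (T p)) i p - alpha i p) (16 * (10 * s + 9))).
  intros i p Hw. assert (H8 : 8 <= w p) by lra. pose proof (w_rho i p) as Hwr.
  destruct (rho_far i p H8) as (H2 & _ & H4). set (r := rho i p) in *.
  assert (Hr : 4 * s + 4 <= r) by lra.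
  pose proof (NR_triangle (zx i p - sx) (zy i p - sy) sx sy) as T1. fold s in T1.
  replace (zx i p - sx + sx) with (zx i p) in T1 by ring. replace (zy i p - sy + sy) with (zy i p) in T1 by ring.
  change (sqrt (NR (zx i p) (zy i p))) with r in T1.
  set (r' := sqrt (NR (zx i p - sx) (zy i p - sy))) in *.
  assert (Hr' : r / 2 <= r') by lra.
  assert (HN' : 1 <= NR (zx i p - sx) (zy i p - sy)).
  { rewrite <- (sqrt_sqrt (NR (zx i p - sx) (zy i p - sy))) by apply NR_nonneg. fold r'. nra. }
  destruct (grad_yhat_angle T sg sx sy i p Hsg HT) as (k & Hk); [lra|].
  assert (ES : strain (fun p => yhat (T p)) i p = ang i (zx i p - sx) (zy i p - sy)).
  { apply (red_unique _ _ k); auto. pose proof (ang_lt i (zx i p - sx) (zy i p - sy)). lra. }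
  rewrite ES, alpha_noncore by now apply far_noncore.
  pose proof (ang_lead i (zx i p - sx) (zy i p - sy) HN') as A1. fold r' in A1.
  pose proof (ang_lead i (zx i p) (zy i p)) as A2. assert (A2' := A2 ltac:(lra)). clear A2.
  change (sqrt (NR (zx i p) (zy i p))) with r in A2'.
  pose proof (lead_shift i (zx i p) (zy i p) sx sy) as A3. cbv zeta in A3. fold s in A3.
  change (sqrt (NR (zx i p) (zy i p))) with r in A3. assert (A3' := A3 ltac:(lra) ltac:(lra)). clear A3.
  pose proof (rho_pow_w i p 2 H8) as C2. fold r in C2.
  assert (B1 : 1 / r' ^ 3 <= 8 / r ^ 2).
  { apply Rle_trans with (1 / (r / 2) ^ 3).
    - unfold Rdiv at 1. rewrite Rmult_1_l. unfold Rdiv at 1. rewrite Rmult_1_l. apply Rinv_le_contravar; [apply pow_lt; lra|].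
      apply pow_incr. lra.
    - replace (1 / (r / 2) ^ 3) with (8 / r ^ 2 * / r) by (field; lra).
      rewrite <- (Rmult_1_r (8 / r ^ 2)) at 2. apply Rmult_le_compat_l.
      + apply Rdiv_le_0_compat; [lra|apply pow_lt; lra].
      + rewrite <- Rinv_1. apply Rinv_le_contravar; lra. }
  assert (B2 : 1 / r ^ 3 <= 1 / r ^ 2).
  { unfold Rdiv. rewrite !Rmult_1_l. apply Rinv_le_contravar; [apply pow_lt; lra|]. simpl. nra. }
  set (l' := lead i (zx i p - sx) (zy i p - sy)) in *. set (l := lead i (zx i p) (zy i p)) in *.
  replace (ang i (zx i p - sx) (zy i p - sy) - ang i (zx i p) (zy i p)) with
    ((ang i (zx i p - sx) (zy i p - sy) - l') + (l' - l) + - (ang i (zx i p) (zy i p) - l)) by ring.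
  eapply Rle_trans; [apply Rabs_triang|]. rewrite Rabs_Ropp.
  pose proof (Rabs_triang (ang i (zx i p - sx) (zy i p - sy) - l') (l' - l)).
  apply Rle_trans with ((10 * s + 9) * / r ^ 2); [unfold Rdiv in *; nra|].
  replace (4 ^ 2) with 16 in C2 by ring. unfold Rdiv in *. nra.
Qed.

Ltac mulpos := match goal with |- 0 <= _ * _ => apply Rmult_le_pos; mulpos | |- _ => lra end.

(** * The renormalised energy *)

(* Subtracting mu * c removes the part of the first variation that is not in l2: it does not change the
   sum over the bonds of a gradient, because c is a rotated gradient. *)
Definition Gd (psi : R -> R) (i : dir) (p : site) (t : R) : R :=
  psi (alpha i p + t) - psi (alpha i p) - Derive_n psi 2 0 * cfield i p * t.

Definition Fe (psi : R -> R) (b : field) : R := fsum (fun i p => Gd psi i p (b i p)).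

(** [C] bounds the squared norm, each unordered bond being counted once. *)
Definition l2f (b : field) (C : R) : Prop := forall l, NoDup l -> lsum (S3 (fsq b)) l <= C.

Lemma inv_w_le1 p : 0 < / w p <= 1.
Proof.
  split; [apply Rinv_0_lt_compat, w_pos|]. rewrite <- Rinv_1. apply Rinv_le_contravar; [lra|apply w_ge1].
Qed.

Lemma inv_w_pow p k : / w p ^ k = (/ w p) ^ k.
Proof. now rewrite pow_inv. Qed.

Lemma abs_le_sq a b : Rabs a <= b -> a ^ 2 <= b ^ 2.
Proof. intros H. rewrite <- pow2_abs. apply pow_incr. split; auto using Rabs_pos. Qed.

(** Isolates two quartic remainders of [psi] and a quadratic polynomial whose linear coefficient
    decays like [/ w^3] instead of [/ w]. *)
Lemma Gd_split psi i p t :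
  Gd psi i p t = (psi (alpha i p + t) - / 2 * Derive_n psi 2 0 * (alpha i p + t) ^ 2)
    - (psi (alpha i p) - / 2 * Derive_n psi 2 0 * alpha i p ^ 2)
    + / 2 * Derive_n psi 2 0 * t ^ 2 + Derive_n psi 2 0 * (alpha i p - cfield i p) * t.
Proof. unfold Gd. field. Qed.

(** For [|t| <= 1], [Gd_split] with [alpha^4] and [(alpha - cfield)^2] of order [/ w^4]; for larger
    [t], boundedness of [psi] and [|t| <= t^2]. *)
Lemma Gd_upper psi : psi_hyp psi ->
  exists C, 0 < C /\ forall i p t, Rabs (Gd psi i p t) <= C * (t ^ 2 + / w p ^ 4).
Proof.
  intros H. pose proof (psi_mu psi H) as Hmu. destruct (psi_quartic psi H) as (C4 & P4 & Q4).
  destruct (psi_bounded psi H) as (M & PM & QM). pose proof (psi_nonneg psi H) as Hnn.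
  destruct alpha_c_bound as (Cc & Pc & Qc). destruct c_bound as (Cb & Pb & Qb). destruct alpha_bound as (Ca & Pa & Qa).
  set (mu := Derive_n psi 2 0) in *.
  exists (9 * C4 * Ca ^ 4 + 8 * C4 + mu * (2 + Cc ^ 2) + M + mu * Cb). split.
  { assert (0 < Ca ^ 4) by now apply pow_lt. assert (0 < Cc ^ 2) by now apply pow_lt. nra. }
  intros i p t. pose proof (Qa i p) as A. pose proof (Qc i p) as B. pose proof (Qb i p) as D.
  pose proof (inv_w_le1 p) as Hw. unfold Rdiv in *. rewrite inv_w_pow in *. set (v := / w p) in *.
  assert (Hv4 : 0 < v ^ 4) by (apply pow_lt; lra). pose proof (pow2_ge_0 t) as Ht2.
  assert (HC4 : 0 <= Ca ^ 4) by (apply pow_le; lra). assert (HC2 : 0 <= Cc ^ 2) by (apply pow_le; lra).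
  destruct (Rle_dec (Rabs t) 1) as [Ht|Ht].
  - rewrite Gd_split. fold mu.
    pose proof (Q4 (alpha i p + t)) as R1. pose proof (Q4 (alpha i p)) as R2.
    assert (S1 : alpha i p ^ 4 <= Ca ^ 4 * v ^ 4).
    { rewrite <- Rpow_mult_distr. replace 4%nat with (2 * 2)%nat by lia. rewrite !pow_mult. apply pow_incr.
      split; [apply pow2_ge_0|]. now apply abs_le_sq. }
    assert (S2 : t ^ 4 <= t ^ 2).
    { assert (t ^ 2 <= 1 ^ 2) by now apply abs_le_sq. replace (t ^ 4) with (t ^ 2 * t ^ 2) by ring. nra. }
    assert (S3 : (alpha i p + t) ^ 4 <= 8 * (alpha i p ^ 4 + t ^ 4)).
    { set (x := alpha i p). assert (E : (x + t) ^ 2 <= 2 * (x ^ 2 + t ^ 2)) by (pose proof (pow2_ge_0 (x - t)); nra).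
      pose proof (pow2_ge_0 (x + t)). pose proof (pow2_ge_0 (x ^ 2 - t ^ 2)).
      replace ((x + t) ^ 4) with ((x + t) ^ 2 * (x + t) ^ 2) by ring.
      apply Rle_trans with (2 * (x ^ 2 + t ^ 2) * (2 * (x ^ 2 + t ^ 2))); [apply Rmult_le_compat; auto|]. nra. }
    assert (S4 : Rabs ((alpha i p - cfield i p) * t) <= t ^ 2 + Cc ^ 2 * v ^ 4).
    { rewrite Rabs_mult.
      assert (V : (alpha i p - cfield i p) ^ 2 <= Cc ^ 2 * v ^ 4).
      { apply abs_le_sq in B. rewrite Rpow_mult_distr, <- pow_mult in B. simpl (3 * 2)%nat in B.
        assert (v ^ 6 <= v ^ 4). { replace (v ^ 6) with (v ^ 4 * v ^ 2) by ring. assert (v ^ 2 <= 1 ^ 2) by (apply pow_incr; lra). nra. } nra. }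
      rewrite <- pow2_abs in V. rewrite <- (pow2_abs t).
      set (x := Rabs (alpha i p - cfield i p)) in *. set (z := Rabs t) in *.
      pose proof (pow2_ge_0 (x - z)). pose proof (pow2_ge_0 (x + z)). nra. }
    replace (mu * (alpha i p - cfield i p) * t) with (mu * ((alpha i p - cfield i p) * t)) by ring.
    apply Rabs_le_between in R1. apply Rabs_le_between in R2. apply Rabs_le_between in S4.
    set (y1 := psi (alpha i p + t) - _) in *. set (y2 := psi (alpha i p) - _) in *. set (y3 := (alpha i p - cfield i p) * t) in *.
    assert (T1' : C4 * (alpha i p + t) ^ 4 <= C4 * (8 * (Ca ^ 4 * v ^ 4 + t ^ 2))) by (apply Rmult_le_compat_l; lra).
    assert (T1 : - (8 * C4 * (Ca ^ 4 * v ^ 4 + t ^ 2)) <= y1 <= 8 * C4 * (Ca ^ 4 * v ^ 4 + t ^ 2)) by lra.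
    assert (T2' : C4 * alpha i p ^ 4 <= C4 * (Ca ^ 4 * v ^ 4)) by (apply Rmult_le_compat_l; lra).
    assert (T2 : - (C4 * (Ca ^ 4 * v ^ 4)) <= y2 <= C4 * (Ca ^ 4 * v ^ 4)) by lra.
    assert (T3 : - (mu * (t ^ 2 + Cc ^ 2 * v ^ 4)) <= mu * y3 <= mu * (t ^ 2 + Cc ^ 2 * v ^ 4)) by nra.
    assert (T4 : 0 <= C4 * Ca ^ 4 * t ^ 2) by mulpos.
    assert (T5 : 0 <= mu * Cc ^ 2 * t ^ 2) by mulpos.
    assert (T6 : 0 <= C4 * v ^ 4) by (apply Rmult_le_pos; lra).
    assert (T7 : 0 <= mu * v ^ 4) by (apply Rmult_le_pos; lra).
    assert (T8 : 0 <= M * (t ^ 2 + v ^ 4)) by (apply Rmult_le_pos; lra).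
    assert (T9 : 0 <= mu * Cb * (t ^ 2 + v ^ 4)) by mulpos.
    assert (T10 : 0 <= mu * t ^ 2) by (apply Rmult_le_pos; lra).
    apply Rabs_le. lra.
  - assert (Ht1 : 1 <= Rabs t) by lra. assert (Htt : Rabs t <= t ^ 2) by (rewrite <- pow2_abs; nra).
    unfold Gd. fold mu.
    assert (A1 : Rabs (psi (alpha i p + t) - psi (alpha i p)) <= M).
    { pose proof (QM (alpha i p + t)). pose proof (QM (alpha i p)). pose proof (Hnn (alpha i p + t)). pose proof (Hnn (alpha i p)).
      apply Rabs_le; lra. }
    assert (A2 : Rabs (mu * cfield i p * t) <= mu * Cb * t ^ 2).
    { rewrite !Rabs_mult, (Rabs_pos_eq mu) by lra. rewrite Rmult_assoc, (Rmult_assoc mu Cb). apply Rmult_le_compat_l; [lra|].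
      apply Rmult_le_compat; auto using Rabs_pos. eapply Rle_trans; [apply D|]. nra. }
    pose proof (Rabs_triang (psi (alpha i p + t) - psi (alpha i p)) (- (mu * cfield i p * t))) as Tr. rewrite Rabs_Ropp in Tr.
    assert (T3 : M <= M * t ^ 2) by nra.
    assert (T4 : 0 <= C4 * Ca ^ 4 * (t ^ 2 + v ^ 4)) by mulpos.
    assert (T5 : 0 <= mu * (2 + Cc ^ 2) * (t ^ 2 + v ^ 4)) by mulpos.
    assert (T6 : 0 <= C4 * (t ^ 2 + v ^ 4)) by (apply Rmult_le_pos; lra).
    assert (T8 : 0 <= M * v ^ 4) by (apply Rmult_le_pos; lra).
    assert (T9 : 0 <= mu * Cb * v ^ 4) by mulpos.
    unfold Rminus at 1. lra.
Qed.

(* Below, psi >= mu/2 (.)^2 makes G_b quadratic from below as long as the strain stays in [-1/2,1/2]. *)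
Lemma Gd_lower_reduced psi : psi_hyp psi ->
  exists C, 0 < C /\ forall i p t, Rabs (alpha i p + t) <= / 2 ->
    / 2 * Derive_n psi 2 0 * t ^ 2 + Derive_n psi 2 0 * (alpha i p - cfield i p) * t - C / w p ^ 4 <= Gd psi i p t.
Proof.
  intros H. destruct (psi_quartic psi H) as (C4 & P4 & Q4). destruct alpha_bound as (Ca & Pa & Qa).
  exists (C4 * Ca ^ 4). split; [apply Rmult_lt_0_compat; [auto|now apply pow_lt]|].
  intros i p t Ht. rewrite Gd_split. pose proof (psi_lower psi H _ Ht) as A. pose proof (Q4 (alpha i p)) as B.
  apply Rabs_le_between in B. pose proof (Qa i p) as D. unfold Rdiv in *. rewrite inv_w_pow in *. set (v := / w p) in *.
  assert (S1 : alpha i p ^ 4 <= Ca ^ 4 * v ^ 4).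
  { rewrite <- Rpow_mult_distr. replace 4%nat with (2 * 2)%nat by lia. rewrite !pow_mult. apply pow_incr.
    split; [apply pow2_ge_0|]. now apply abs_le_sq. }
  assert (C4 * alpha i p ^ 4 <= C4 * Ca ^ 4 * v ^ 4) by nra. lra.
Qed.

(** While the strain stays in [-1/2, 1/2] the square can be completed. Once it leaves, [|t| >= / 6]
    because [|alpha| <= / 3], and only [- psi alpha] and the linear term can be negative, both of
    order [t^2 / w]. The decaying factor of [t^2] makes tails uniformly small on l2-bounded sets. *)
Lemma Gd_lower psi : psi_hyp psi ->
  exists C, 0 < C /\ forall i p t, - (C / w p ^ 4) - C / w p * t ^ 2 <= Gd psi i p t.
Proof.
  intros H. pose proof (psi_mu psi H) as Hmu. destruct (psi_quartic psi H) as (C4 & P4 & Q4).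
  pose proof (psi_nonneg psi H) as Hnn. destruct (Gd_lower_reduced psi H) as (Cr & Pr & Qr).
  destruct alpha_c_bound as (Cc & Pc & Qc). destruct c_bound as (Cb & Pb & Qb). destruct alpha_bound as (Ca & Pa & Qa).
  set (mu := Derive_n psi 2 0) in *.
  exists (Cr + mu * Cc ^ 2 + 36 * (mu + C4) * Ca ^ 2 + 6 * mu * Cb).
  assert (HC2 : 0 < Cc ^ 2) by now apply pow_lt. assert (HA2 : 0 < Ca ^ 2) by now apply pow_lt.
  assert (Z1 : 0 < mu * Cc ^ 2) by now apply Rmult_lt_0_compat. assert (Z2 : 0 < (mu + C4) * Ca ^ 2) by (apply Rmult_lt_0_compat; lra).
  assert (Z3 : 0 < mu * Cb) by now apply Rmult_lt_0_compat.
  split; [lra|]. intros i p t. pose proof (Qa i p) as A. pose proof (Qc i p) as B. pose proof (Qb i p) as D.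
  pose proof (Qr i p t) as Hr.
  pose proof (inv_w_le1 p) as Hw. unfold Rdiv in *. rewrite inv_w_pow in *. set (v := / w p) in *.
  assert (Hv4 : 0 < v ^ 4) by (apply pow_lt; lra). pose proof (pow2_ge_0 t) as Ht2.
  set (K := Cr + mu * Cc ^ 2 + 36 * (mu + C4) * Ca ^ 2 + 6 * mu * Cb).
  destruct (Rle_dec (Rabs (alpha i p + t)) (/ 2)) as [Hl|Hl].
  - specialize (Hr Hl). fold mu in Hr.
    assert (V : (alpha i p - cfield i p) ^ 2 <= Cc ^ 2 * v ^ 4).
    { apply abs_le_sq in B. rewrite Rpow_mult_distr, <- pow_mult in B. simpl (3 * 2)%nat in B.
      assert (v ^ 6 <= v ^ 4). { replace (v ^ 6) with (v ^ 4 * v ^ 2) by ring. assert (v ^ 2 <= 1 ^ 2) by (apply pow_incr; lra). nra. } nra. }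
    set (x := alpha i p - cfield i p) in *.
    assert (W : 0 <= mu * (x + t) ^ 2) by (apply Rmult_le_pos; [lra|apply pow2_ge_0]).
    assert (W2 : mu * x ^ 2 <= mu * (Cc ^ 2 * v ^ 4)) by (apply Rmult_le_compat_l; lra).
    assert (W3 : 0 <= K * v * t ^ 2) by (unfold K; mulpos).
    assert (W4 : 0 <= (36 * (mu + C4) * Ca ^ 2 + 6 * mu * Cb) * v ^ 4) by (apply Rmult_le_pos; lra).
    assert (W5 : 0 <= mu * x ^ 2) by (apply Rmult_le_pos; [lra|apply pow2_ge_0]).
    unfold K in *. nra.
  - assert (Ht6 : / 6 <= Rabs t).
    { pose proof (alpha_le i p). pose proof (Rabs_triang (alpha i p) t). lra. }
    assert (Ht36 : 1 <= 36 * t ^ 2) by (rewrite <- pow2_abs; nra).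
    assert (Htt : Rabs t <= 6 * t ^ 2) by (rewrite <- pow2_abs; nra).
    unfold Gd. fold mu. pose proof (Hnn (alpha i p + t)) as N1.
    assert (N2 : psi (alpha i p) <= (mu + C4) * (Ca ^ 2 * v)).
    { pose proof (Q4 (alpha i p)) as E. apply Rabs_le_between in E. pose proof (alpha_le i p) as E3.
      assert (E1 : alpha i p ^ 2 <= Ca ^ 2 * v).
      { apply abs_le_sq in A. rewrite Rpow_mult_distr in A. assert (v ^ 2 <= v) by nra. nra. }
      assert (E2 : alpha i p ^ 4 <= alpha i p ^ 2).
      { apply abs_le_sq in E3. replace (alpha i p ^ 4) with (alpha i p ^ 2 * alpha i p ^ 2) by ring.
        pose proof (pow2_ge_0 (alpha i p)). nra. }
      pose proof (pow2_ge_0 (alpha i p)). nra. }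
    assert (N3 : Rabs (mu * cfield i p * t) <= mu * Cb * v * (6 * t ^ 2)).
    { rewrite !Rabs_mult, (Rabs_pos_eq mu) by lra. rewrite !Rmult_assoc. apply Rmult_le_compat_l; [lra|].
      rewrite <- Rmult_assoc. apply Rmult_le_compat; auto using Rabs_pos. }
    apply Rabs_le_between in N3.
    assert (W1 : (mu + C4) * (Ca ^ 2 * v) <= (mu + C4) * Ca ^ 2 * v * (36 * t ^ 2)).
    { assert (0 <= (mu + C4) * Ca ^ 2 * v) by mulpos. nra. }
    assert (W2 : 0 <= K * v ^ 4) by (apply Rmult_le_pos; unfold K; lra).
    assert (W3 : 0 <= (Cr + mu * Cc ^ 2) * v * t ^ 2) by mulpos.
    unfold K in *. nra.
Qed.

Lemma l2f_fsummable b C : l2f b C -> fsummable (fsq b).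
Proof.
  intros H i. exists C. intros l Hl. eapply Rle_trans; [|apply (H l Hl)]. apply lsum_le. intros p _.
  rewrite Rabs_pos_eq by (unfold fsq; apply pow2_ge_0). apply (S3_comp (fsq b) p i). intros; unfold fsq; apply pow2_ge_0.
Qed.

Lemma fsummable_w4 : fsummable (fun _ p => / w p ^ 4).
Proof. intros i. apply summable_w4. Qed.

Lemma Gd_summable psi b C : psi_hyp psi -> l2f b C -> fsummable (fun i p => Gd psi i p (b i p)).
Proof.
  intros H Hb. destruct (Gd_upper psi H) as (K & PK & QK).
  apply (fsummable_le _ (fun i p => K * (fsq b i p + / w p ^ 4))); [intros; apply QK|].
  apply fsummable_scal, fsummable_plus; [now apply (l2f_fsummable b C)|apply fsummable_w4].
Qed.

Lemma l2f_sum b C : l2f b C -> fsum (fsq b) <= C.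
Proof. intros H. apply (Tsum_le_bound _ nil); [apply summable_S3; eapply l2f_fsummable; eauto|]. intros k Hk _. now apply H. Qed.

Lemma l2f_of_sum b : fsummable (fsq b) -> l2f b (fsum (fsq b)).
Proof.
  intros H l Hl. apply lsum_le_Tsum; auto using summable_S3. intros p. apply S3_nonneg. intros; apply pow2_ge_0.
Qed.

Lemma fsq_summable_minus a b : fsummable (fsq a) -> fsummable (fsq b) -> fsummable (fsq (fun i p => a i p - b i p)).
Proof.
  intros Ha Hb. apply (fsummable_le _ (fun i p => 2 * fsq a i p + 2 * fsq b i p)).
  - intros i p. unfold fsq. rewrite Rabs_pos_eq by apply pow2_ge_0. pose proof (pow2_ge_0 (a i p + b i p)). nra.
  - apply fsummable_plus; now apply fsummable_scal.
Qed.

(** * Continuity of the renormalised energy in l2 *)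

Lemma Gd_continuous psi : psi_hyp psi -> forall i p t eps, 0 < eps ->
  exists delta, 0 < delta /\ forall s, Rabs (s - t) <= delta -> Rabs (Gd psi i p s - Gd psi i p t) <= eps.
Proof.
  intros H i p t eps He.
  assert (Hc : continuous (Gd psi i p) t).
  { unfold Gd. apply (continuous_minus (fun t => psi (alpha i p + t) - psi (alpha i p)) (fun t => Derive_n psi 2 0 * cfield i p * t)).
    - apply (continuous_minus (fun t => psi (alpha i p + t)) (fun _ => psi (alpha i p))); [|apply continuous_const].
      apply (continuous_comp (fun t => alpha i p + t) psi); [|apply H].
      apply (continuous_plus (fun _ => alpha i p) (fun t => t)); [apply continuous_const|apply continuous_id].
    - apply (continuous_mult (fun _ => Derive_n psi 2 0 * cfield i p) (fun t => t)); [apply continuous_const|apply continuous_id]. }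
  assert (Hl : locally (Gd psi i p t) (fun y => Rabs (y - Gd psi i p t) < eps)) by (exists (mkposreal eps He); intros y Hy; exact Hy).
  destruct (Hc _ Hl) as (d & Hd). exists (d / 2). pose proof (cond_pos d). split; [lra|].
  intros s Hs. left. apply Hd. change (Rabs (s - t) < d). lra.
Qed.

Lemma Gd_continuous_list psi : psi_hyp psi -> forall (d : field) l eps, 0 < eps ->
  exists delta, 0 < delta /\ forall b : field, (forall i p, In p l -> Rabs (b i p - d i p) <= delta) ->
    lsum (fun p => Rabs (S3 (fun i p => Gd psi i p (b i p)) p - S3 (fun i p => Gd psi i p (d i p)) p)) l <= eps.
Proof.
  intros H d. induction l as [|p l IH]; intros eps He.
  - exists 1. split; [lra|]. intros; simpl; lra.
  - destruct (IH (eps / 2)) as (e0 & P0 & Q0); [lra|].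
    destruct (Gd_continuous psi H d1 p (d d1 p) (eps / 6)) as (e1 & P1 & Q1); [lra|].
    destruct (Gd_continuous psi H d2 p (d d2 p) (eps / 6)) as (e2 & P2 & Q2); [lra|].
    destruct (Gd_continuous psi H d3 p (d d3 p) (eps / 6)) as (e3 & P3 & Q3); [lra|].
    set (e := Rmin (Rmin e0 e1) (Rmin e2 e3)).
    assert (He' : 0 < e /\ e <= e0 /\ e <= e1 /\ e <= e2 /\ e <= e3).
    { unfold e, Rmin. repeat destruct Rle_dec; lra. }
    exists e. split; [tauto|]. intros b Hb. cbn [lsum].
    assert (A : lsum (fun p => Rabs (S3 (fun i p => Gd psi i p (b i p)) p - S3 (fun i p => Gd psi i p (d i p)) p)) l <= eps / 2).
    { apply Q0. intros i q Hq. eapply Rle_trans; [apply Hb; now right|]. tauto. }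
    assert (Hbp : forall i, Rabs (b i p - d i p) <= e) by (intros; apply Hb; now left).
    pose proof (Q1 (b d1 p)) as B1. pose proof (Q2 (b d2 p)) as B2. pose proof (Q3 (b d3 p)) as B3.
    pose proof (Hbp d1). pose proof (Hbp d2). pose proof (Hbp d3).
    assert (B1' := B1 ltac:(lra)). assert (B2' := B2 ltac:(lra)). assert (B3' := B3 ltac:(lra)).
    apply Rabs_le_between in B1'. apply Rabs_le_between in B2'. apply Rabs_le_between in B3'.
    assert (Rabs (S3 (fun i p => Gd psi i p (b i p)) p - S3 (fun i p => Gd psi i p (d i p)) p) <= eps / 2); [|lra].
    unfold S3. apply Rabs_le. lra.
Qed.

Definition outl (l0 : list site) (p : site) : bool := if in_dec site_eq_dec p l0 then false else true.
Definition insl (l0 : list site) (p : site) : bool := if in_dec site_eq_dec p l0 then true else false.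

Lemma lsum_split_site (h : site -> R) l0 l : lsum h l = lsum h (filter (insl l0) l) + lsum h (filter (outl l0) l).
Proof.
  induction l as [|f l IH]; simpl; [lra|]. unfold insl at 1, outl at 1. destruct in_dec; simpl; lra.
Qed.

Lemma insl_In l0 l p : In p (filter (insl l0) l) <-> In p l /\ In p l0.
Proof. rewrite filter_In. unfold insl. destruct in_dec; intuition congruence. Qed.
Lemma outl_In l0 l p : In p (filter (outl l0) l) <-> In p l /\ ~ In p l0.
Proof. rewrite filter_In. unfold outl. destruct in_dec; intuition congruence. Qed.

(** Pointwise continuity of [Gd] on finitely many cells; outside them [Gd_upper] and the small tail
    of [d]. *)
Lemma Fe_continuous psi (d : field) C eps : psi_hyp psi -> l2f d C -> 0 < eps ->
  exists delta, 0 < delta /\ forall b C', l2f b C' -> l2f (fun i p => b i p - d i p) delta ->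
    Rabs (Fe psi b - Fe psi d) < eps.
Proof.
  intros H Hd He. destruct (Gd_upper psi H) as (K & PK & QK).
  set (e := eps / (16 * K)). assert (Pe : 0 < e) by (unfold e; apply Rdiv_lt_0_compat; lra).
  assert (EK : K * e = eps / 16) by (unfold e; field; lra).
  destruct (Tsum_tail (S3 (fun i p => fsq d i p + / w p ^ 4)) e) as (l0 & N0 & T0); auto.
  { apply summable_S3, fsummable_plus; [now apply (l2f_fsummable d C)|apply fsummable_w4]. }
  destruct (Gd_continuous_list psi H d l0 (eps / 4)) as (d0 & P0 & Q0); [lra|].
  (* [l2f] bounds squares, so pointwise closeness [d0] requires [d0 ^ 2]. *)
  exists (Rmin e (d0 ^ 2)). split. { apply Rmin_pos; auto. now apply pow_lt. }
  intros b C' Hb Hbd.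
  assert (Hs1 : fsummable (fun i p => Gd psi i p (b i p))) by (eapply Gd_summable; eauto).
  assert (Hs2 : fsummable (fun i p => Gd psi i p (d i p))) by (eapply Gd_summable; eauto).
  assert (Hbnd : forall l, NoDup l -> Rabs (lsum (S3 (fun i p => Gd psi i p (b i p) - Gd psi i p (d i p))) l) <= eps * 3 / 4).
  { intros l Hl. eapply Rle_trans; [apply lsum_abs|]. rewrite (lsum_split_site _ l0).
    assert (A : lsum (fun p => Rabs (S3 (fun i p => Gd psi i p (b i p) - Gd psi i p (d i p)) p)) (filter (insl l0) l) <= eps / 4).
    { eapply Rle_trans; [apply (lsum_incl _ _ l0)|].
      - now apply NoDup_filter.
      - intros p Hp. apply insl_In in Hp. tauto.
      - intros; apply Rabs_pos.
      - eapply Rle_trans; [|apply (Q0 b)].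
        + right. apply lsum_ext. intros p _. f_equal. unfold S3. ring.
        + intros i p _. assert (E : (b i p - d i p) ^ 2 <= d0 ^ 2).
          { eapply Rle_trans; [|eapply Rle_trans; [apply (Hbd [p])|apply Rmin_r]].
            - simpl. rewrite Rplus_0_r. apply (S3_comp (fsq (fun i p => b i p - d i p)) p i). intros; apply pow2_ge_0.
            - constructor; [intros []|constructor]. }
          apply Rsqr_incr_0_var; [|lra]. unfold Rsqr. rewrite <- pow2_abs in E. simpl in E. lra. }
    assert (B : lsum (fun p => Rabs (S3 (fun i p => Gd psi i p (b i p) - Gd psi i p (d i p)) p)) (filter (outl l0) l)
       <= K * (2 * e + 4 * e)).
    { assert (Nf : NoDup (filter (outl l0) l)) by now apply NoDup_filter.
      assert (T1 := T0 _ Nf (fun p Hp => proj2 (proj1 (outl_In _ _ _) Hp))).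
      assert (T2 := Hbd _ Nf). assert (T3 := Rmin_l e (d0 ^ 2)).
      eapply Rle_trans; [apply (lsum_le _ (fun p => K * (2 * S3 (fsq (fun i p => b i p - d i p)) p
          + 4 * Rabs (S3 (fun i p => fsq d i p + / w p ^ 4) p))))|].
      - intros p _. rewrite (Rabs_pos_eq (S3 (fun i p => fsq d i p + / w p ^ 4) p)).
        2:{ apply S3_nonneg. intros. pose proof (pow2_ge_0 (d i p0)). unfold fsq.
            assert (0 < / w p0 ^ 4) by (apply Rinv_0_lt_compat, pow_lt, w_pos). lra. }
        assert (A1 : forall i, Rabs (Gd psi i p (b i p) - Gd psi i p (d i p)) <= K * (2 * (b i p - d i p) ^ 2 + 4 * (d i p ^ 2 + / w p ^ 4))).
        { intros i. pose proof (QK i p (b i p)) as U1. pose proof (QK i p (d i p)) as U2.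
          eapply Rle_trans; [apply Rabs_triang|]. rewrite Rabs_Ropp.
          assert (Hw4 : 0 < / w p ^ 4) by (apply Rinv_0_lt_compat, pow_lt, w_pos).
          assert (b i p ^ 2 <= 2 * (b i p - d i p) ^ 2 + 2 * d i p ^ 2) by (pose proof (pow2_ge_0 (b i p - 2 * d i p)); nra).
          pose proof (pow2_ge_0 (d i p)). nra. }
        unfold S3, fsq. pose proof (A1 d1) as V1. pose proof (A1 d2) as V2. pose proof (A1 d3) as V3.
        eapply Rle_trans; [apply Rabs_triang|]. eapply Rle_trans; [apply Rplus_le_compat_r, Rabs_triang|]. lra.
      - rewrite lsum_scal, lsum_plus, !lsum_scal. apply Rmult_le_compat_l; lra. }
    lra. }
  assert (E : Fe psi b - Fe psi d = fsum (fun i p => Gd psi i p (b i p) - Gd psi i p (d i p))).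
  { unfold Fe. now rewrite fsum_minus. }
  assert (Hs3 : summable (S3 (fun i p => Gd psi i p (b i p) - Gd psi i p (d i p)))) by now apply summable_S3, fsummable_minus.
  rewrite E. apply Rle_lt_trans with (eps * 3 / 4); [|lra].
  apply Rabs_le. split.
  - apply (Tsum_ge _ nil); auto. intros k Hk _. specialize (Hbnd k Hk). apply Rabs_le_between in Hbnd. lra.
  - apply (Tsum_le_bound _ nil); auto. intros k Hk _. specialize (Hbnd k Hk). apply Rabs_le_between in Hbnd. lra.
Qed.

(** * Ordered bonds *)

Definition obonds (p : site) : list (site * site) :=
  [(bs d1 p, be d1 p); (be d1 p, bs d1 p); (bs d2 p, be d2 p); (be d2 p, bs d2 p); (bs d3 p, be d3 p); (be d3 p, bs d3 p)].
Definition OB (l : list site) : list (site * site) := flat_map obonds l.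

Lemma vsub_pos p q : vsub (pos p) (pos q) = vv (IZR (fst p - fst q)) (IZR (snd p - snd q)).
Proof. rewrite !pos_vv. unfold vsub, vv, X, Y; simpl. rewrite !minus_IZR. f_equal; field. Qed.

Lemma bond_NZ p q : bond p q <-> NZ (fst p - fst q) (snd p - snd q) = 1%Z.
Proof.
  unfold bond. rewrite vsub_pos, vnorm_vv, <- IZR_NZ. split.
  - intros H. apply eq_IZR. rewrite <- (sqrt_sqrt (IZR _)) by (apply IZR_le, NZ_nonneg). rewrite H. lra.
  - intros ->. apply sqrt_1.
Qed.

Lemma in_OB l p q : In (p, q) (OB l) <->
  exists i r, In r l /\ ((p = bs i r /\ q = be i r) \/ (p = be i r /\ q = bs i r)).
Proof.
  unfold OB. rewrite in_flat_map. split.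
  - intros (r & Hr & H). unfold obonds in H. simpl In in H.
    destruct H as [H|[H|[H|[H|[H|[H|[]]]]]]]; injection H as <- <-.
    + exists d1, r. auto.
    + exists d1, r. auto.
    + exists d2, r. auto.
    + exists d2, r. auto.
    + exists d3, r. auto.
    + exists d3, r. auto.
  - intros (i & r & Hr & H). exists r. split; auto. unfold obonds.
    destruct i; destruct H as [(-> & ->)|(-> & ->)]; simpl; auto 10.
Qed.

Lemma bond_cases p q : bond p q -> exists i r, (p = bs i r /\ q = be i r) \/ (p = be i r /\ q = bs i r).
Proof.
  rewrite bond_NZ. destruct p as [a b], q as [c d]. simpl. intros H.
  assert (Hab : (a - c = 0 /\ (b - d = 1 \/ b - d = -1) \/ a - c = 1 /\ (b - d = 0 \/ b - d = -1) \/ a - c = -1 /\ (b - d = 0 \/ b - d = 1))%Z).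
  { unfold NZ in H. set (x := (a - c)%Z) in *. set (y := (b - d)%Z) in *.
    assert (Hx : (-2 < x < 2)%Z).
    { pose proof (Z.square_nonneg (x + 2 * y)). assert (3 * (x * x) <= 4)%Z by lia. nia. }
    assert (Hy : (-2 < y < 2)%Z).
    { pose proof (Z.square_nonneg (2 * x + y)). assert (3 * (y * y) <= 4)%Z by lia. nia. }
    assert (Hx' : (x = -1 \/ x = 0 \/ x = 1)%Z) by lia. assert (Hy' : (y = -1 \/ y = 0 \/ y = 1)%Z) by lia.
    destruct Hx' as [->|[->| ->]], Hy' as [->|[->| ->]]; lia. }
  destruct Hab as [(H1 & [H2|H2])|[(H1 & [H2|H2])|(H1 & [H2|H2])]].
  - exists d2, (c, d). right. unfold bs, be, sh; simpl. split; f_equal; lia.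
  - exists d2, (a, b). left. unfold bs, be, sh; simpl. split; f_equal; lia.
  - exists d1, (c, d). right. unfold bs, be, sh; simpl. split; f_equal; lia.
  - exists d3, (c, b). left. unfold bs, be, sh; simpl. split; f_equal; lia.
  - exists d1, (a, b). left. unfold bs, be, sh; simpl. split; f_equal; lia.
  - exists d3, (a, d). right. unfold bs, be, sh; simpl. split; f_equal; lia.
Qed.

Lemma bond_bs_be i r : bond (bs i r) (be i r) /\ bond (be i r) (bs i r).
Proof.
  rewrite !bond_NZ. destruct r as [a b]. unfold NZ. destruct i; unfold bs, be, sh; simpl fst; simpl snd; split; ring_simplify; lia.
Qed.

Lemma NoDup_flat_map {A B} (f : A -> list B) l : NoDup l -> (forall a, NoDup (f a)) ->
  (forall a a' b, In b (f a) -> In b (f a') -> a = a') -> NoDup (flat_map f l).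
Proof.
  intros Hl Hf Hd. induction l as [|a l IH]; simpl; [constructor|]. inversion Hl; subst.
  apply NoDup_app; auto. intros b Hb Hb'. apply in_flat_map in Hb'. destruct Hb' as (a' & Ha' & Hb').
  rewrite (Hd a a' b) in H1 by auto. contradiction.
Qed.

Lemma obonds_inj i j r r' : (bs i r = bs j r' /\ be i r = be j r') \/ (bs i r = be j r' /\ be i r = bs j r') ->
  r = r' /\ i = j.
Proof.
  destruct r as [a b], r' as [c d]. destruct i, j; unfold bs, be, sh; simpl; intros [(H1 & H2)|(H1 & H2)];
  inversion H1; inversion H2; split; try reflexivity; try (f_equal; lia); exfalso; lia.
Qed.

Lemma OB_bond_list l : NoDup l -> bond_list (OB l).
Proof.
  intros Hl. split.
  - apply NoDup_flat_map; auto.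
    + intros [a b]. unfold obonds, bs, be, sh; simpl fst; simpl snd.
      repeat constructor; simpl; intros H; repeat destruct H as [H|H]; try contradiction; inversion H; lia.
    + intros r r' [p q] H H'. 
      assert (A : In (p, q) (OB [r])) by (unfold OB; simpl; rewrite ?app_nil_r; auto).
      assert (B : In (p, q) (OB [r'])) by (unfold OB; simpl; rewrite ?app_nil_r; auto).
      apply in_OB in A. apply in_OB in B. destruct A as (i & x & [<-|[]] & A), B as (j & y & [<-|[]] & B).
      apply (obonds_inj i j). destruct A as [(-> & ->)|(-> & ->)], B as [(A1 & A2)|(A1 & A2)]; rewrite ?A1, ?A2 in *; auto.
  - apply Forall_forall. intros [p q] H. apply in_OB in H. destruct H as (i & r & _ & [(-> & ->)|(-> & ->)]); apply bond_bs_be.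
Qed.

Lemma bond_list_in_OB l : bond_list l -> exists N, incl l (OB (box N)).
Proof.
  intros (_ & H). induction l as [|[p q] l IH].
  - exists 0%nat. intros x [].
  - inversion H; subst. destruct (IH H3) as (N & HN). simpl in H2. destruct (bond_cases p q H2) as (i & r & Hr).
    destruct (in_some_box [r]) as (M & HM). exists (N + M)%nat.
    intros [p' q'] [E|Hx].
    + inversion E; subst. apply in_OB. exists i, r. split; auto. apply (box_incl M); [lia|]. apply HM; now left.
    + apply HN, in_OB in Hx. apply in_OB. destruct Hx as (i' & r' & Hr' & Hx). exists i', r'. split; auto.
      apply (box_incl N); auto. lia.
Qed.

Lemma sum_list_lsum f l : sum_list f l = lsum (fun b => f (fst b) (snd b)) l.
Proof. induction l as [|b l IH]; simpl; [reflexivity|]. now rewrite IH. Qed.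
Lemma sumsq_lsum g l : sumsq g l = lsum (fun b => g (fst b) (snd b) ^ 2) l.
Proof. induction l as [|b l IH]; [reflexivity|]. cbn [sumsq lsum]. now rewrite IH. Qed.

Lemma lsum_OB (f : site -> site -> R) (b : field) l :
  (forall i p, f (bs i p) (be i p) = b i p) -> (forall i p, f (be i p) (bs i p) = b i p) ->
  lsum (fun b => f (fst b) (snd b)) (OB l) = 2 * lsum (S3 b) l.
Proof.
  intros H1 H2. unfold OB. rewrite lsum_flat_map, <- lsum_scal. apply lsum_ext. intros p _.
  unfold obonds. cbn [lsum fst snd]. rewrite !H1, !H2. unfold S3. ring.
Qed.

(** Any admissible list is compared with the ordered bonds of a large box, since bonds with zero
    increment contribute nothing; the factor 2 accounts for the two orientations. *)
Lemma E0_value_eq psi u e (b : field) l : E0_value psi u e -> 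
  (forall i p, bond_energy psi u (bs i p) (be i p) = b i p) -> (forall i p, bond_energy psi u (be i p) (bs i p) = b i p) ->
  (forall i p, grad u i p = 0 -> b i p = 0) -> NoDup l -> fsupp (grad u) l -> e = 2 * lsum (S3 b) l.
Proof.
  intros (l' & Hl' & Hsupp & ->) H1 H2 H0 Hl Hs. destruct (bond_list_in_OB l' Hl') as (N & HN).
  assert (Hsb : forall a, S3 b a <> 0 -> In a l).
  { intros a Ha. destruct (in_dec site_eq_dec a l) as [|Hn]; auto. exfalso. apply Ha.
    assert (E : forall i, b i a = 0).
    { intros i. apply H0. destruct (Req_dec (grad u i a) 0); auto. exfalso; apply Hn, (Hs i); auto. }
    unfold S3. rewrite !E. ring. }
  rewrite sum_list_lsum.
  assert (Hfz : forall x, In x (OB (box N)) -> ~ In x l' -> bond_energy psi u (fst x) (snd x) = 0).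
  { intros [p q] Hx Hn. apply in_OB in Hx. destruct Hx as (i & r & _ & Hx). simpl.
    assert (Hb : bond p q) by (destruct Hx as [(-> & ->)|(-> & ->)]; apply bond_bs_be).
    assert (HD : D u p q = 0) by (destruct (Req_dec (D u p q) 0) as [|Hne]; auto; exfalso; apply Hn, Hsupp; auto).
    unfold bond_energy. rewrite HD, Rplus_0_r. ring. }
  rewrite (lsum_incl_eq _ l' (OB (box N))).
  - rewrite (lsum_OB _ b) by auto. f_equal. apply lsum_supp_eq; auto using box_NoDup.
    intros a Ha. destruct (in_dec site_eq_dec a (box N)) as [|Hn]; auto. exfalso. apply Ha.
    assert (E : forall i, b i a = 0).
    { intros i. rewrite <- H1. unfold bond_energy.
      assert (HD : D u (bs i a) (be i a) = 0).
      { destruct (Req_dec (D u (bs i a) (be i a)) 0) as [|Hne]; auto. exfalso. apply Hn.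
        assert (Hi : In (bs i a, be i a) (OB (box N))) by (apply HN, Hsupp; auto; apply bond_bs_be).
        apply in_OB in Hi. destruct Hi as (j & r & Hr & Hj).
        destruct (obonds_inj i j a r) as (-> & _); auto. }
      rewrite HD, Rplus_0_r. ring. }
    unfold S3. rewrite !E. ring.
  - apply Hl'.
  - apply OB_bond_list, box_NoDup.
  - auto.
  - auto.
Qed.

Lemma W0_supp u : W0 u -> exists N, fsupp (grad u) (box N).
Proof.
  intros (_ & Rb & H). destruct (INR_unbounded (1.2 * Rabs Rb + 2)) as (N & HN). exists N. intros i p Hp.
  destruct (H (bs i p) (be i p)) as (H1 & _); [apply bond_bs_be|exact Hp|].
  rewrite pos_vv, vnorm_vv in H1. destruct (NR_coord (X (bs i p)) (Y (bs i p))) as (A & B).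
  pose proof (Rle_abs Rb). apply in_box.
  assert (E1 : Rabs (X (bs i p)) < INR N - 2) by lra. assert (E2 : Rabs (Y (bs i p)) < INR N - 2) by lra.
  apply Rabs_def2 in E1. apply Rabs_def2 in E2. unfold X, Y in E1, E2.
  assert (F1 : Rabs (IZR (fst p)) <= INR N).
  { apply Rabs_le. destruct i; unfold bs, sh in E1; simpl in E1; rewrite ?plus_IZR in E1; lra. }
  assert (F2 : Rabs (IZR (snd p)) <= INR N).
  { apply Rabs_le. destruct i; unfold bs, sh in E2; simpl in E2; rewrite ?plus_IZR in E2; lra. }
  rewrite <- abs_IZR, INR_IZR_INZ in F1, F2. split; now apply le_IZR.
Qed.

Lemma psi_mod psi x y (k : Z) : psi_hyp psi -> x = y + IZR k -> psi x = psi y.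
Proof. intros H ->. now apply psi_shift. Qed.

Lemma psi_alpha psi i p t : psi_hyp psi -> psi (grad yhat i p + t) = psi (alpha i p + t).
Proof.
  intros H. unfold alpha. destruct (red_mod (grad yhat i p)) as (k & Hk). apply (psi_mod psi _ _ k H). rewrite Hk. ring.
Qed.

Lemma psi_even psi : psi_hyp psi -> forall x, psi (- x) = psi x.
Proof. intros H. apply H. Qed.

(** * Identification of the energy on [W0] with twice [Fe] *)

Definition local_energy (psi : R -> R) (u : site -> R) : field :=
  fun i p => psi (alpha i p + grad u i p) - psi (alpha i p).

Lemma bond_energy_bs psi u i p : psi_hyp psi -> bond_energy psi u (bs i p) (be i p) = local_energy psi u i p.
Proof.
  intros H. unfold bond_energy, local_energy. change (D yhat (bs i p) (be i p)) with (grad yhat i p).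
  change (D u (bs i p) (be i p)) with (grad u i p). rewrite psi_alpha by auto.
  rewrite <- (Rplus_0_r (grad yhat i p)), psi_alpha, Rplus_0_r by auto. reflexivity.
Qed.
Lemma bond_energy_be psi u i p : psi_hyp psi -> bond_energy psi u (be i p) (bs i p) = local_energy psi u i p.
Proof.
  intros H. rewrite <- bond_energy_bs by auto. unfold bond_energy, D.
  rewrite <- (psi_even psi H (yhat (bs i p) - yhat (be i p) + _)), <- (psi_even psi H (yhat (bs i p) - yhat (be i p))).
  f_equal; [|f_equal]; f_equal; ring.
Qed.

Lemma E0_box psi u e l : psi_hyp psi -> E0_value psi u e -> NoDup l -> fsupp (grad u) l ->
  e = 2 * lsum (S3 (local_energy psi u)) l.
Proof.
  intros H He Hl Hs. apply (E0_value_eq psi u e (local_energy psi u) l He); auto.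
  - intros; now apply bond_energy_bs.
  - intros; now apply bond_energy_be.
  - intros i p E. unfold local_energy. rewrite E, Rplus_0_r. ring.
Qed.

Lemma l2f_fin b l : NoDup l -> fsupp b l -> l2f b (lsum (S3 (fsq b)) l).
Proof.
  intros Hl H. assert (Hs : fsupp (fsq b) l).
  { intros i p Hp. apply (H i). intros E. apply Hp. unfold fsq. rewrite E. ring. }
  rewrite <- (fsum_fin (fsq b) l Hl Hs). apply l2f_of_sum. eapply fsupp_summable; eauto.
Qed.

Lemma fsum_c_grad_fin u l : fsupp (grad u) l -> fsum (fun i p => cfield i p * grad u i p) = 0.
Proof.
  intros H. unfold cfield. rewrite (sbp_field_fin phi (grad u) l H). rewrite (Tsum_ext _ (fun _ => 0)).
  - rewrite (Tsum_fin _ nil); [reflexivity|constructor|intros p E; lra].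
  - intros p. unfold F2. rewrite !curl_grad. ring.
Qed.

(** The renormalising term sums to zero: [cfield] is [rot phi] and a gradient has no circulation. *)
Lemma Fe_W0 psi u l : psi_hyp psi -> NoDup l -> fsupp (grad u) l ->
  Fe psi (grad u) = lsum (S3 (local_energy psi u)) l.
Proof.
  intros H Hl Hs.
  assert (Hsc : fsupp (fun i p => cfield i p * grad u i p) l).
  { intros i p Hp. apply (Hs i). intros E; apply Hp; rewrite E; ring. }
  assert (Hse : fsupp (local_energy psi u) l).
  { intros i p Hp. apply (Hs i). intros E; apply Hp. unfold local_energy. rewrite E, Rplus_0_r. ring. }
  rewrite <- (fsum_fin _ l Hl Hse). unfold Fe.
  rewrite (fsum_ext _ (fun i p => local_energy psi u i p - Derive_n psi 2 0 * (cfield i p * grad u i p))).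
  2:{ intros i p. unfold Gd, local_energy. ring. }
  rewrite fsum_minus, fsum_scal, (fsum_c_grad_fin u l Hs); eauto using fsupp_summable.
  - ring.
  - apply fsummable_scal. eapply fsupp_summable; eauto.
Qed.

Lemma E0_Fe psi u e : psi_hyp psi -> W0 u -> E0_value psi u e -> e = 2 * Fe psi (grad u).
Proof.
  intros H Hu He. destruct (W0_supp u Hu) as (N & HN).
  rewrite (Fe_W0 psi u (box N)); auto using box_NoDup. apply E0_box; auto using box_NoDup.
Qed.

Lemma in_l2_l2f (g : site -> site -> R) (b : field) C : 
  (forall i p, g (bs i p) (be i p) = b i p) -> (forall i p, g (be i p) (bs i p) = - b i p) ->
  (forall x, partial_sq_sums g x -> x <= C) -> l2f b (C / 2).
Proof.
  intros H1 H2 H l Hl. specialize (H (sumsq g (OB l))).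
  assert (E : sumsq g (OB l) = 2 * lsum (S3 (fsq b)) l).
  { rewrite sumsq_lsum. apply (lsum_OB (fun p q => g p q ^ 2)).
    - intros. now rewrite H1.
    - intros. rewrite H2. unfold fsq. ring. }
  rewrite E in H. assert (2 * lsum (S3 (fsq b)) l <= C); [|lra]. apply H. exists (OB l). split; auto. now apply OB_bond_list.
Qed.

Lemma l2f_in_l2 (g : site -> site -> R) (b : field) C : 
  (forall i p, g (bs i p) (be i p) = b i p) -> (forall i p, g (be i p) (bs i p) = - b i p) ->
  l2f b C -> forall x, partial_sq_sums g x -> x <= 2 * C.
Proof.
  intros H1 H2 H x (l & Hl & ->). destruct (bond_list_in_OB l Hl) as (N & HN). rewrite sumsq_lsum.
  eapply Rle_trans; [apply (lsum_incl _ l (OB (box N))); auto|].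
  - apply Hl.
  - intros; apply pow2_ge_0.
  - rewrite (lsum_OB (fun p q => g p q ^ 2) (fsq b)).
    + specialize (H (box N) (box_NoDup N)). lra.
    + intros. now rewrite H1.
    + intros. rewrite H2. unfold fsq. ring.
Qed.

Lemma D_bs (u : site -> R) i p : D u (bs i p) (be i p) = grad u i p.
Proof. reflexivity. Qed.
Lemma D_be (u : site -> R) i p : D u (be i p) (bs i p) = - grad u i p.
Proof. unfold D, grad. ring. Qed.

Lemma W12_l2f u : W12 u -> exists C, l2f (grad u) C.
Proof.
  intros (_ & C & HC). exists (C / 2). apply (in_l2_l2f (D u)); auto using D_bs, D_be.
Qed.

Lemma l2f_W12 u C : u xi0 = 0 -> l2f (grad u) C -> W12 u.
Proof.
  intros H0 H. split; auto. exists (2 * C). apply (l2f_in_l2 (D u) (grad u)); auto using D_bs, D_be.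
Qed.

Lemma l2norm_sq g C : (forall x, partial_sq_sums g x -> x <= C) -> forall x, partial_sq_sums g x -> x <= l2norm g ^ 2.
Proof.
  intros HC x Hx. unfold l2norm. destruct (Lub_Rbar_correct (partial_sq_sums g)) as (H1 & H2).
  assert (H0 : partial_sq_sums g 0). { exists nil. split; [split; constructor|reflexivity]. }
  specialize (H2 (Finite C)). assert (Hle : Rbar_le (Lub_Rbar (partial_sq_sums g)) C) by (apply H2; intros y Hy; now apply HC).
  pose proof (H1 x Hx) as A. pose proof (H1 0 H0) as B.
  destruct (Lub_Rbar (partial_sq_sums g)) as [L| |]; simpl in *; try contradiction.
  rewrite Rmult_1_r, sqrt_sqrt; auto.
Qed.

Lemma l2norm_small u v Cu Cv delta : l2f (grad u) Cu -> l2f (grad v) Cv -> 0 < delta ->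
  l2norm (fun p q => D u p q - D v p q) < delta -> l2f (fun i p => grad u i p - grad v i p) (delta ^ 2).
Proof.
  intros Hu Hv Hd H. set (g := fun p q => D u p q - D v p q) in *.
  assert (H1 : forall i p, g (bs i p) (be i p) = grad u i p - grad v i p) by (intros; unfold g; now rewrite !D_bs).
  assert (H2 : forall i p, g (be i p) (bs i p) = - (grad u i p - grad v i p)) by (intros; unfold g; rewrite !D_be; ring).
  assert (Hs : fsummable (fsq (fun i p => grad u i p - grad v i p))).
  { apply fsq_summable_minus; eapply l2f_fsummable; eauto. }
  pose proof (l2f_in_l2 g _ _ H1 H2 (l2f_of_sum _ Hs)) as HC.
  pose proof (in_l2_l2f g _ _ H1 H2 (l2norm_sq g _ HC)) as HR.
  assert (Hn : 0 <= l2norm g) by apply sqrt_pos.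
  intros l Hl. specialize (HR l Hl). nra.
Qed.

(** * Invariance under lattice symmetries *)

(** A map of sites with its actions on bonds and faces. A point reflection reverses bonds, whence
    [sg = -1], but it is a half turn and preserves orientation, so [curl_spec] keeps the sign of the
    charges. [rng] bounds the enlargement of boxes, which is what limits over boxes require. *)
Record lattice_sym := {
  sT : site -> site;
  sg : R;
  sx : R;
  sy : R;
  tau : dir -> site -> site;
  taui : dir -> site -> site;
  rng : nat;
  Tf : face -> face;
  Tfi : face -> face;
  sg_spec : sg = 1 \/ sg = -1;
  coord_spec : forall p, X (sT p) = sg * (X p - sx) /\ Y (sT p) = sg * (Y p - sy);
  tau_l : forall i p, taui i (tau i p) = p;
  tau_r : forall i p, tau i (taui i p) = p;
  tau_box : forall i p N, In p (box N) -> In (tau i p) (box (N + rng));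
  taui_box : forall i p N, In p (box N) -> In (taui i p) (box (N + rng));
  grad_spec : forall v i p, grad (fun q => v (sT q)) i p = sg * grad v i (tau i p);
  Tf_l : forall f, Tfi (Tf f) = f;
  Tf_r : forall f, Tf (Tfi f) = f;
  Tf_box : forall f N, In (fst (Tf f)) (box N) -> In (fst f) (box (N + rng));
  curl_spec : forall b f, curl (fun i p => sg * b i (tau i p)) f = curl b (Tf f);
  D2_spec : forall f g, D2 (Tf f) (Tf g) = D2 f g
}.

Lemma box_growth f B K s : (forall p, ~ In p (box K) -> f p <= B) ->
  lsum f (box (K + s)) <= lsum f (box K) + B * ((2 * INR (K + s) + 1) ^ 2 - (2 * INR K + 1) ^ 2).
Proof.
  intros H. assert (A := lsum_incl_neg (fun p => f p - B) (box K) (box (K + s))).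
  rewrite !lsum_minus, !lsum_const, !length_box in A.
  assert (lsum f (box (K + s)) - B * (2 * INR (K + s) + 1) ^ 2 <= lsum f (box K) - B * (2 * INR K + 1) ^ 2); [|lra].
  apply A; auto using box_NoDup.
  - apply box_incl. lia.
  - intros p _ Hp. specialize (H p Hp). lra.
Qed.

Lemma inv_sqrt_small C eps : 0 < eps -> exists K0, (1 <= K0)%nat /\ forall K, (K0 <= K)%nat -> C / sqrt (INR K) <= eps.
Proof.
  intros He. destruct (INR_unbounded (1 + (C / eps) ^ 2)) as (K0 & HK). exists (S K0). split; [lia|]. intros K Hk.
  assert (H1 : 1 + (C / eps) ^ 2 < INR K) by (eapply Rlt_le_trans; [exact HK|apply le_INR; lia]).
  pose proof (pow2_ge_0 (C / eps)).
  assert (Hs : 0 < sqrt (INR K)) by (apply sqrt_lt_R0; lra).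
  assert (H2 : C / eps <= sqrt (INR K)).
  { eapply Rle_trans; [apply Rle_abs|]. rewrite <- sqrt_Rsqr_abs. apply sqrt_le_1_alt. unfold Rsqr. lra. }
  apply (Rmult_le_reg_r (sqrt (INR K) / eps)); [now apply Rdiv_lt_0_compat|].
  replace (C / sqrt (INR K) * (sqrt (INR K) / eps)) with (C / eps) by (field; lra).
  replace (eps * (sqrt (INR K) / eps)) with (sqrt (INR K)) by (field; lra). auto.
Qed.

(** A square root in place of the logarithm is good enough: a shell of order [K] cells, times
    [sqrt K], times the decay [/ K^2] of [dmoved], still tends to 0. *)
Lemma phi_bound p s : Rabs (phi (p, s)) <= sqrt (w p).
Proof.
  unfold phi. rewrite dist_f0. pose proof Alog_pos. pose proof Alog_lt. pose proof (w_ge1 p) as Hw.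
  set (x := IZR (fx (p, s)) / 3). set (y := IZR (fy (p, s)) / 3).
  assert (Hx : Rabs x <= w p).
  { unfold x, fx, w; simpl fst; simpl snd. rewrite plus_IZR, mult_IZR. 
    pose proof (Rabs_pos (IZR (snd p))). destruct s; unfold Rabs in *; repeat destruct Rcase_abs; lra. }
  assert (Hy : Rabs y <= w p).
  { unfold y, fy, w; simpl fst; simpl snd. rewrite plus_IZR, mult_IZR.
    pose proof (Rabs_pos (IZR (fst p))). destruct s; unfold Rabs in *; repeat destruct Rcase_abs; lra. }
  assert (HN : NR x y <= 4 * (w p * w p)).
  { apply abs_le_sq in Hx. apply abs_le_sq in Hy. unfold NR. pose proof (pow2_ge_0 (x - y)). nra. }
  assert (Hd : sqrt (NR x y) <= 2 * w p).
  { rewrite <- (sqrt_square (2 * w p)) by lra. apply sqrt_le_1_alt. lra. }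
  set (r := Rmax 1 (sqrt (NR x y))).
  assert (Hr : 1 <= r <= 2 * w p). { unfold r. split; [apply Rmax_l|apply Rmax_lub; lra]. }
  assert (Hln : 0 <= ln r). { rewrite <- ln_1. apply ln_le; lra. }
  rewrite Rabs_mult, Rabs_Ropp, !Rabs_pos_eq by lra.
  set (q := sqrt (w p)). assert (Hq : q * q = w p) by (apply sqrt_sqrt; lra).
  assert (Hq1 : 1 <= q). { unfold q. rewrite <- sqrt_1. now apply sqrt_le_1_alt. }
  assert (Hl2 : ln r <= 2 * (1.5 * q)).
  { apply Rle_trans with (ln ((1.5 * q) * (1.5 * q))).
    - apply ln_le; nra.
    - rewrite ln_mult by lra. pose proof (ln_succ_le (1.5 * q - 1)).
      replace (1 + (1.5 * q - 1)) with (1.5 * q) in H1 by ring. lra. }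
  nra.
Qed.

Lemma red_sg (s : lattice_sym) x : red (sg s * x) = sg s * red x.
Proof.
  destruct (sg_spec s) as [-> | ->].
  - now rewrite !Rmult_1_l.
  - replace (-1 * x) with (- x) by ring. rewrite red_opp. ring.
Qed.

Definition moved (s : lattice_sym) (u : site -> R) : site -> R := fun p => yhat (sT s p) + u (sT s p).

Lemma strain_moved s u i p :
  strain (moved s u) i p = sg s * strain (fun p => yhat p + u p) i (tau s i p).
Proof.
  unfold strain, moved. rewrite (grad_spec s (fun p => yhat p + u p)). apply red_sg.
Qed.

(** Not a gradient in general: its circulations are the moved charges minus the reference charge at
    [f0]. *)
Definition dmoved (s : lattice_sym) (u : site -> R) : field := fun i p => strain (moved s u) i p - alpha i p.

Lemma strain_out u l i p : fsupp (grad u) l -> ~ In p l -> strain (fun p => yhat p + u p) i p = alpha i p.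
Proof.
  intros H Hp. unfold strain, alpha. f_equal.
  assert (E : grad u i p = 0) by (destruct (Req_dec (grad u i p) 0); auto; exfalso; apply Hp, (H i); auto).
  unfold grad in *. lra.
Qed.

Lemma dmoved_bound s u N : fsupp (grad u) (box N) ->
  exists C, 0 < C /\ forall i p, Rabs (dmoved s u i p) <= C / w p ^ 2.
Proof.
  intros H. destruct (shifted_strain_bound (sT s) (sg s) (sx s) (sy s) (sg_spec s) (coord_spec s)) as (C & PC & QC).
  apply (extend_bound_field 2 (2 * (N + rng s) + 2) (dmoved s u) C). intros i p Hw.
  assert (Hp : ~ In (tau s i p) (box N)).
  { intros Hi. apply (taui_box s i) in Hi. rewrite tau_l in Hi. apply in_box in Hi.
    unfold w in Hw. rewrite <- !abs_IZR, INR_IZR_INZ, <- !plus_IZR in Hw. apply le_IZR in Hw. lia. }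
  unfold dmoved. rewrite strain_moved, (strain_out u (box N)) by auto.
  replace (sg s * alpha i (tau s i p)) with (strain (fun p => yhat (sT s p)) i p); [apply QC|].
  unfold strain, alpha. rewrite (grad_spec s yhat). apply red_sg.
Qed.

Lemma dmoved_curl s u f : curl (dmoved s u) f = curl (strain (fun p => yhat p + u p)) (Tf s f) - ind f0 f.
Proof.
  unfold dmoved. rewrite (curl_minus (strain (moved s u)) alpha), curl_alpha. f_equal.
  rewrite <- curl_spec. unfold curl. rewrite !strain_moved. reflexivity.
Qed.

Lemma strain_curl_out u N f : fsupp (grad u) (box N) -> ~ In (fst f) (box (S N)) ->
  curl (strain (fun p => yhat p + u p)) f = ind f0 f.
Proof.
  intros H Hf. rewrite <- curl_alpha.
  assert (E : forall i a b, (-1 <= a <= 1)%Z -> (-1 <= b <= 1)%Z -> strain (fun p => yhat p + u p) i (sh a b (fst f)) = alpha i (sh a b (fst f))).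
  { intros i a b Ha Hb. apply (strain_out u (box N)); auto. intros Hi. apply Hf. apply in_box. apply in_box in Hi.
    unfold sh in Hi; simpl in Hi. lia. }
  assert (E0 : forall i, strain (fun p => yhat p + u p) i (fst f) = alpha i (fst f)).
  { intros i. rewrite <- (sh_0 (fst f)). apply E; lia. }
  unfold curl. rewrite !E0, !E by lia. reflexivity.
Qed.

Lemma dmoved_curl_supp s u N : fsupp (grad u) (box N) -> hsupp (curl (dmoved s u)) (box (S N + 2 + rng s)).
Proof.
  intros H p t Hp. rewrite dmoved_curl in Hp.
  destruct (in_dec site_eq_dec (fst (Tf s (p, t))) (box (S N + 2))) as [Hi|Hn].
  - apply (Tf_box s (p, t) (S N + 2)) in Hi. exact Hi.
  - rewrite (strain_curl_out u N) in Hp; auto.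
    2:{ intros Hi. apply Hn. apply (box_incl (S N)); [lia|auto]. }
    unfold ind in Hp. destruct (face_eq_dec f0 (p, t)) as [E|E].
    + inversion E; subst. apply in_box. simpl. lia.
    + destruct (face_eq_dec f0 (Tf s (p, t))) as [E'|E']; [|lra]. exfalso. apply Hn. rewrite <- E'. apply in_box. simpl; lia.
Qed.

Lemma lsum_tau_le s i (f : site -> R) R : (forall p, 0 <= f p) ->
  lsum (fun p => f (tau s i p)) (box R) <= lsum f (box (R + rng s)).
Proof.
  intros Hf. rewrite <- (lsum_map (tau s i) f). apply lsum_incl; auto.
  - apply FinFun.Injective_map_NoDup; [|apply box_NoDup]. intros x y E. now rewrite <- (tau_l s i x), E, tau_l.
  - intros p Hp. apply in_map_iff in Hp. destruct Hp as (q & <- & Hq). now apply tau_box.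
Qed.

(** As [psi >= 0], the moved sum over a box is at most the original sum over a box larger by [rng].
    The extra shell costs [O(/ R)] of reference energy, because [psi alpha] is of order [/ w^2]. *)
Lemma psi_energy_moved psi s u N : psi_hyp psi -> fsupp (grad u) (box N) -> forall eps, 0 < eps ->
  exists K0, forall R, (K0 <= R)%nat ->
    lsum (S3 (fun i p => psi (strain (moved s u) i p) - psi (alpha i p))) (box R) <= Fe psi (grad u) + eps.
Proof.
  intros H Hs eps He. pose proof (psi_nonneg psi H) as Hnn.
  destruct (psi_quartic psi H) as (C4 & P4 & Q4). pose proof (psi_mu psi H) as Hmu. destruct alpha_bound as (Ca & Pa & Qa).
  set (mu := Derive_n psi 2 0) in *. set (k := INR (rng s)). assert (Hk : 0 <= k) by apply pos_INR.
  set (B0 := 3 * (mu + C4) * Ca ^ 2). assert (HB0 : 0 <= B0) by (unfold B0; assert (0 < Ca ^ 2) by (now apply pow_lt); mulpos).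
  destruct (inv_sqrt_small (B0 * (12 * k + 4 * k ^ 2)) eps He) as (K0 & HK1 & HK0).
  exists (K0 + N)%nat. intros R HR.
  assert (HR1 : 1 <= INR R) by (replace 1 with (INR 1) by reflexivity; apply le_INR; lia).
  assert (A : lsum (S3 (fun i p => psi (strain (moved s u) i p))) (box R) <=
     lsum (S3 (fun i p => psi (grad (fun p => yhat p + u p) i p))) (box (R + rng s))).
  { unfold S3. rewrite !lsum_plus.
    assert (E : forall i, lsum (fun p => psi (strain (moved s u) i p)) (box R) <= lsum (fun p => psi (grad (fun p => yhat p + u p) i p)) (box (R + rng s))).
    { intros i. eapply Rle_trans; [|apply (lsum_tau_le s i)]; [|auto]. right. apply lsum_ext. intros p _.
      rewrite strain_moved. unfold strain. rewrite <- red_sg, psi_red by auto.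
      destruct (sg_spec s) as [-> | ->]; [now rewrite Rmult_1_l|].
      replace (-1 * grad (fun p => yhat p + u p) i (tau s i p)) with (- grad (fun p => yhat p + u p) i (tau s i p)) by ring.
      now rewrite psi_even. }
    pose proof (E d1); pose proof (E d2); pose proof (E d3). lra. }
  assert (B : lsum (S3 (fun i p => psi (grad (fun p => yhat p + u p) i p))) (box (R + rng s)) =
     Fe psi (grad u) + lsum (S3 (fun i p => psi (alpha i p))) (box (R + rng s))).
  { rewrite (Fe_W0 psi u (box (R + rng s))); auto using box_NoDup.
    - rewrite <- lsum_plus. apply lsum_ext. intros p _. unfold S3, local_energy.
      assert (E : forall i, psi (grad (fun p => yhat p + u p) i p) = psi (alpha i p + grad u i p)).
      { intros i. rewrite <- psi_alpha by auto. f_equal. unfold grad. ring. }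
      rewrite !E. ring.
    - intros i p Hp. apply (box_incl N); [lia|]. now apply (Hs i). }
  assert (Cc : lsum (S3 (fun i p => psi (alpha i p))) (box (R + rng s)) <=
     lsum (S3 (fun i p => psi (alpha i p))) (box R) + B0 / INR R ^ 2 * ((2 * INR (R + rng s) + 1) ^ 2 - (2 * INR R + 1) ^ 2)).
  { apply box_growth. intros p Hp. apply w_out_box in Hp.
    assert (E : forall i, psi (alpha i p) <= (mu + C4) * Ca ^ 2 / INR R ^ 2).
    { intros i. pose proof (Q4 (alpha i p)) as E1. apply Rabs_le_between in E1. pose proof (alpha_le i p) as E2.
      pose proof (Qa i p) as E3. apply abs_le_sq in E3. apply abs_le_sq in E2.
      pose proof (pow2_ge_0 (alpha i p)) as E4.
      assert (E5 : alpha i p ^ 4 <= alpha i p ^ 2) by (replace (alpha i p ^ 4) with (alpha i p ^ 2 * alpha i p ^ 2) by ring; nra).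
      assert (E6 : (Ca / w p) ^ 2 <= Ca ^ 2 / INR R ^ 2).
      { unfold Rdiv. rewrite Rpow_mult_distr, pow_inv. apply Rmult_le_compat_l; [apply pow2_ge_0|].
        apply Rinv_le_contravar; [apply pow_lt; lra|]. apply pow_incr. lra. }
      apply Rle_trans with ((mu + C4) * alpha i p ^ 2); [nra|].
      replace ((mu + C4) * Ca ^ 2 / INR R ^ 2) with ((mu + C4) * (Ca ^ 2 / INR R ^ 2)) by (field; lra).
      apply Rmult_le_compat_l; lra. }
    unfold S3. pose proof (E d1); pose proof (E d2); pose proof (E d3). unfold B0.
    replace (3 * (mu + C4) * Ca ^ 2 / INR R ^ 2) with (3 * ((mu + C4) * Ca ^ 2 / INR R ^ 2)) by (field; lra). lra. }
  assert (Dd : B0 / INR R ^ 2 * ((2 * INR (R + rng s) + 1) ^ 2 - (2 * INR R + 1) ^ 2) <= eps).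
  { eapply Rle_trans; [|apply (HK0 R); lia]. rewrite plus_INR. fold k.
    set (r := INR R) in *. assert (Hsr : 0 < sqrt r) by (apply sqrt_lt_R0; lra).
    assert (Hsr2 : sqrt r <= r). { rewrite <- (sqrt_square r) at 2 by lra. apply sqrt_le_1_alt. nra. }
    apply Rle_trans with (B0 * (12 * k + 4 * k ^ 2) / r).
    - apply (Rmult_le_reg_r (r ^ 2)); [apply pow_lt; lra|].
      replace (B0 / r ^ 2 * ((2 * (r + k) + 1) ^ 2 - (2 * r + 1) ^ 2) * r ^ 2) with (B0 * (8 * r * k + 4 * k ^ 2 + 4 * k)) by (field; lra).
      replace (B0 * (12 * k + 4 * k ^ 2) / r * r ^ 2) with (B0 * ((12 * k + 4 * k ^ 2) * r)) by (field; lra).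
      apply Rmult_le_compat_l; auto. nra.
    - unfold Rdiv. apply Rmult_le_compat_l; [pose proof (pow2_ge_0 k); mulpos|]. now apply Rinv_le_contravar. }
  unfold S3 in *. repeat rewrite ?lsum_plus, ?lsum_minus in *. lra.
Qed.

(** Summation by parts with [phi] truncated outside [box (S K)]. For large [K] all charges lie where
    nothing was truncated, and only a shell of cells produces an error. *)
Lemma c_sum_moved s u N : fsupp (grad u) (box N) -> forall eps, 0 < eps ->
  exists K0, forall R, (K0 <= R)%nat ->
    Rabs (lsum (S3 (fun i p => cfield i p * dmoved s u i p)) (box R) - Tsum (F2 (fun f => phi f * curl (dmoved s u) f))) <= eps.
Proof.
  intros Hs eps He. destruct (dmoved_bound s u N Hs) as (Cd & Pd & Qd).
  pose proof (dmoved_curl_supp s u N Hs) as Hcs. set (N1 := (S N + 2 + rng s)%nat) in *.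
  set (d := dmoved s u) in *.
  (* A jump of [phK] is at most [6 * sqrt K], a cell has 3 bonds, and the shell has
     [16 K + 24 <= 40 K] cells. *)
  destruct (inv_sqrt_small (6 * Cd * 3 * 40) eps He) as (K0 & HK1 & HK0).
  exists (K0 + N1)%nat. intros K HK.
  assert (HK1' : 1 <= INR K) by (replace 1 with (INR 1) by reflexivity; apply le_INR; lia).
  set (phK := fun f : face => if in_dec site_eq_dec (fst f) (box (S K)) then phi f else 0).
  assert (Hph : hsupp phK (box (S K))).
  { intros p t Hp. unfold phK in Hp. cbn [fst] in Hp. destruct in_dec; [auto|]. now contradiction Hp. }
  assert (E1 : Tsum (F2 (fun f => phi f * curl d f)) = fsum (fun i p => rot phK i p * d i p)).
  { rewrite (sbp_face_fin phK d _ Hph). apply Tsum_ext. intros p. unfold F2.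
    assert (E : forall t, phK (p, t) * curl d (p, t) = phi (p, t) * curl d (p, t)).
    { intros t. unfold phK. cbn [fst]. destruct in_dec as [|Hn]; auto.
      destruct (Req_dec (curl d (p, t)) 0) as [->|Hne]; [ring|]. exfalso. apply Hn.
      apply (box_incl N1); [lia|]. apply (Hcs p t). auto. }
    unfold U, V. now rewrite !E. }
  assert (Hcell : forall i p, (fst (lf i p) = p \/ fst (lf i p) = sh (-1) 0 p) /\ (fst (rf i p) = p \/ fst (rf i p) = sh 0 (-1) p)).
  { intros i p. destruct i; simpl; auto. }
  assert (Hbox : forall M q a b, (-1 <= a <= 1)%Z -> (-1 <= b <= 1)%Z -> In q (box M) -> In (sh a b q) (box (S M))).
  { intros M q a b Ha Hb Hq. apply in_box in Hq. apply in_box. unfold sh; simpl. lia. }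
  assert (Hfs : fsupp (fun i p => rot phK i p * d i p) (box (K + 2))).
  { intros i p Hp. assert (Hr : rot phK i p <> 0) by (intros E; apply Hp; rewrite E; ring).
    replace (K + 2)%nat with (S (S K)) by lia.
    assert (Hor : phK (lf i p) <> 0 \/ phK (rf i p) <> 0).
    { destruct (Req_dec (phK (lf i p)) 0); [right|left]; auto. intros E. apply Hr. unfold rot. lra. }
    assert (Hin : exists a b, (-1 <= a <= 1)%Z /\ (-1 <= b <= 1)%Z /\ In (sh a b p) (box (S K))).
    { destruct (Hcell i p) as (L & M). destruct Hor as [Hor|Hor]; unfold phK in Hor.
      - destruct in_dec as [Hi|]; [|lra]. destruct L as [L|L]; rewrite L in Hi.
        + exists 0%Z, 0%Z. rewrite sh_0. repeat split; auto; lia.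
        + exists (-1)%Z, 0%Z. repeat split; auto; lia.
      - destruct in_dec as [Hi|]; [|lra]. destruct M as [M|M]; rewrite M in Hi.
        + exists 0%Z, 0%Z. rewrite sh_0. repeat split; auto; lia.
        + exists 0%Z, (-1)%Z. repeat split; auto; lia. }
    destruct Hin as (a & b & Ha & Hb & Hi). rewrite <- (sh_inv' a b p). apply Hbox; auto; lia. }
  rewrite E1, (fsum_fin _ (box (K + 2)) (box_NoDup _) Hfs).
  assert (E2 : lsum (S3 (fun i p => cfield i p * d i p)) (box K) = lsum (S3 (fun i p => rot phK i p * d i p)) (box K)).
  { apply lsum_ext. intros p Hp.
    assert (E : forall i, cfield i p = rot phK i p).
    { intros i. unfold cfield, rot, phK. destruct (Hcell i p) as (L & M).
      assert (HL : In (fst (lf i p)) (box (S K))).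
      { destruct L as [-> | ->]; [rewrite <- (sh_0 p)|]; apply Hbox; auto; lia. }
      assert (HM : In (fst (rf i p)) (box (S K))).
      { destruct M as [-> | ->]; [rewrite <- (sh_0 p)|]; apply Hbox; auto; lia. }
      destruct in_dec; [|contradiction]. destruct in_dec; [|contradiction]. reflexivity. }
    unfold S3. now rewrite !E. }
  rewrite E2. set (g := S3 (fun i p => rot phK i p * d i p)).
  assert (Hq : 0 < sqrt (INR K)) by (apply sqrt_lt_R0; lra).
  assert (Hq2 : sqrt (INR K) * sqrt (INR K) = INR K) by (apply sqrt_sqrt; lra).
  set (q := sqrt (INR K)) in *.
  assert (HphB : forall f, Rabs (phK f) <= 3 * q).
  { intros [p t]. unfold phK. cbn [fst]. destruct in_dec as [Hi|]; [|rewrite Rabs_R0; lra].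
    eapply Rle_trans; [apply phi_bound|].
    apply in_box in Hi. assert (Hwp : w p <= 3 * q * (3 * q)).
    { unfold w. rewrite <- !abs_IZR. destruct Hi as (H1 & H2). apply IZR_le in H1. apply IZR_le in H2.
      rewrite <- INR_IZR_INZ, S_INR in H1, H2. replace (3 * q * (3 * q)) with (9 * (q * q)) by ring. rewrite Hq2. lra. }
    rewrite <- (sqrt_square (3 * q)) by lra. now apply sqrt_le_1_alt. }
  assert (Hg : forall p, ~ In p (box K) -> Rabs (g p) <= 6 * Cd * 3 * q / INR K ^ 2).
  { intros p Hp. apply w_out_box in Hp.
    assert (E : forall i, Rabs (rot phK i p * d i p) <= (6 * q) * (Cd / INR K ^ 2)).
    { intros i. rewrite Rabs_mult. apply Rmult_le_compat; auto using Rabs_pos.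
      - unfold rot. eapply Rle_trans; [apply Rabs_triang|]. rewrite Rabs_Ropp.
        pose proof (HphB (lf i p)). pose proof (HphB (rf i p)). lra.
      - eapply Rle_trans; [apply Qd|]. unfold Rdiv. apply Rmult_le_compat_l; [lra|].
        apply Rinv_le_contravar; [apply pow_lt; lra|]. apply pow_incr. lra. }
    unfold g, S3. pose proof (E d1); pose proof (E d2); pose proof (E d3).
    eapply Rle_trans; [apply Rabs_triang|]. eapply Rle_trans; [apply Rplus_le_compat_r, Rabs_triang|].
    replace (6 * Cd * 3 * q / INR K ^ 2) with (3 * ((6 * q) * (Cd / INR K ^ 2))) by (field; lra). lra. }
  set (B := 6 * Cd * 3 * q / INR K ^ 2) in *.
  pose proof (box_growth g B K 2) as U1. pose proof (box_growth (fun p => -1 * g p) B K 2) as U2.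
  rewrite !lsum_scal in U2.
  assert (HBe : B * ((2 * INR (K + 2) + 1) ^ 2 - (2 * INR K + 1) ^ 2) <= eps).
  { eapply Rle_trans; [|apply (HK0 K); lia]. rewrite plus_INR. simpl (INR 2). unfold B.
    fold q. rewrite <- Hq2. replace ((2 * (q * q + (1 + 1)) + 1) ^ 2 - (2 * (q * q) + 1) ^ 2) with (16 * (q * q) + 24) by ring.
    apply (Rmult_le_reg_r (q ^ 3)); [now apply pow_lt|].
    replace (6 * Cd * 3 * q / (q * q) ^ 2 * (16 * (q * q) + 24) * q ^ 3) with (6 * Cd * 3 * (16 * (q * q) + 24)) by (field; lra).
    replace (6 * Cd * 3 * 40 / q * q ^ 3) with (6 * Cd * 3 * (40 * (q * q))) by (field; lra).
    rewrite Hq2. apply Rmult_le_compat_l; lra. }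
  apply Rabs_le. split.
  - assert (lsum g (box (K + 2)) <= lsum g (box K) + B * ((2 * INR (K + 2) + 1) ^ 2 - (2 * INR K + 1) ^ 2)); [|lra].
    apply U1. intros p Hp. specialize (Hg p Hp). apply Rabs_le_between in Hg. lra.
  - assert (-1 * lsum g (box (K + 2)) <= -1 * lsum g (box K) + B * ((2 * INR (K + 2) + 1) ^ 2 - (2 * INR K + 1) ^ 2)); [|lra].
    apply U2. intros p Hp. specialize (Hg p Hp). apply Rabs_le_between in Hg. lra.
Qed.

Lemma fsummable_of_bound (b : field) C : (forall i p, Rabs (b i p) <= C / w p ^ 2) -> fsummable (fsq b).
Proof.
  intros H. apply (fsummable_le _ (fun i p => C ^ 2 * / w p ^ 4)); [|apply fsummable_scal, fsummable_w4].
  intros i p. unfold fsq. rewrite Rabs_pos_eq by apply pow2_ge_0. specialize (H i p). apply abs_le_sq in H.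
  replace (C ^ 2 * / w p ^ 4) with ((C / w p ^ 2) ^ 2); [auto|]. pose proof (w_pos p). field. lra.
Qed.

(** The two preceding limits combined. The circulation term appears because the renormalising term
    does not sum to zero on a field that is not a gradient. *)
Lemma energy_moved psi s u N : psi_hyp psi -> fsupp (grad u) (box N) ->
  Fe psi (dmoved s u) + Derive_n psi 2 0 * Tsum (F2 (fun f => phi f * curl (dmoved s u) f)) <= Fe psi (grad u).
Proof.
  intros H Hs. apply le_epsilon. intros eps He. pose proof (psi_mu psi H) as Hmu. set (mu := Derive_n psi 2 0) in *.
  destruct (dmoved_bound s u N Hs) as (Cd & Pd & Qd).
  pose proof (fsummable_of_bound _ _ Qd) as Hsum. pose proof (Gd_summable psi _ _ H (l2f_of_sum _ Hsum)) as HG.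
  destruct (Tsum_box_lim (S3 (fun i p => Gd psi i p (dmoved s u i p))) (eps / 3) (summable_S3 _ HG)) as (K1 & HK1); [lra|].
  destruct (psi_energy_moved psi s u N H Hs (eps / 3)) as (K2 & HK2); [lra|].
  destruct (c_sum_moved s u N Hs (eps / (3 * mu))) as (K3 & HK3). { apply Rdiv_lt_0_compat; lra. }
  set (K := (K1 + K2 + K3)%nat).
  specialize (HK1 K ltac:(lia)). specialize (HK2 K ltac:(lia)). specialize (HK3 K ltac:(lia)).
  fold (fsum (fun i p => Gd psi i p (dmoved s u i p))) in HK1. fold (Fe psi (dmoved s u)) in HK1.
  assert (E : lsum (S3 (fun i p => Gd psi i p (dmoved s u i p))) (box K) =
    lsum (S3 (fun i p => psi (strain (moved s u) i p) - psi (alpha i p))) (box K)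
    - mu * lsum (S3 (fun i p => cfield i p * dmoved s u i p)) (box K)).
  { rewrite <- lsum_scal, <- lsum_minus. apply lsum_ext. intros p _. unfold S3, Gd.
    assert (EE : forall i, alpha i p + dmoved s u i p = strain (moved s u) i p) by (intros; unfold dmoved; ring).
    rewrite !EE. fold mu. ring. }
  rewrite E in HK1. apply Rabs_def2 in HK1. apply Rabs_le_between in HK3.
  set (T := Tsum _) in *. set (L := lsum (S3 (fun i p => cfield i p * dmoved s u i p)) (box K)) in *.
  assert (mu * (T - L) <= eps / 3).
  { apply Rle_trans with (mu * (eps / (3 * mu))); [apply Rmult_le_compat_l; lra|]. right. field. lra. }
  lra.
Qed.

(** * Translations and point reflections *)

Lemma X_sh a b p : X (sh a b p) = X p + IZR a /\ Y (sh a b p) = Y p + IZR b.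
Proof. unfold X, Y, sh; simpl. rewrite !plus_IZR. split; ring. Qed.

Definition translation (a b : Z) : lattice_sym.
Proof.
  refine (Build_lattice_sym (sh a b) 1 (- IZR a) (- IZR b) (fun _ => sh a b) (fun _ => sh (-a) (-b))
    (Z.abs_nat a + Z.abs_nat b) (fun f => (sh a b (fst f), snd f)) (fun f => (sh (-a) (-b) (fst f), snd f))
    (or_introl eq_refl) _ _ _ _ _ _ _ _ _ _ _).
  - intros p. destruct (X_sh a b p) as (-> & ->). split; ring.
  - intros i p. apply sh_inv'.
  - intros i p. apply sh_inv.
  - intros i p N Hp. apply in_box in Hp. apply in_box. unfold sh; simpl. lia.
  - intros i p N Hp. apply in_box in Hp. apply in_box. unfold sh; simpl. lia.
  - intros v i p. unfold grad. rewrite Rmult_1_l.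
    assert (E1 : sh a b (be i p) = be i (sh a b p)) by (destruct i; simpl; rewrite !sh_sh; f_equal; lia).
    assert (E2 : sh a b (bs i p) = bs i (sh a b p)) by (destruct i; simpl; rewrite ?sh_sh; f_equal; lia).
    now rewrite E1, E2.
  - intros [p t]. simpl. now rewrite sh_inv'.
  - intros [p t]. simpl. now rewrite sh_inv.
  - intros [p t] N Hp. simpl in *. apply in_box in Hp. apply in_box. unfold sh in Hp; simpl in Hp. lia.
  - intros c [p t]. unfold curl; simpl.
    rewrite !sh_sh, (Z.add_comm 1 a), (Z.add_comm 1 b), !Z.add_0_l, !Z.add_0_r. destruct t; ring.
  - intros f g. unfold D2, fx, fy, sh; cbn [fst snd]. f_equal; lia.
Defined.

Definition refl_tau (a b : Z) (i : dir) (p : site) : site :=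
  match i with d1 => (a - fst p - 1, b - snd p)%Z | d2 => (a - fst p, b - snd p - 1)%Z | d3 => (a - fst p - 1, b - snd p - 1)%Z end.

Definition reflection (a b : Z) : lattice_sym.
Proof.
  refine (Build_lattice_sym (fun p => (a - fst p, b - snd p)%Z) (-1) (IZR a + 2 / 3) (IZR b + 2 / 3)
    (refl_tau a b) (refl_tau a b)
    (Z.abs_nat a + Z.abs_nat b + 1) (fun f => ((a - fst (fst f) - 1, b - snd (fst f) - 1)%Z, negb (snd f)))
    (fun f => ((a - fst (fst f) - 1, b - snd (fst f) - 1)%Z, negb (snd f)))
    (or_intror eq_refl) _ _ _ _ _ _ _ _ _ _ _).
  - intros p. unfold X, Y; simpl. rewrite !minus_IZR. split; field.
  - intros i [m n]. destruct i; simpl; f_equal; lia.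
  - intros i [m n]. destruct i; simpl; f_equal; lia.
  - intros i [m n] N Hp. apply in_box in Hp. apply in_box. simpl in Hp. destruct i; simpl; lia.
  - intros i [m n] N Hp. apply in_box in Hp. apply in_box. simpl in Hp. destruct i; simpl; lia.
  - intros v i [m n]. unfold grad. destruct i; unfold be, bs, sh, refl_tau; simpl fst; simpl snd.
    + replace (a - m - 1 + 1)%Z with (a - m)%Z by lia. replace (b - n + 0)%Z with (b - n)%Z by lia.
      replace (a - (m + 1))%Z with (a - m - 1)%Z by lia. replace (b - (n + 0))%Z with (b - n)%Z by lia. ring.
    + replace (a - m + 0)%Z with (a - m)%Z by lia. replace (b - n - 1 + 1)%Z with (b - n)%Z by lia.
      replace (a - (m + 0))%Z with (a - m)%Z by lia. replace (b - (n + 1))%Z with (b - n - 1)%Z by lia. ring.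
    + replace (a - m - 1 + 0)%Z with (a - m - 1)%Z by lia. replace (b - n - 1 + 1)%Z with (b - n)%Z by lia.
      replace (a - m - 1 + 1)%Z with (a - m)%Z by lia. replace (b - n - 1 + 0)%Z with (b - n - 1)%Z by lia.
      replace (a - (m + 0))%Z with (a - m)%Z by lia. replace (b - (n + 1))%Z with (b - n - 1)%Z by lia.
      replace (a - (m + 1))%Z with (a - m - 1)%Z by lia. replace (b - (n + 0))%Z with (b - n)%Z by lia. ring.
  - intros [[m n] t]. simpl. rewrite Bool.negb_involutive. do 2 f_equal; lia.
  - intros [[m n] t]. simpl. rewrite Bool.negb_involutive. do 2 f_equal; lia.
  - intros [[m n] t] N Hp. simpl in *. apply in_box in Hp. apply in_box. simpl in *. lia.
  - intros c [[m n] t]. unfold curl, refl_tau, sh. simpl fst; simpl snd. destruct t; simpl negb; cbv iota.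
    + replace (a - (m + 1))%Z with (a - m - 1)%Z by lia. replace (b - (n + 0) - 1)%Z with (b - n - 1)%Z by lia.
      replace (a - (m + 0) - 1)%Z with (a - m - 1)%Z by lia. replace (b - (n + 1))%Z with (b - n - 1)%Z by lia. ring.
    + replace (a - m - 1 + 1)%Z with (a - m)%Z by lia. replace (b - n - 1 + 0)%Z with (b - n - 1)%Z by lia.
      replace (a - m - 1 + 0)%Z with (a - m - 1)%Z by lia. replace (b - n - 1 + 1)%Z with (b - n)%Z by lia. ring.
  - intros [[m n] t] [[m' n'] t']. unfold D2, NZ, fx, fy; simpl fst; simpl snd. destruct t, t'; simpl negb; cbv iota; ring.
Defined.

(** Translations reach the triangles oriented like [f0], point reflections the others. *)
Lemma sym_exists z : exists s : lattice_sym, Tf s f0 = z.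
Proof.
  destruct z as [[a b] []].
  - exists (translation (a + 1) (b + 1)). unfold f0, V, sh. cbn [Tf translation fst snd].
    apply f_equal2; [|reflexivity]. unfold sh. cbn [fst snd]. apply f_equal2; lia.
  - exists (reflection a b). unfold f0, V. cbn [Tf reflection fst snd negb].
    apply f_equal2; [|reflexivity]. apply f_equal2; lia.
Qed.

(** * The test field attached to a centre *)

Lemma Tsum_F2_list (h : face -> R) L : NoDup L -> (forall f, h f <> 0 -> In f L) -> Tsum (F2 h) = lsum h L.
Proof.
  intros HL H. destruct (in_some_box (map fst L)) as (N & HN).
  assert (Hin : forall p t, h (p, t) <> 0 -> In p (box N)).
  { intros p t Hp. apply HN. apply in_map_iff. exists (p, t). auto. }
  rewrite (Tsum_fin _ (box N)); [|apply box_NoDup|].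
  - rewrite lsum_F2_faces. symmetry. apply lsum_incl_eq; auto.
    + apply faces_NoDup, box_NoDup.
    + intros [p t] Hf. apply in_faces. apply HN. apply in_map_iff. exists (p, t). auto.
    + intros f _ Hf. destruct (Req_dec (h f) 0); auto. exfalso; auto.
  - intros p Hp. unfold F2 in Hp. destruct (Req_dec (h (U p)) 0); [|now apply (Hin p false)].
    destruct (Req_dec (h (V p)) 0); [|now apply (Hin p true)]. lra.
Qed.

(** The radial test function; the profile [m r = ln (Rmax 1 r)] would give back [phi]. *)
Definition hm (m : R -> R) (f : face) : R := - Alog * m (dist f f0).
Definition jm (m : R -> R) : field := rot (hm m).

Lemma jm_between m i p : log_growth m ->
  (exists x y, cfield i p = Alog * x /\ jm m i p = Alog * y /\ 0 <= y <= x) \/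
  (exists x y, cfield i p = - Alog * x /\ jm m i p = - Alog * y /\ 0 <= y <= x).
Proof.
  intros (H0 & H1). unfold cfield, jm, rot, phi, hm.
  assert (E : forall r, m r = m (Rmax 1 r)).
  { intros r. unfold Rmax. destruct Rle_dec; auto. rewrite !H0 by lra. reflexivity. }
  rewrite (E (dist (lf i p) f0)), (E (dist (rf i p) f0)).
  set (a := Rmax 1 (dist (lf i p) f0)). set (b := Rmax 1 (dist (rf i p) f0)).
  assert (Ha : 1 <= a) by apply Rmax_l. assert (Hb : 1 <= b) by apply Rmax_l.
  destruct (Rle_dec a b) as [Hab|Hab].
  - left. exists (ln b - ln a), (m b - m a). specialize (H1 a b Ha Hab). repeat split; try ring; tauto.
  - right. exists (ln a - ln b), (m a - m b). assert (Hba : b <= a) by lra. specialize (H1 b a Hb Hba). repeat split; try ring; tauto.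
Qed.

(** By [jm_between] the two fields are [Alog * x] and [Alog * y] up to a common sign, with
    [0 <= y <= x], so [(x - y)^2 <= (x - y) * x]. *)
Lemma jm_facts m i p : log_growth m ->
  (cfield i p - jm m i p) ^ 2 <= (cfield i p - jm m i p) * cfield i p /\
  Rabs (jm m i p) <= Rabs (cfield i p) /\ Rabs (cfield i p - jm m i p) <= Rabs (cfield i p).
Proof.
  intros H. pose proof Alog_pos as HA. destruct (jm_between m i p H) as [(x & y & -> & -> & Hxy)|(x & y & -> & -> & Hxy)].
  - assert (0 <= Alog * x) by mulpos. assert (0 <= Alog * y) by mulpos. assert (0 <= Alog * (x - y)) by mulpos.
    rewrite !Rabs_pos_eq by lra. repeat split; nra.
  - assert (0 <= Alog * x) by mulpos. assert (0 <= Alog * y) by mulpos. assert (0 <= Alog * (x - y)) by mulpos.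
    rewrite !(Rabs_left1) by lra. repeat split; nra.
Qed.

(* chi differs from phi - h by a constant, chosen so that chi vanishes far away. *)
Definition chi (m : R -> R) (Lam : R) (f : face) : R := phi f - hm m f + Alog * Lam.

Lemma rot_chi m Lam i p : rot (chi m Lam) i p = cfield i p - jm m i p.
Proof. unfold rot, chi, cfield, jm, rot. ring. Qed.

Lemma chi_f0 m Lam : log_growth m -> chi m Lam f0 = Alog * Lam.
Proof.
  intros (H0 & _). unfold chi, phi, hm. rewrite dist_refl, (H0 0) by lra. rewrite Rmax_left by lra. rewrite ln_1. ring.
Qed.

Lemma chi_supp m Lam Rr : 1 <= Rr -> (forall r, Rr <= r -> m r = ln r - Lam) -> exists N, hsupp (chi m Lam) (box N).
Proof.
  intros HR H. destruct (INR_unbounded (1.2 * Rr + 1)) as (N & HN). exists N. intros p t Hp.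
  apply in_box. assert (Hd : dist (p, t) f0 < Rr).
  { apply Rnot_le_lt. intros Hle. apply Hp. unfold chi, phi, hm. rewrite H by auto. rewrite Rmax_right by lra. ring. }
  rewrite dist_f0 in Hd. destruct (NR_coord (IZR (fx (p, t)) / 3) (IZR (fy (p, t)) / 3)) as (A & B).
  assert (A' : Rabs (IZR (fx (p, t)) / 3) < INR N - 1) by lra. assert (B' : Rabs (IZR (fy (p, t)) / 3) < INR N - 1) by lra.
  apply Rabs_def2 in A'. apply Rabs_def2 in B'.
  unfold fx, fy in A', B'; simpl fst in A', B'; simpl snd in A', B'. rewrite plus_IZR, mult_IZR in A', B'.
  assert (F1 : Rabs (IZR (fst p)) <= INR N) by (apply Rabs_le; destruct t; lra).
  assert (F2 : Rabs (IZR (snd p)) <= INR N) by (apply Rabs_le; destruct t; lra).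
  rewrite <- abs_IZR, INR_IZR_INZ in F1, F2. split; now apply le_IZR.
Qed.

Lemma fsum_w4_le c : 0 <= c -> fsum (fun _ p => c * / w p ^ 4) <= 48 * c.
Proof.
  intros Hc. rewrite (fsum_scal c _ fsummable_w4). rewrite (Rmult_comm 48). apply Rmult_le_compat_l; auto.
  apply (Tsum_le_bound _ nil); [apply summable_S3, fsummable_w4|]. intros k Hk _. unfold S3.
  rewrite !lsum_plus. pose proof (lsum_w4 k Hk). lra.
Qed.

Lemma eps_sq_bound : exists C, 0 < C /\ (forall i p, (alpha i p - cfield i p) ^ 2 <= C * / w p ^ 4) /\
  (forall i p, Rabs (alpha i p - cfield i p) * Rabs (cfield i p) <= C * / w p ^ 4).
Proof.
  destruct alpha_c_bound as (Cc & Pc & Qc). destruct c_bound as (Cb & Pb & Qb).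
  assert (0 < Cc ^ 2) by now apply pow_lt. assert (0 < Cc * Cb) by now apply Rmult_lt_0_compat.
  exists (Cc ^ 2 + Cc * Cb). split; [lra|].
  split; intros i p; pose proof (Qc i p) as A; pose proof (Qb i p) as B; pose proof (inv_w_le1 p) as Hw;
  unfold Rdiv in *; rewrite inv_w_pow in *; set (v := / w p) in *.
  - apply abs_le_sq in A. rewrite Rpow_mult_distr, <- pow_mult in A. simpl (3 * 2)%nat in A.
    assert (v ^ 6 <= v ^ 4). { replace (v ^ 6) with (v ^ 4 * v ^ 2) by ring. assert (0 < v ^ 4) by (apply pow_lt; lra). assert (v ^ 2 <= 1 ^ 2) by (apply pow_incr; lra). nra. }
    assert (0 < v ^ 4) by (apply pow_lt; lra). nra.
  - assert (0 < v ^ 3) by (apply pow_lt; lra).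
    apply Rle_trans with (Cc * v ^ 3 * (Cb * v)); [apply Rmult_le_compat; auto using Rabs_pos|].
    assert (0 < v ^ 4) by (apply pow_lt; lra). replace (Cc * v ^ 3 * (Cb * v)) with (Cc * Cb * v ^ 4) by ring. nra.
Qed.

(** Up to [/ w^4] errors, [(alpha - jm)^2] is at most [(cfield - jm) * alpha], that is
    [rot chi * alpha]. Since [alpha] has its only charge at [f0], summation by parts leaves
    [chi f0 = Alog * Lam]. *)
Lemma test_field_error : exists C1, 0 < C1 /\ forall m Lam Rr, log_growth m -> 1 <= Rr -> (forall r, Rr <= r -> m r = ln r - Lam) ->
  fsummable (fsq (fun i p => alpha i p - jm m i p)) /\
  fsum (fsq (fun i p => alpha i p - jm m i p)) <= Alog * Lam + C1.
Proof.
  destruct eps_sq_bound as (Ce & Pe & Qe1 & Qe2). exists (48 * (2 * Ce)). split; [lra|].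
  intros m Lam Rr Hm HR HL. destruct (chi_supp m Lam Rr HR HL) as (N & HN).
  pose proof (rot_supp _ _ HN) as Hrs.
  assert (Hfin : forall b : field, fsummable (fun i p => rot (chi m Lam) i p * b i p)).
  { intros b. apply (fsupp_summable _ (nbhd (box N))). intros i p Hp. apply (Hrs i). intros E; apply Hp; rewrite E; ring. }
  assert (Hbd : fsummable (fun i p => rot (chi m Lam) i p * alpha i p + (2 * Ce) * / w p ^ 4)).
  { apply fsummable_plus; [apply Hfin|apply fsummable_scal, fsummable_w4]. }
  assert (Hpt : forall i p, fsq (fun i p => alpha i p - jm m i p) i p <= rot (chi m Lam) i p * alpha i p + (2 * Ce) * / w p ^ 4).
  { intros i p. rewrite rot_chi. unfold fsq. destruct (jm_facts m i p Hm) as (J1 & J2 & J3).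
    pose proof (Qe1 i p) as A. pose proof (Qe2 i p) as B.
    set (e := alpha i p - cfield i p) in *. set (c := cfield i p) in *. set (j := jm m i p) in *.
    assert (D : Rabs (e * (c - j)) <= Ce * / w p ^ 4).
    { rewrite Rabs_mult. eapply Rle_trans; [|apply B]. apply Rmult_le_compat_l; auto using Rabs_pos. }
    apply Rabs_le_between in D. replace (alpha i p) with (e + c) by (unfold e; ring).
    replace ((e + c - j) ^ 2) with (e ^ 2 + 2 * (e * (c - j)) + (c - j) ^ 2) by ring.
    replace ((c - j) * (e + c)) with (e * (c - j) + (c - j) * c) by ring. lra. }
  assert (Hs : fsummable (fsq (fun i p => alpha i p - jm m i p))).
  { eapply fsummable_le; [|apply Hbd]. intros i p. rewrite Rabs_pos_eq by apply pow2_ge_0. apply Hpt. }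
  split; auto. eapply Rle_trans; [apply (fsum_le _ _ Hs Hbd Hpt)|].
  rewrite (fsum_plus (fun i p => rot (chi m Lam) i p * alpha i p) (fun _ p => 2 * Ce * / w p ^ 4)); auto.
  2:{ apply fsummable_scal, fsummable_w4. }
  rewrite (sbp_face_fin (chi m Lam) alpha _ HN).
  rewrite (Tsum_F2_list _ [f0]).
  - cbn [lsum]. rewrite curl_alpha, chi_f0 by auto. unfold ind. destruct face_eq_dec; [|congruence].
    pose proof (fsum_w4_le (2 * Ce) ltac:(lra)). lra.
  - constructor; [intros []|constructor].
  - intros f Hf. rewrite curl_alpha in Hf. unfold ind in Hf. destruct (face_eq_dec f0 f); [now left|lra].
Qed.

(** Completing the square around [jm] leaves the linear term [(cfield - jm) * d = rot chi * d].
    Summed by parts it only involves circulations, and as these total 0 the constant in [chi] drops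
    out, leaving [phi - hm]. *)
Lemma lower_energy psi : psi_hyp psi -> exists C2, 0 < C2 /\ forall (d : field) m Lam Rr L,
  log_growth m -> 1 <= Rr -> (forall r, Rr <= r -> m r = ln r - Lam) -> fsummable (fsq d) ->
  (forall i p, Rabs (alpha i p + d i p) <= / 2) -> NoDup L -> (forall f, curl d f <> 0 -> In f L) -> lsum (curl d) L = 0 ->
  fsummable (fsq (fun i p => alpha i p + d i p - jm m i p)) /\
  / 2 * Derive_n psi 2 0 * (fsum (fsq (fun i p => alpha i p + d i p - jm m i p)) - fsum (fsq (fun i p => alpha i p - jm m i p)))
    + Derive_n psi 2 0 * lsum (fun f => hm m f * curl d f) L - C2
  <= Fe psi d + Derive_n psi 2 0 * Tsum (F2 (fun f => phi f * curl d f)).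
Proof.
  intros H. pose proof (psi_mu psi H) as Hmu. set (mu := Derive_n psi 2 0) in *.
  destruct (Gd_lower_reduced psi H) as (Cr & Pr & Qr). exists (48 * Cr). split; [lra|].
  intros d m Lam Rr L Hm HR HL Hd Hred HLn HLs HL0.
  destruct test_field_error as (C1 & _ & T1). destruct (T1 m Lam Rr Hm HR HL) as (Hsa & _). clear T1.
  set (a := fun i p => alpha i p - jm m i p) in *.
  set (bj := fun i p => alpha i p + d i p - jm m i p).
  destruct (chi_supp m Lam Rr HR HL) as (N & HN). pose proof (rot_supp _ _ HN) as Hrs.
  assert (Hfin : fsummable (fun i p => rot (chi m Lam) i p * d i p)).
  { apply (fsupp_summable _ (nbhd (box N))). intros i p Hp. apply (Hrs i). intros E; apply Hp; rewrite E; ring. }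
  assert (Hsb : fsummable (fsq bj)).
  { apply (fsummable_ext (fsq (fun i p => a i p - - d i p))).
    - intros i p. unfold fsq, bj, a. ring.
    - apply fsq_summable_minus; auto. apply (fsummable_ext (fsq d)); auto. intros; unfold fsq; ring. }
  split; auto.
  assert (HG : fsummable (fun i p => Gd psi i p (d i p))) by (eapply Gd_summable; eauto using l2f_of_sum).
  assert (Hpt : forall i p, / 2 * mu * (fsq bj i p - fsq a i p) - mu * (rot (chi m Lam) i p * d i p) - Cr * / w p ^ 4 <= Gd psi i p (d i p)).
  { intros i p. eapply Rle_trans; [|apply Qr; auto]. fold mu. rewrite rot_chi. unfold fsq, bj, a, Rdiv. right. field.
    pose proof (w_pos p). lra. }
  assert (Hsum := fun Ha => fsum_le _ _ Ha HG Hpt).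
  assert (H1 : fsummable (fun i p => fsq bj i p - fsq a i p)) by now apply fsummable_minus.
  assert (H2 : fsummable (fun i p => / 2 * mu * (fsq bj i p - fsq a i p))) by now apply fsummable_scal.
  assert (H3 : fsummable (fun i p => mu * (rot (chi m Lam) i p * d i p))) by now apply fsummable_scal.
  assert (H4 : fsummable (fun i p => / 2 * mu * (fsq bj i p - fsq a i p) - mu * (rot (chi m Lam) i p * d i p))) by now apply fsummable_minus.
  assert (H5 : fsummable (fun (_ : dir) p => Cr * / w p ^ 4)) by apply fsummable_scal, fsummable_w4.
  specialize (Hsum (fsummable_minus _ _ H4 H5)). fold (Fe psi d) in Hsum.
  rewrite (fsum_minus _ _ H4 H5), (fsum_minus _ _ H2 H3), (fsum_scal _ _ H1), (fsum_scal _ _ Hfin) in Hsum.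
  rewrite (fsum_minus (fsq bj) (fsq a)) in Hsum by auto.
  pose proof (fsum_w4_le Cr (Rlt_le _ _ Pr)) as Hw.
  rewrite (sbp_face_fin (chi m Lam) d _ HN) in Hsum.
  assert (Hz : forall (k : face -> R) f, k f * curl d f <> 0 -> In f L).
  { intros k f Hf. apply HLs. intros E; apply Hf; rewrite E; ring. }
  rewrite (Tsum_F2_list (fun f => chi m Lam f * curl d f) L HLn (Hz _)) in Hsum.
  rewrite (Tsum_F2_list (fun f => phi f * curl d f) L HLn (Hz _)).
  assert (E : lsum (fun f => chi m Lam f * curl d f) L = lsum (fun f => phi f * curl d f) L - lsum (fun f => hm m f * curl d f) L).
  { rewrite (lsum_ext _ (fun f => (phi f * curl d f - hm m f * curl d f) + Alog * Lam * curl d f)) by (intros; unfold chi; ring).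
    rewrite lsum_plus, lsum_minus, lsum_scal, HL0. ring. }
  rewrite E in Hsum. unfold bj, a in *. lra.
Qed.

(** * Energy carried by charged faces *)

Lemma D2_lf_rf i p : D2 (lf i p) (rf i p) = 3%Z.
Proof.
  destruct p as [a b]. unfold D2, NZ, fx, fy. destruct i; unfold lf, rf, U, V, sh; simpl fst; simpl snd; cbv iota; ring.
Qed.

Lemma sum3_sq x y z : (x + y - z) ^ 2 <= 3 * (x ^ 2 + y ^ 2 + z ^ 2).
Proof.
  pose proof (pow2_ge_0 (x - y)). pose proof (pow2_ge_0 (x + z)). pose proof (pow2_ge_0 (y + z)). nra.
Qed.

(** Cauchy-Schwarz on the three bonds of each face; the weights ensure that no bond is used more
    than once in total. *)
Lemma charged_faces_energy (x : field) (a : face -> R) L : fsummable (fsq x) -> NoDup L ->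
  (forall f, a f <> 0 -> In f L) -> (forall f, 0 <= a f) -> (forall i p, a (lf i p) + a (rf i p) <= 1) ->
  lsum (fun f => a f * (curl x f ^ 2 / 3)) L <= fsum (fsq x).
Proof.
  intros Hx HL Ha Hpos Hone.
  assert (Ha1 : forall f, a f <= 1).
  { intros [p []].
    - pose proof (Hone d3 p). simpl in H. pose proof (Hpos (U p)). fold (V p). lra.
    - pose proof (Hone d3 p). simpl in H. pose proof (Hpos (V p)). fold (U p). lra. }
  assert (Hs : forall g : dir -> site -> face, fsummable (fun i p => a (g i p) * fsq x i p)).
  { intros g. apply (fsummable_le _ (fsq x)); auto. intros i p. unfold fsq. pose proof (pow2_ge_0 (x i p)).
    pose proof (Hpos (g i p)). pose proof (Ha1 (g i p)). rewrite Rabs_pos_eq by mulpos. nra. }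
  apply Rle_trans with (fsum (fun i p => a (lf i p) * fsq x i p + a (rf i p) * fsq x i p)).
  - rewrite (bond_face_sum a (fsq x) (fsq x) (Hs lf) (Hs rf)).
    rewrite (Tsum_F2_list _ L HL).
    2:{ intros f Hf. apply Ha. intros E; apply Hf; rewrite E; ring. }
    apply lsum_le. intros f _. apply Rmult_le_compat_l; auto. unfold curl, fsq. destruct (snd f).
    + set (u := x d2 _). set (v := x d1 _). set (t := x d3 _).
      pose proof (sum3_sq u (- v) t). replace (u - v - t) with (u + - v - t) by ring. 
      replace ((- v) ^ 2) with (v ^ 2) in H by ring. lra.
    + pose proof (sum3_sq (x d1 (fst f)) (x d3 (fst f)) (x d2 (fst f))). lra.
  - apply fsum_le; auto.
    + apply fsummable_plus; apply Hs.
    + intros i p. pose proof (Hone i p). unfold fsq. pose proof (pow2_ge_0 (x i p)). nra.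
Qed.

Lemma lsum_faces_w4 L : NoDup L -> lsum (fun f : face => / w (fst f) ^ 4) L <= 32.
Proof.
  intros HL. destruct (in_some_box (map fst L)) as (N & HN).
  eapply Rle_trans; [apply (lsum_incl _ L (flat_map (fun p => [U p; V p]) (box N)) HL)|].
  - intros [p t] Hf. apply in_faces, HN, in_map_iff. exists (p, t). auto.
  - intros f. left. apply Rinv_0_lt_compat, pow_lt, w_pos.
  - rewrite <- lsum_F2_faces. unfold F2; simpl. rewrite lsum_plus. pose proof (lsum_w4 (box N) (box_NoDup N)). simpl in H. lra.
Qed.

(** [x <= eta + x^4 / eta^3], with fourth powers summable over distinct faces. The final balance
    affords only a small multiple of the number of charges. *)
Lemma lsum_inv_w L C eta : 0 < C -> 0 < eta -> NoDup L ->
  lsum (fun f : face => C / w (fst f)) L <= eta * INR (length L) + 32 * (C ^ 4 / eta ^ 3).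
Proof.
  intros HC He HL.
  assert (He3 : 0 < eta ^ 3) by now apply pow_lt. assert (HC4 : 0 < C ^ 4) by now apply pow_lt.
  apply Rle_trans with (lsum (fun f : face => eta + C ^ 4 / eta ^ 3 * / w (fst f) ^ 4) L).
  - apply lsum_le. intros f _. pose proof (w_pos (fst f)) as Hw. set (v := w (fst f)) in *.
    assert (Hq : 0 < C / v) by now apply Rdiv_lt_0_compat.
    replace (C ^ 4 / eta ^ 3 * / v ^ 4) with ((C / v) ^ 4 / eta ^ 3) by (field; lra). set (x := C / v) in *.
    assert (Hx4 : 0 < x ^ 4 / eta ^ 3) by (apply Rdiv_lt_0_compat; [now apply pow_lt|auto]).
    destruct (Rle_dec x eta); [lra|].
    assert (x <= x ^ 4 / eta ^ 3); [|lra]. apply (Rmult_le_reg_r (eta ^ 3)); auto.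
    replace (x ^ 4 / eta ^ 3 * eta ^ 3) with (x * x ^ 3) by (field; lra). apply Rmult_le_compat_l; [lra|].
    apply pow_incr. lra.
  - rewrite lsum_plus, lsum_const, lsum_scal. pose proof (lsum_faces_w4 L HL).
    assert (0 < C ^ 4 / eta ^ 3) by now apply Rdiv_lt_0_compat. nra.
Qed.

Lemma w_sh a b p : (-1 <= a <= 1)%Z -> (-1 <= b <= 1)%Z -> (a = 0 \/ b = 0)%Z -> w p <= 2 * w (sh a b p).
Proof.
  intros Ha Hb Hab. unfold w, sh; simpl. rewrite <- !abs_IZR.
  assert (H : (1 + Z.abs (fst p) + Z.abs (snd p) <= 2 * (1 + Z.abs (fst p + a) + Z.abs (snd p + b)))%Z) by lia.
  apply IZR_le in H. rewrite mult_IZR, !plus_IZR in H. exact H.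
Qed.

Lemma curl_jm_bound : exists C, 0 < C /\ forall m f, log_growth m -> Rabs (curl (jm m) f) <= C / w (fst f).
Proof.
  destruct c_bound as (Cb & Pb & Qb). exists (6 * Cb). split; [lra|]. intros m f Hm.
  assert (E : forall i a b, (-1 <= a <= 1)%Z -> (-1 <= b <= 1)%Z -> (a = 0 \/ b = 0)%Z -> Rabs (jm m i (sh a b (fst f))) <= 2 * Cb / w (fst f)).
  { intros i a b Ha Hb Hab. destruct (jm_facts m i (sh a b (fst f)) Hm) as (_ & J & _). eapply Rle_trans; [apply J|].
    eapply Rle_trans; [apply Qb|]. pose proof (w_sh a b (fst f) Ha Hb Hab). pose proof (w_pos (fst f)). pose proof (w_pos (sh a b (fst f))).
    apply (Rmult_le_reg_r (w (fst f) * w (sh a b (fst f)))); [nra|].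
    replace (Cb / w (sh a b (fst f)) * (w (fst f) * w (sh a b (fst f)))) with (Cb * w (fst f)) by (field; lra).
    replace (2 * Cb / w (fst f) * (w (fst f) * w (sh a b (fst f)))) with (2 * Cb * w (sh a b (fst f))) by (field; lra). nra. }
  assert (E0 : forall i, Rabs (jm m i (fst f)) <= 2 * Cb / w (fst f)).
  { intros i. rewrite <- (sh_0 (fst f)) at 1. apply E; lia. }
  replace (6 * Cb / w (fst f)) with (3 * (2 * Cb / w (fst f))) by (pose proof (w_pos (fst f)); field; lra).
  set (K := 2 * Cb / w (fst f)) in *. unfold curl. destruct (snd f).
  - pose proof (E d2 1%Z 0%Z ltac:(lia) ltac:(lia) ltac:(lia)) as A1. pose proof (E d1 0%Z 1%Z ltac:(lia) ltac:(lia) ltac:(lia)) as A2.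
    pose proof (E0 d3) as A3. apply Rabs_le_between in A1. apply Rabs_le_between in A2. apply Rabs_le_between in A3. apply Rabs_le; lra.
  - pose proof (E0 d1) as A1. pose proof (E0 d2) as A2. pose proof (E0 d3) as A3.
    apply Rabs_le_between in A1. apply Rabs_le_between in A2. apply Rabs_le_between in A3. apply Rabs_le; lra.
Qed.

(** * Compactness modulo lattice symmetries *)

Lemma ind_self f : ind f f = 1.
Proof. unfold ind. destruct face_eq_dec; congruence. Qed.
Lemma ind_other f g : f <> g -> ind f g = 0.
Proof. intros H. unfold ind. destruct face_eq_dec; congruence. Qed.

Lemma lsum_with_f0 (q : face -> R) P : NoDup P -> (forall f, q f <> 0 -> In f P) ->
  let L := nodup face_eq_dec (f0 :: P) in lsum (fun f => q f - ind f0 f) L = lsum q P - 1.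
Proof.
  intros HP Hq L. assert (HL : NoDup L) by apply NoDup_nodup.
  assert (HPL : incl P L) by (intros x Hx; apply nodup_In; now right).
  assert (HfL : incl [f0] L) by (intros x [<-|[]]; apply nodup_In; now left).
  rewrite lsum_minus, <- (lsum_incl_eq q P L), <- (lsum_incl_eq (ind f0) [f0] L); auto.
  - simpl. rewrite ind_self. ring.
  - constructor; [intros []|constructor].
  - intros f _ Hf. apply ind_other. intros E. apply Hf. left. exact E.
  - intros f _ Hf. destruct (Req_dec (q f) 0); auto. exfalso; auto.
Qed.

(** The strain minus [alpha] has finite support; testing it against the constant 1 shows that its
    circulations total 0, so the charges total 1. Each is a nonzero integer of modulus at most
    3/2. *)
Lemma charges_list u N : fsupp (grad u) (box N) -> let q := curl (strain (fun p => yhat p + u p)) in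
  exists P, NoDup P /\ (forall f, In f P <-> q f <> 0) /\ lsum q P = 1 /\ (forall f, In f P -> q f ^ 2 = 1).
Proof.
  intros Hs q.
  set (P := filter (fun f => if Req_dec_T (q f) 0 then false else true) (flat_map (fun p => [U p; V p]) (box (N + 2)))).
  assert (HP : NoDup P) by (apply NoDup_filter, faces_NoDup, box_NoDup).
  assert (Hq : forall f, In f P <-> q f <> 0).
  { intros [p t]. unfold P. rewrite filter_In, in_faces. destruct (Req_dec_T (q (p, t)) 0) as [E|E]; split; try (intros [_ E']; congruence); try tauto.
    intros Hne. split; auto. destruct (in_dec site_eq_dec p (box (N + 2))) as [|Hn]; auto. exfalso. apply Hne.
    unfold q. rewrite (strain_curl_out u N); auto.
    - apply ind_other. intros E1. apply Hn. inversion E1. apply in_box. simpl; lia.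
    - intros Hi. apply Hn. apply (box_incl (S N)); [lia|auto]. }
  exists P. split; auto. split; auto. split.
  - set (b := fun i p => strain (fun p => yhat p + u p) i p - alpha i p).
    assert (Hb : fsupp b (box N)).
    { intros i p Hp. destruct (in_dec site_eq_dec p (box N)) as [|Hn]; auto. exfalso. apply Hp. unfold b.
      rewrite (strain_out u (box N)); auto. ring. }
    assert (E := sbp_field_fin (fun _ => 1) b (box N) Hb).
    rewrite (fsum_ext _ (fun _ _ => 0)) in E by (intros; unfold rot; ring).
    rewrite (fsum_fin (fun _ _ => 0) nil) in E; [|constructor|intros i p Hp; lra]. simpl in E.
    assert (Hc : forall f, curl b f = q f - ind f0 f) by (intros f; unfold b; rewrite (curl_minus (strain (fun p => yhat p + u p)) alpha), curl_alpha; reflexivity).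
    rewrite (Tsum_F2_list _ (nodup face_eq_dec (f0 :: P))) in E; [|apply NoDup_nodup|].
    2:{ intros f Hf. apply nodup_In. rewrite Hc in Hf. destruct (face_eq_dec f0 f) as [<-|Hne]; [now left|right].
        apply Hq. rewrite ind_other in Hf by auto. lra. }
    rewrite (lsum_ext _ (fun f => q f - ind f0 f)) in E by (intros; rewrite Hc; ring).
    pose proof (lsum_with_f0 q P HP (fun f => proj2 (Hq f))) as E2. simpl in E2. simpl in E. lra.
  - intros f Hf. apply Hq in Hf. destruct (curl_int (fun p => yhat p + u p) f) as (k & Hk).
    change (q f = IZR k) in Hk.
    assert (Hb : Rabs (q f) <= 3 / 2).
    { assert (B : forall i p, Rabs (strain (fun p => yhat p + u p) i p) <= / 2) by (intros; apply red_bound).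
      assert (B' : forall i p, - / 2 <= strain (fun p => yhat p + u p) i p <= / 2) by (intros; apply Rabs_le_between, B).
      unfold q, curl. apply Rabs_le. destruct (snd f).
      - pose proof (B' d2 (sh 1 0 (fst f))). pose proof (B' d1 (sh 0 1 (fst f))). pose proof (B' d3 (fst f)). lra.
      - pose proof (B' d1 (fst f)). pose proof (B' d2 (fst f)). pose proof (B' d3 (fst f)). lra. }
    rewrite Hk in *. assert (Hk2 : (Z.abs k < 2)%Z) by (apply lt_IZR; rewrite abs_IZR; lra).
    assert (k <> 0%Z) by (intros ->; apply Hf; reflexivity).
    assert (k = 1 \/ k = -1)%Z as [-> | ->] by lia; simpl; ring.
Qed.

Lemma psi_Gd_int psi i p t (k : Z) : psi_hyp psi ->
  Gd psi i p (t - IZR k) = Gd psi i p t + Derive_n psi 2 0 * (cfield i p * IZR k).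
Proof.
  intros H. unfold Gd. rewrite (psi_mod psi (alpha i p + t) (alpha i p + (t - IZR k)) k H) by ring. ring.
Qed.

(** With [n] charges of total weight [S], gain and loss give [S/3 - (2/3) (n/400 + Ce) <= 1 +
    (49/50) S/3 + C3], that is [S/150 <= const + n/600]. Since [S >= n/2], this bounds [n] by [nr],
    hence also the loss and the l2 norm. *)
Lemma moved_charges_bound psi : psi_hyp psi -> exists n0 C5, forall u N,
  fsupp (grad u) (box N) -> Fe psi (grad u) <= 0 ->
  exists (s : lattice_sym) (L : list face), (length L <= n0)%nat /\ NoDup L /\
    (forall f, curl (dmoved s u) f <> 0 -> In f L) /\ l2f (dmoved s u) C5.
Proof.
  intros H. pose proof (psi_mu psi H) as Hmu.
  destruct (lower_energy psi H) as (C2 & P2 & Q2). destruct test_field_error as (C1 & P1 & Q1).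
  destruct curl_jm_bound as (Ck & Pk & Qk). set (mu := Derive_n psi 2 0) in *.
  set (eta := / 400). set (Ce := 32 * (Ck ^ 4 / eta ^ 3)).
  assert (HCe : 0 < Ce). { unfold Ce. apply Rmult_lt_0_compat; [lra|]. apply Rdiv_lt_0_compat; apply pow_lt; [auto|unfold eta; lra]. }
  set (C3 := C1 + 2 * C2 / mu). assert (HC3 : 0 < C3). { unfold C3. assert (0 < 2 * C2 / mu) by (apply Rdiv_lt_0_compat; lra). lra. }
  set (nr := 600 * (1 + C3 + Ce)).
  destruct (INR_unbounded nr) as (n1 & Hn1).
  set (C4 := 1 + INR n1). 
  exists (S n1), (2 * (C4 + C3) + 2 * (C4 + C1)). intros u N Hs Hle.
  destruct (charges_list u N Hs) as (P & HPn & HPq & HPs & HP1). set (q := curl (strain (fun p => yhat p + u p))) in *.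
  set (iso := fun f => forall g, In g P -> g <> f -> (8 < D2 f g)%Z).
  (* With these weights two charged faces that share a bond have total weight 1. *)
  set (a := fun f => if in_dec face_eq_dec f P then if excluded_middle_informative (iso f) then 1 else / 2 else 0).
  assert (Ha0 : forall f, 0 <= a f <= 1). { intros f. unfold a. destruct in_dec; [destruct excluded_middle_informative|]; lra. }
  destruct (centre_exists q a P) as (z & Rr & m & Lam & Hz & HR & Hm & HL & Hsum & Hcost); auto.
  { apply (curl_int (fun p => yhat p + u p)). }
  { intros f Hf. unfold a. destruct in_dec; [destruct excluded_middle_informative; lra|contradiction]. }
  { intros f Hf Hi. unfold a. destruct in_dec; [|contradiction]. destruct excluded_middle_informative; [reflexivity|contradiction]. }
  destruct (sym_exists z) as (s & Hsz). exists s.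
  set (d := dmoved s u). set (P' := map (Tfi s) P).
  assert (Hcd : forall f, curl d f = q (Tf s f) - ind f0 f) by (intros; apply dmoved_curl).
  assert (HP' : NoDup P').
  { apply FinFun.Injective_map_NoDup; auto. intros x y E. now rewrite <- (Tf_r s x), E, Tf_r. }
  assert (HP'in : forall f, q (Tf s f) <> 0 <-> In f P').
  { intros f. rewrite <- HPq. unfold P'. rewrite in_map_iff. split.
    - intros Hf. exists (Tf s f). split; auto. apply Tf_l.
    - intros (g & <- & Hg). now rewrite Tf_r. }
  assert (HsumP' : forall h, lsum (fun f => h (Tf s f)) P' = lsum h P).
  { intros h. unfold P'. rewrite lsum_map. apply lsum_ext. intros f _. now rewrite Tf_r. }
  set (L := nodup face_eq_dec (f0 :: P')).
  assert (HLn : NoDup L) by apply NoDup_nodup.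
  assert (HLs : forall f, curl d f <> 0 -> In f L).
  { intros f Hf. apply nodup_In. rewrite Hcd in Hf. destruct (face_eq_dec f0 f) as [<-|Hne]; [now left|right].
    apply HP'in. rewrite ind_other in Hf by auto. lra. }
  assert (HL0 : lsum (curl d) L = 0).
  { rewrite (lsum_ext _ (fun f => q (Tf s f) - ind f0 f)) by auto.
    pose proof (lsum_with_f0 (fun f => q (Tf s f)) P' HP' (fun f => proj1 (HP'in f))) as E. cbv zeta in E. fold L in E. rewrite E, (HsumP' q), HPs. ring. }
  assert (Hdist : forall f, dist f f0 = dist (Tf s f) z).
  { intros f. unfold dist. now rewrite <- Hsz, D2_spec. }
  destruct (dmoved_bound s u N Hs) as (Cd & Pd & Qd). pose proof (fsummable_of_bound _ _ Qd) as Hsd. fold d in Hsd.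
  assert (Had : forall i p, alpha i p + d i p = strain (moved s u) i p) by (intros; unfold d, dmoved; ring).
  destruct (Q2 d m Lam Rr L) as (Hsx & Hen); auto.
  { intros i p. rewrite Had. apply red_bound. }
  pose proof (energy_moved psi s u N H Hs) as Hinv. fold d mu in Hinv.
  destruct (Q1 m Lam Rr Hm HR HL) as (Hsa & Hea).
  set (x := fun i p => alpha i p + d i p - jm m i p) in *. set (y := fun i p => alpha i p - jm m i p) in *.
  (* [hm] vanishes at [f0], so the reference charge drops out and the sum is [- Alog] times the
     nonpositive sum of [centre_exists]. *)
  assert (Hh : 0 <= lsum (fun f => hm m f * curl d f) L).
  { assert (Hf0 : hm m f0 = 0). { unfold hm. rewrite dist_refl. destruct Hm as (Hm0 & _). rewrite Hm0 by lra. ring. }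
    rewrite (lsum_ext _ (fun f => hm m f * q (Tf s f))).
    2:{ intros f _. rewrite Hcd. destruct (face_eq_dec f0 f) as [<-|Hne]; [rewrite Hf0; ring|]. rewrite ind_other by auto. ring. }
    rewrite <- (lsum_incl_eq _ P' L); auto.
    - rewrite (lsum_ext _ (fun f => (fun g => - Alog * (q g * m (dist g z))) (Tf s f))).
      2:{ intros f _. unfold hm. rewrite Hdist. ring. }
      rewrite (HsumP' (fun g => - Alog * (q g * m (dist g z)))), lsum_scal. pose proof Alog_pos. nra.
    - intros f Hf. apply nodup_In. now right.
    - intros f _ Hf. destruct (Req_dec (q (Tf s f)) 0) as [->|Hne]; [ring|]. exfalso. apply Hf. now apply HP'in. }
  (* The hypothesis [Fe psi (grad u) <= 0] enters here, through [energy_moved]. *)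
  assert (HX : fsum (fsq x) <= Alog * Lam + C3).
  { assert (A1 : / 2 * mu * (fsum (fsq x) - fsum (fsq y)) <= C2) by nra.
    assert (A2 : fsum (fsq x) - fsum (fsq y) <= 2 * C2 / mu).
    { apply (Rmult_le_reg_l (/ 2 * mu)); [lra|]. replace (/ 2 * mu * (2 * C2 / mu)) with C2 by (field; lra). auto. }
    unfold C3. lra. }
  set (n := INR (length P)).
  assert (Hgain : lsum a P / 3 - 2 / 3 * (eta * n + Ce) <= fsum (fsq x)).
  { eapply Rle_trans; [|apply (charged_faces_energy x (fun f => a (Tf s f)) P' Hsx HP')].
    - apply Rle_trans with (lsum (fun f => / 3 * a (Tf s f) - 2 / 3 * (Ck / w (fst f))) P').
      + rewrite lsum_minus, !lsum_scal, (HsumP' a).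
        pose proof (lsum_inv_w P' Ck eta Pk ltac:(unfold eta; lra) HP') as E. fold Ce in E.
        replace (length P') with (length P) in E by (symmetry; apply length_map). fold n in E. lra.
      + apply lsum_le. intros f Hf. apply HP'in, HPq in Hf as Hf'. pose proof (HP1 _ Hf') as Hq1.
        assert (Hcx : curl x f = q (Tf s f) - curl (jm m) f).
        { unfold x. rewrite (curl_minus (fun i p => alpha i p + d i p) (jm m)), (curl_plus alpha d), curl_alpha, Hcd. ring. }
        rewrite Hcx. pose proof (Qk m f Hm) as Hk. set (k := curl (jm m) f) in *. set (Q := q (Tf s f)) in *.
        pose proof (Ha0 (Tf s f)) as Haf.
        assert (HQk : - (Ck / w (fst f)) <= Q * k <= Ck / w (fst f)).
        { apply Rabs_le_between. rewrite Rabs_mult. replace (Rabs Q) with 1; [lra|].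
          rewrite <- (Rabs_pos_eq 1) by lra. apply Rsqr_eq_abs_0. unfold Rsqr. simpl in Hq1. lra. }
        assert (0 < Ck / w (fst f)) by (apply Rdiv_lt_0_compat; [auto|apply w_pos]).
        assert (Hsq : 1 - 2 * (Ck / w (fst f)) <= (Q - k) ^ 2).
        { replace ((Q - k) ^ 2) with (Q ^ 2 - 2 * (Q * k) + k ^ 2) by ring. rewrite Hq1. pose proof (pow2_ge_0 k). lra. }
        assert (a (Tf s f) * (1 - 2 * (Ck / w (fst f))) <= a (Tf s f) * (Q - k) ^ 2) by (apply Rmult_le_compat_l; lra).
        assert (a (Tf s f) * (Ck / w (fst f)) <= 1 * (Ck / w (fst f))) by (apply Rmult_le_compat_r; lra). lra.
    - intros f Hf. apply HP'in, HPq. unfold a in Hf. destruct in_dec; [auto|lra].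
    - intros f. apply Ha0.
    - intros i p. set (f := Tf s (lf i p)). set (g := Tf s (rf i p)).
      assert (HD : D2 f g = 3%Z) by (unfold f, g; rewrite D2_spec; apply D2_lf_rf).
      assert (Hne : f <> g). { intros E. rewrite E in HD. unfold D2, NZ in HD. rewrite !Z.sub_diag in HD. discriminate. }
      unfold a. destruct (in_dec face_eq_dec f P) as [If|], (in_dec face_eq_dec g P) as [Ig|].
      + assert (If' : ~ iso f) by (intros Iso; specialize (Iso g Ig (not_eq_sym Hne)); lia).
        assert (Ig' : ~ iso g) by (intros Iso; specialize (Iso f If Hne); rewrite D2_sym in Iso; lia).
        destruct excluded_middle_informative; [contradiction|]. destruct excluded_middle_informative; [contradiction|]. lra.
      + destruct excluded_middle_informative; lra.
      + destruct excluded_middle_informative; lra.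
      + lra. }
  assert (Hn : n <= nr).
  { assert (Ha2 : / 2 * n <= lsum a P).
    { unfold n. rewrite <- lsum_const. apply lsum_le. intros f Hf. unfold a. destruct in_dec; [destruct excluded_middle_informative; lra|contradiction]. }
    unfold nr, eta in *. lra. }
  assert (HaP : lsum a P <= n).
  { unfold n. rewrite <- (Rmult_1_l (INR _)), <- lsum_const. apply lsum_le. intros f _. apply Ha0. }
  assert (Hn1' : (length P <= n1)%nat) by (apply INR_le; fold n; lra).
  exists L. split; [|split; [auto|split; [auto|]]].
  - assert (length L <= length (f0 :: P'))%nat.
    { apply NoDup_incl_length; auto. intros f Hf. now apply nodup_In in Hf. }
    cbn [length] in H0. unfold P' in H0. rewrite length_map in H0. lia.
  - apply le_INR in Hn1'. fold n in Hn1'.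
    assert (HAL : Alog * Lam <= C4) by (unfold C4; pose proof (pos_INR n1); lra).
    intros l Hl. eapply Rle_trans; [apply (l2f_of_sum d Hsd l Hl)|].
    assert (E : fsum (fsq d) <= fsum (fun i p => 2 * fsq x i p + 2 * fsq y i p)).
    { apply fsum_le; auto.
      - apply fsummable_plus; now apply fsummable_scal.
      - intros i p. unfold fsq. replace (d i p) with (x i p - y i p) by (unfold x, y; ring).
        pose proof (pow2_ge_0 (x i p + y i p)). nra. }
    rewrite (fsum_plus (fun i p => 2 * fsq x i p)), !fsum_scal in E by (try apply fsummable_scal; auto). lra.
Qed.

(** Subtracting the integer field leaves [psi] unchanged and alters the renormalising term by
    exactly the circulation sum of [energy_moved], so the gradient obtained has no more energy than
    [u]. Its support need not be bounded. *)
Lemma key_compactness psi : psi_hyp psi -> exists K, forall u N, fsupp (grad u) (box N) -> Fe psi (grad u) <= 0 ->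
  exists u', u' xi0 = 0 /\ l2f (grad u') K /\ Fe psi (grad u') <= Fe psi (grad u).
Proof.
  intros H. destruct (moved_charges_bound psi H) as (n0 & C5 & HB).
  destruct (integer_correction n0 C5) as (K & HK0 & HK). exists (2 * C5 + 2 * (K * K)).
  intros u N Hs Hle. destruct (HB u N Hs Hle) as (s & L & HL1 & HL2 & HL3 & Hl2). set (d := dmoved s u) in *.
  destruct (HK d L HL1 HL2 HL3) as (Nf & l & N1 & N2 & N3 & N4); auto.
  { intros f. unfold d. rewrite dmoved_curl. destruct (curl_int (fun p => yhat p + u p) (Tf s f)) as (k & Hk).
    change (curl (strain (fun p => yhat p + u p)) (Tf s f) = IZR k) in Hk. rewrite Hk. unfold ind. destruct face_eq_dec.
    - exists (k - 1)%Z. now rewrite minus_IZR.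
    - exists k. ring. }
  destruct (curl_free_grad (fun i p => d i p - Nf i p)) as (u' & U0 & U1).
  { intros f. rewrite curl_minus, N3. ring. }
  exists u'. split; auto. split.
  - intros k Hk. rewrite (lsum_ext _ (S3 (fsq (fun i p => d i p - Nf i p)))).
    + apply fsq_diff_bound; auto.
    + intros p _. unfold S3, fsq. now rewrite !U1.
  - pose proof (energy_moved psi s u N H Hs) as Hinv. fold d in Hinv.
    eapply Rle_trans; [|apply Hinv]. right.
    assert (HG : fsummable (fun i p => Gd psi i p (d i p))) by (eapply Gd_summable; eauto).
    assert (HcN : fsummable (fun i p => cfield i p * Nf i p)).
    { apply (fsupp_summable _ l). intros i p Hp. apply (N1 i). intros E; apply Hp; rewrite E; ring. }
    unfold Fe. rewrite (fsum_ext _ (fun i p => Gd psi i p (d i p) + Derive_n psi 2 0 * (cfield i p * Nf i p))).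
    2:{ intros i p. rewrite U1. destruct (N2 i p) as (k & ->). now apply psi_Gd_int. }
    rewrite fsum_plus, fsum_scal by (auto; now apply fsummable_scal). f_equal. f_equal.
    unfold cfield. rewrite (sbp_field_fin phi Nf l N1). apply Tsum_ext. intros p. unfold F2. now rewrite !N3.
Qed.

(** * Existence of a minimiser *)

(** Replaces the extraction of subsequences: finitely many coordinates are approached simultaneously
    along arbitrarily large indices. *)
Definition clusters (a : nat -> nat -> R) (vs : list R) : Prop :=
  forall eps, 0 < eps -> forall n0, exists n, (n0 <= n)%nat /\ forall i, (i < length vs)%nat -> Rabs (a n i - nth i vs 0) < eps.

(* The next coordinate is the largest x such that a_n(k) > x infinitely often along the indices at which
   the coordinates already chosen are approached. *)
Lemma clusters_step a vs B : (forall n, Rabs (a n (length vs)) <= B) -> clusters a vs -> exists v, clusters a (vs ++ [v]).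
Proof.
  intros HB HC. set (k := length vs) in *.
  set (close := fun eps n => forall i, (i < k)%nat -> Rabs (a n i - nth i vs 0) < eps).
  set (S := fun x => forall eps, 0 < eps -> forall n0, exists n, (n0 <= n)%nat /\ close eps n /\ x < a n k).
  destruct (completeness S) as (v & Hv1 & Hv2).
  - exists B. intros x Hx. destruct (Hx 1 Rlt_0_1 0%nat) as (n & _ & _ & Hn). specialize (HB n). apply Rabs_le_between in HB. lra.
  - exists (- B - 1). intros eps He n0. destruct (HC eps He n0) as (n & Hn & Hc). exists n. repeat split; auto.
    specialize (HB n). apply Rabs_le_between in HB. lra.
  - exists v. intros eps He n0.
    assert (Hx : exists x, S x /\ v - eps < x).
    { apply NNPP. intros Hno. assert (v <= v - eps); [|lra]. apply Hv2. intros x Hx. apply Rnot_lt_le. intros Hlt. apply Hno; eauto. }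
    destruct Hx as (x & Sx & Hx).
    assert (Hns : ~ S (v + eps / 2)) by (intros HS; specialize (Hv1 _ HS); lra).
    unfold S in Hns. apply not_all_ex_not in Hns. destruct Hns as (e0 & Hns). apply imply_to_and in Hns. destruct Hns as (He0 & Hns).
    apply not_all_ex_not in Hns. destruct Hns as (m0 & Hns).
    destruct (Sx (Rmin eps e0) ltac:(apply Rmin_pos; auto) (n0 + m0)%nat) as (n & Hn & Hc & Hxn).
    exists n. split; [lia|]. intros i Hi. rewrite length_app in Hi. simpl in Hi. fold k in Hi.
    destruct (Nat.eq_dec i k) as [->|Hne].
    + rewrite app_nth2 by (unfold k; lia). unfold k. rewrite Nat.sub_diag. simpl. fold k.
      assert (a n k <= v + eps / 2).
      { apply Rnot_lt_le. intros Hlt. apply Hns. exists n. split; [lia|]. split; auto. intros j Hj.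
        eapply Rlt_le_trans; [apply Hc; auto|apply Rmin_r]. }
      apply Rabs_def1; lra.
    + rewrite app_nth1 by (fold k; lia). eapply Rlt_le_trans; [apply Hc; lia|apply Rmin_l].
Qed.

(** Each coordinate is chosen as a function of the list of the earlier ones; the lists are prefixes
    of one another and define one limit. *)
Lemma cluster_sequence a : (forall i, exists B, forall n, Rabs (a n i) <= B) ->
  exists v : nat -> R, forall k eps, 0 < eps -> forall n0, exists n, (n0 <= n)%nat /\ forall i, (i < k)%nat -> Rabs (a n i - v i) < eps.
Proof.
  intros HB.
  assert (Hst : forall vs, exists v, clusters a vs -> clusters a (vs ++ [v])).
  { intros vs. destruct (classic (clusters a vs)) as [Hc|Hc]; [|exists 0; tauto].
    destruct (HB (length vs)) as (B & HB'). destruct (clusters_step a vs B HB' Hc) as (v & Hv). eauto. }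
  destruct (choice _ Hst) as (f & Hf).
  set (L := fix L k := match k with O => [] | S k => L k ++ [f (L k)] end).
  assert (HLen : forall k, length (L k) = k). { induction k as [|k IH]; simpl; auto. rewrite length_app, IH. simpl. lia. }
  assert (HLc : forall k, clusters a (L k)).
  { induction k as [|k IH]; [|simpl; now apply Hf]. intros eps He n0. exists n0. split; auto. simpl. intros; lia. }
  assert (Hnth : forall k i, (i < k)%nat -> nth i (L k) 0 = f (L i)).
  { induction k as [|k IH]; intros i Hi; [lia|]. simpl. destruct (Nat.eq_dec i k) as [->|Hne].
    - rewrite app_nth2, HLen, Nat.sub_diag by (rewrite HLen; lia). reflexivity.
    - rewrite app_nth1 by (rewrite HLen; lia). apply IH. lia. }
  exists (fun i => f (L i)). intros k eps He n0. destruct (HLc k eps He n0) as (n & Hn & Hc). exists n. split; auto.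
  intros i Hi. rewrite <- (Hnth k i Hi). apply Hc. now rewrite HLen.
Qed.

Definition nat_Z (n : nat) : Z := (Z.of_nat (fst (of_nat n)) - Z.of_nat (snd (of_nat n)))%Z.
Definition nat_site (n : nat) : site := (nat_Z (fst (of_nat n)), nat_Z (snd (of_nat n))).

Lemma nat_Z_surj z : exists n, nat_Z n = z.
Proof. exists (to_nat (Z.to_nat z, Z.to_nat (- z))). unfold nat_Z. rewrite cancel_of_to. simpl. lia. Qed.

Lemma nat_site_surj p : exists n, nat_site n = p.
Proof.
  destruct p as [a b]. destruct (nat_Z_surj a) as (x & <-), (nat_Z_surj b) as (y & <-).
  exists (to_nat (x, y)). unfold nat_site. now rewrite cancel_of_to.
Qed.

Lemma cluster_sites (u : nat -> site -> R) : (forall p, exists B, forall n, Rabs (u n p) <= B) ->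
  exists v : site -> R, forall l eps, 0 < eps -> forall n0, exists n, (n0 <= n)%nat /\ forall p, In p l -> Rabs (u n p - v p) < eps.
Proof.
  intros HB. destruct (choice _ nat_site_surj) as (e & He).
  destruct (cluster_sequence (fun n i => u n (nat_site i))) as (v & Hv); [intros i; apply HB|].
  exists (fun p => v (e p)). intros l eps Heps n0.
  assert (Hk : exists k, forall p, In p l -> (e p < k)%nat).
  { induction l as [|p l (k & Hk)]; [exists 0%nat; intros p []|]. exists (k + S (e p))%nat.
    intros q [<-|Hq]; [lia|]. specialize (Hk q Hq). lia. }
  destruct Hk as (k & Hk). destruct (Hv k eps Heps n0) as (n & Hn & Hc). exists n. split; auto.
  intros p Hp. specialize (Hc (e p) (Hk p Hp)). now rewrite He in Hc.
Qed.

Lemma l2f_pointwise b C i p : l2f b C -> Rabs (b i p) <= 1 + C.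
Proof.
  intros H. specialize (H [p] (NoDup_cons _ (in_nil (a:=p)) (NoDup_nil _))). simpl in H.
  assert (E : b i p ^ 2 <= C).
  { eapply Rle_trans; [apply (S3_comp (fsq b) p i)|lra]. intros; apply pow2_ge_0. }
  rewrite <- pow2_abs in E. pose proof (Rabs_pos (b i p)). nra.
Qed.

(** Walk from [xi0] to [p], each bond changing [u] by at most [1 + K]; the bound depends on [p]. *)
Lemma pointwise_bound K p : exists B, forall u, u xi0 = 0 -> l2f (grad u) K -> Rabs (u p) <= B.
Proof.
  assert (H1 : forall m n, (exists B, forall u, u xi0 = 0 -> l2f (grad u) K -> Rabs (u (m, n)) <= B) <->
                           (exists B, forall u, u xi0 = 0 -> l2f (grad u) K -> Rabs (u (m + 1, n)%Z) <= B)).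
  { intros m n. split; intros (B & HB); exists (B + (1 + K)); intros u H0 Hu; specialize (HB u H0 Hu);
    pose proof (l2f_pointwise _ _ d1 (m, n) Hu) as E; unfold grad, be, bs, sh in E; simpl in E; rewrite Z.add_0_r in E;
    apply Rabs_le_between in E; apply Rabs_le_between in HB; apply Rabs_le; lra. }
  assert (H2 : forall m n, (exists B, forall u, u xi0 = 0 -> l2f (grad u) K -> Rabs (u (m, n)) <= B) <->
                           (exists B, forall u, u xi0 = 0 -> l2f (grad u) K -> Rabs (u (m, n + 1)%Z) <= B)).
  { intros m n. split; intros (B & HB); exists (B + (1 + K)); intros u H0 Hu; specialize (HB u H0 Hu);
    pose proof (l2f_pointwise _ _ d2 (m, n) Hu) as E; unfold grad, be, bs, sh in E; simpl in E; rewrite Z.add_0_r in E;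
    apply Rabs_le_between in E; apply Rabs_le_between in HB; apply Rabs_le; lra. }
  destruct p as [m n]. revert m. apply Z_bi_ind; [|intros; apply H1]. revert n. apply Z_bi_ind; [|intros; apply H2].
  apply (proj1 (H2 0%Z (-1)%Z)). exists 0. intros u H0 _. change (0%Z, (-1)%Z) with xi0. rewrite H0, Rabs_R0. lra.
Qed.

(** On a finite list [l], some [u n] is so close to [v] that the errors in the squares total at most
    1; the factor 2 comes from comparing the squares. *)
Lemma l2f_cluster (u : nat -> site -> R) v K : (forall n, l2f (grad (u n)) K) ->
  (forall l eps, 0 < eps -> forall n0, exists n, (n0 <= n)%nat /\ forall p, In p l -> Rabs (u n p - v p) < eps) ->
  l2f (grad v) (2 * K + 1).
Proof.
  intros Hu Hv l Hl. set (e := / (24 * INR (length l) + 24)).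
  assert (Hlen := pos_INR (length l)). assert (He : 0 < e <= 1).
  { unfold e. split; [apply Rinv_0_lt_compat; lra|]. rewrite <- Rinv_1. apply Rinv_le_contravar; lra. }
  destruct (Hv (nbhd l) e (proj1 He) 0%nat) as (n & _ & Hn).
  apply Rle_trans with (lsum (fun p => 2 * S3 (fsq (grad (u n))) p + 24 * e) l).
  - apply lsum_le. intros p Hp. destruct (nbhd_cases l p Hp) as (N0 & N1 & N2 & _).
    assert (A : forall i, (grad v i p) ^ 2 <= 2 * grad (u n) i p ^ 2 + 8 * e).
    { intros i. assert (B1 : Rabs (u n (be i p) - v (be i p)) < e) by (apply Hn; destruct i; simpl; auto).
      assert (B2 : Rabs (u n (bs i p) - v (bs i p)) < e) by (apply Hn; destruct i; simpl; auto).
      assert (B3 : Rabs (grad v i p - grad (u n) i p) <= 2 * e).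
      { unfold grad. apply Rabs_def2 in B1. apply Rabs_def2 in B2. apply Rabs_le. lra. }
      apply abs_le_sq in B3. set (x := grad v i p) in *. set (y := grad (u n) i p) in *.
      pose proof (pow2_ge_0 (x - 2 * y)). nra. }
    unfold S3, fsq. pose proof (A d1); pose proof (A d2); pose proof (A d3). lra.
  - rewrite lsum_plus, lsum_scal, lsum_const. specialize (Hu n l Hl).
    assert (24 * e * INR (length l) <= 1); [|lra].
    unfold e. apply (Rmult_le_reg_r (24 * INR (length l) + 24)); [lra|].
    replace (24 * / (24 * INR (length l) + 24) * INR (length l) * (24 * INR (length l) + 24)) with (24 * INR (length l)) by (field; lra). lra.
Qed.

(** The substitute for nonnegativity in Fatou: by [Gd_lower] the cells outside [box N] contribute at
    least [- C / w^4 - (C / N) b^2] per bond, which is small uniformly in [b]. *)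
Lemma Fe_lower_bound_tail psi : psi_hyp psi -> forall K eps, 0 < eps -> exists N0, forall N b, (N0 <= N)%nat -> l2f b K ->
  lsum (S3 (fun i p => Gd psi i p (b i p))) (box N) - eps <= Fe psi b.
Proof.
  intros H K eps He. destruct (Gd_lower psi H) as (C & PC & QC).
  destruct (Tsum_tail (S3 (fun _ p => C * / w p ^ 4)) (eps / 2)) as (l0 & L1 & L2); [apply summable_S3, fsummable_scal, fsummable_w4|lra|].
  destruct (in_some_box l0) as (N1 & HN1).
  destruct (INR_unbounded (1 + 2 * C * (Rabs K + 1) / eps)) as (N2 & HN2).
  exists (N1 + N2)%nat. intros N b HN Hb.
  assert (HNr : 1 + 2 * C * (Rabs K + 1) / eps < INR N) by (eapply Rlt_le_trans; [exact HN2|apply le_INR; lia]).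
  assert (HK1 := Rabs_pos K). assert (Hq : 0 < 2 * C * (Rabs K + 1) / eps) by (apply Rdiv_lt_0_compat; [apply Rmult_lt_0_compat; lra|auto]).
  set (g := S3 (fun i p => Gd psi i p (b i p))).
  apply (Tsum_ge g (box N)); [apply summable_S3; eapply Gd_summable; eauto|].
  intros k Hk Hi. rewrite (lsum_split_site g (box N) k).
  assert (E1 : lsum g (filter (insl (box N)) k) = lsum g (box N)).
  { apply lsum_perm, NoDup_Permutation; [now apply NoDup_filter|apply box_NoDup|]. intros p. rewrite insl_In. split; [tauto|]. split; auto. }
  rewrite E1. set (r := filter (outl (box N)) k).
  assert (Hr : NoDup r) by now apply NoDup_filter.
  assert (E2 : - lsum (S3 (fun _ p => C * / w p ^ 4)) r - C / INR N * lsum (S3 (fsq b)) r <= lsum g r).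
  { assert (E3 : lsum (fun p => -1 * S3 (fun _ p => C * / w p ^ 4) p + (- (C / INR N)) * S3 (fsq b) p) r <= lsum g r).
    { apply lsum_le. intros p Hp. apply outl_In in Hp. destruct Hp as (_ & Hp). apply w_out_box in Hp.
      assert (E : forall i, - (C * / w p ^ 4) - C / INR N * b i p ^ 2 <= Gd psi i p (b i p)).
      { intros i. eapply Rle_trans; [|apply QC]. assert (C / w p <= C / INR N).
        { unfold Rdiv. apply Rmult_le_compat_l; [lra|]. apply Rinv_le_contravar; lra. }
        pose proof (pow2_ge_0 (b i p)). unfold Rdiv in *. nra. }
      unfold g, S3, fsq. pose proof (E d1); pose proof (E d2); pose proof (E d3). lra. }
    rewrite lsum_plus, !lsum_scal in E3. lra. }
  assert (E4 : lsum (S3 (fun _ p => C * / w p ^ 4)) r <= eps / 2).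
  { eapply Rle_trans; [|apply (L2 r Hr)].
    - apply lsum_le. intros; apply Rle_abs.
    - intros p Hp Hp0. apply outl_In in Hp. apply (proj2 Hp). apply (box_incl N1); [lia|]. now apply HN1. }
  assert (E5 : C / INR N * lsum (S3 (fsq b)) r <= eps / 2).
  { apply Rle_trans with (C / INR N * (Rabs K + 1)).
    - apply Rmult_le_compat_l; [apply Rdiv_le_0_compat; lra|]. pose proof (Hb r Hr). pose proof (Rle_abs K). lra.
    - apply (Rmult_le_reg_r (2 * INR N / eps)); [apply Rdiv_lt_0_compat; lra|].
      replace (C / INR N * (Rabs K + 1) * (2 * INR N / eps)) with (2 * C * (Rabs K + 1) / eps) by (field; lra).
      replace (eps / 2 * (2 * INR N / eps)) with (INR N) by (field; lra). lra. }
  lra.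
Qed.

(** On a large box the energies of [u n] and [v] are close, and outside it [u n] has little negative
    energy. One well chosen index per [eps] is enough. *)
Lemma Fe_lsc psi (u : nat -> site -> R) v K I : psi_hyp psi -> (forall n, l2f (grad (u n)) K) ->
  (forall l eps, 0 < eps -> forall n0, exists n, (n0 <= n)%nat /\ forall p, In p l -> Rabs (u n p - v p) < eps) ->
  (forall eps, 0 < eps -> exists n0, forall n, (n0 <= n)%nat -> Fe psi (grad (u n)) <= I + eps) ->
  Fe psi (grad v) <= I.
Proof.
  intros H Hu Hv HI. pose proof (l2f_cluster u v K Hu Hv) as Hlv.
  apply le_epsilon. intros eps He.
  destruct (Fe_lower_bound_tail psi H K (eps / 4)) as (N1 & HN1); [lra|].
  assert (HG : fsummable (fun i p => Gd psi i p (grad v i p))) by (eapply Gd_summable; eauto).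
  destruct (Tsum_box_lim (S3 (fun i p => Gd psi i p (grad v i p))) (eps / 4) (summable_S3 _ HG)) as (N2 & HN2); [lra|].
  set (N := (N1 + N2)%nat).
  destruct (Gd_continuous_list psi H (grad v) (box N) (eps / 4)) as (dl & Pd & Qd); [lra|].
  destruct (HI (eps / 4)) as (n0 & Hn0); [lra|].
  destruct (Hv (nbhd (box N)) (dl / 2) ltac:(lra) n0) as (n & Hn & Hc).
  specialize (HN1 N (grad (u n)) ltac:(lia) (Hu n)). specialize (HN2 N ltac:(lia)). specialize (Hn0 n Hn).
  specialize (Qd (grad (u n))).
  assert (Hd : lsum (fun p => Rabs (S3 (fun i p => Gd psi i p (grad (u n) i p)) p - S3 (fun i p => Gd psi i p (grad v i p)) p)) (box N) <= eps / 4).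
  { apply Qd. intros i p Hp. destruct (nbhd_cases (box N) p Hp) as (M0 & M1 & M2 & _).
    assert (B1 : Rabs (u n (be i p) - v (be i p)) < dl / 2) by (apply Hc; destruct i; simpl; auto).
    assert (B2 : Rabs (u n (bs i p) - v (bs i p)) < dl / 2) by (apply Hc; destruct i; simpl; auto).
    unfold grad. apply Rabs_def2 in B1. apply Rabs_def2 in B2. apply Rabs_le. lra. }
  assert (Hd2 := lsum_abs (fun p => S3 (fun i p => Gd psi i p (grad (u n) i p)) p - S3 (fun i p => Gd psi i p (grad v i p)) p) (box N)).
  rewrite lsum_minus in Hd2. assert (Hd3 := Rle_trans _ _ _ Hd2 Hd). apply Rabs_le_between in Hd3.
  fold (fsum (fun i p => Gd psi i p (grad v i p))) in HN2. fold (Fe psi (grad v)) in HN2. apply Rabs_def2 in HN2. lra.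
Qed.

Lemma E_ext_Fe psi v : psi_hyp psi -> W12 v -> E_ext_value psi v (2 * Fe psi (grad v)).
Proof.
  intros H Hv eps He. destruct (W12_l2f v Hv) as (C & HC).
  destruct (Fe_continuous psi (grad v) C (eps / 2) H HC) as (dl & Pd & Qd); [lra|].
  (* [l2norm_small] returns the square of the radius, which is at most [dl] for this choice. *)
  exists (Rmin 1 dl). assert (Hm : 0 < Rmin 1 dl) by (apply Rmin_pos; lra). split; auto.
  intros x Hx Hn e Hee. destruct (W0_supp x Hx) as (N & HN). pose proof (l2f_fin _ _ (box_NoDup N) HN) as Hlx.
  rewrite (E0_Fe psi x e H Hx Hee).
  pose proof (l2norm_small x v _ _ _ Hlx HC Hm Hn) as Hd.
  assert (Hd' : l2f (fun i p => grad x i p - grad v i p) dl).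
  { intros l Hl. eapply Rle_trans; [apply (Hd l Hl)|]. pose proof (Rmin_l 1 dl). pose proof (Rmin_r 1 dl). nra. }
  specialize (Qd (grad x) _ Hlx Hd'). apply Rabs_def2 in Qd. apply Rabs_def1; lra.
Qed.

Lemma Fe_abs_bound psi : psi_hyp psi -> exists C, forall b K, l2f b K -> Rabs (Fe psi b) <= C * (K + 48).
Proof.
  intros H. destruct (Gd_upper psi H) as (C & PC & QC). exists C. intros b K Hb.
  assert (HG : fsummable (fun i p => Gd psi i p (b i p))) by (eapply Gd_summable; eauto).
  assert (Hs1 : fsummable (fsq b)) by (eapply l2f_fsummable; eauto).
  eapply Rle_trans; [apply (fsum_abs _ HG)|].
  assert (Hs2 : fsummable (fun i p => fsq b i p + / w p ^ 4)) by (apply fsummable_plus; auto using fsummable_w4).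
  eapply Rle_trans; [apply (fsum_le _ (fun i p => C * (fsq b i p + / w p ^ 4)))|].
  - intros i. apply summable_abs, HG.
  - now apply fsummable_scal.
  - intros; apply QC.
  - rewrite fsum_scal, fsum_plus by auto using fsummable_w4. apply Rmult_le_compat_l; [lra|].
    pose proof (l2f_sum b K Hb). pose proof (fsum_w4_le 1 ltac:(lra)).
    rewrite (fsum_ext _ (fun _ p => / w p ^ 4)) in H1 by (intros; ring). lra.
Qed.

Lemma W0_zero : W0 (fun _ => 0).
Proof. split; auto. exists 0. intros p q _ Hn. exfalso. apply Hn. unfold D. ring. Qed.

Lemma Fe_zero psi : psi_hyp psi -> Fe psi (grad (fun _ => 0)) = 0.
Proof.
  intros H. rewrite (Fe_W0 psi _ nil H); [reflexivity|constructor|]. intros i p Hp. exfalso. apply Hp. unfold grad. ring.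
Qed.

Theorem theorem4p5 (psi : R -> R) (Hpsi : psi_hyp psi) :
  exists u : site -> R, W12 u /\
    exists Lu, E_ext_value psi u Lu /\
      forall v : site -> R, W12 v ->
        exists Lv, E_ext_value psi v Lv /\ Lu <= Lv.
Proof.
  destruct (key_compactness psi Hpsi) as (K & HK). destruct (Fe_abs_bound psi Hpsi) as (C & HC).
  (* The infimum over [W0], as minus a supremum. It is finite because a competitor of nonpositive
     energy is beaten or matched by one of l2 bound [K]. *)
  destruct (completeness (fun x => exists u, W0 u /\ x = - Fe psi (grad u))) as (s & Hs1 & Hs2).
  { exists (Rmax 0 (C * (K + 48))). intros x (u & Hu & ->). destruct (W0_supp u Hu) as (N & HN).
    destruct (Rle_dec (Fe psi (grad u)) 0) as [Hle|Hle].
    - destruct (HK u N HN Hle) as (u' & _ & Hl & Hf). specialize (HC _ _ Hl). apply Rabs_le_between in HC.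
      eapply Rle_trans; [|apply Rmax_r]. lra.
    - eapply Rle_trans; [|apply Rmax_l]. lra. }
  { exists 0, (fun _ => 0). split; [apply W0_zero|]. rewrite Fe_zero by auto. ring. }
  set (I := - s).
  assert (HI : forall u, W0 u -> I <= Fe psi (grad u)).
  { intros u Hu. assert (- Fe psi (grad u) <= s) by (apply Hs1; eauto). unfold I. lra. }
  assert (Hmin : forall n : nat, exists u, u xi0 = 0 /\ l2f (grad u) K /\ Fe psi (grad u) <= I + / (INR n + 1)).
  { intros n. assert (Hn : 0 < / (INR n + 1)) by (apply Rinv_0_lt_compat; pose proof (pos_INR n); lra).
    assert (Hex : exists u, W0 u /\ Fe psi (grad u) <= I + / (INR n + 1) /\ Fe psi (grad u) <= 0).
    { assert (Hex : exists u, W0 u /\ Fe psi (grad u) <= I + / (INR n + 1)).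
      { apply NNPP. intros Hno. assert (s <= s - / (INR n + 1)); [|lra]. apply Hs2. intros x (u & Hu & ->).
        apply Rnot_lt_le. intros Hlt. apply Hno. exists u. split; auto. unfold I. lra. }
      (* [key_compactness] asks for nonpositive energy; if the near-minimiser has positive energy,
         the zero displacement is better. *)
      destruct Hex as (u & Hu & Hle). destruct (Rle_dec (Fe psi (grad u)) 0) as [Hl|Hl]; [exists u; auto|].
      exists (fun _ => 0). rewrite Fe_zero by auto. split; [apply W0_zero|lra]. }
    destruct Hex as (u & Hu & H1 & H2). destruct (W0_supp u Hu) as (N & HN).
    destruct (HK u N HN H2) as (u' & U0 & U1 & U2). exists u'. repeat split; auto. lra. }
  destruct (choice _ Hmin) as (u & Hu).
  destruct (cluster_sites u) as (v & Hv).
  { intros p. destruct (pointwise_bound K p) as (B & HB). exists B. intros n. apply HB; apply Hu. }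
  assert (Hlv : l2f (grad v) (2 * K + 1)) by (apply (l2f_cluster u); auto; intros n; apply Hu).
  assert (Hv0 : v xi0 = 0).
  { destruct (Req_dec (v xi0) 0) as [|Hne]; auto. exfalso.
    destruct (Hv [xi0] (Rabs (v xi0)) (Rabs_pos_lt _ Hne) 0%nat) as (n & _ & Hn). specialize (Hn xi0 (or_introl eq_refl)).
    rewrite (proj1 (Hu n)), Rminus_0_l, Rabs_Ropp in Hn. lra. }
  assert (HFv : Fe psi (grad v) <= I).
  { apply (Fe_lsc psi u v K I Hpsi); auto; [intros n; apply Hu|].
    intros eps He. destruct (INR_unbounded (/ eps)) as (n0 & Hn0). exists n0. intros n Hn.
    eapply Rle_trans; [apply Hu|]. apply Rplus_le_compat_l. apply le_INR in Hn.
    assert (0 < / eps) by now apply Rinv_0_lt_compat. rewrite <- (Rinv_inv eps). apply Rinv_le_contravar; lra. }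
  assert (HW : W12 v) by now apply (l2f_W12 v (2 * K + 1)).
  exists v. split; auto. exists (2 * Fe psi (grad v)). split; [now apply E_ext_Fe|].
  intros x Hx.
  destruct (classic (forall dl, 0 < dl -> exists y, W0 y /\ l2norm (fun p q => D y p q - D x p q) < dl)) as [Hdense|Hno].
  - exists (2 * Fe psi (grad x)). split; [now apply E_ext_Fe|].
    (* A value at [x] below that of [v] would persist, by continuity, at some [y] in [W0], below the
       infimum [I]. *)
    apply Rnot_lt_le. intros Hlt. destruct (W12_l2f x Hx) as (Cx & HCx).
    destruct (Fe_continuous psi (grad x) Cx (Fe psi (grad v) - Fe psi (grad x)) Hpsi HCx) as (dl & Pd & Qd); [lra|].
    assert (Hm : 0 < Rmin 1 dl) by (apply Rmin_pos; lra).
    destruct (Hdense (Rmin 1 dl) Hm) as (y & Hy & Hn).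
    destruct (W0_supp y Hy) as (N & HN). pose proof (l2f_fin _ _ (box_NoDup N) HN) as Hly.
    pose proof (l2norm_small y x _ _ _ Hly HCx Hm Hn) as Hd.
    assert (Hd' : l2f (fun i p => grad y i p - grad x i p) dl).
    { intros l Hl. eapply Rle_trans; [apply (Hd l Hl)|]. pose proof (Rmin_l 1 dl). pose proof (Rmin_r 1 dl). nra. }
    specialize (Qd (grad y) _ Hly Hd'). apply Rabs_def2 in Qd. specialize (HI y Hy). lra.
  - (* Density of W0 rules this case out, but its proof is not needed: if x is not in the closure of W0,
       every real is an extension value at x. *)
    exists (2 * Fe psi (grad v)). split; [|lra]. intros eps He.
    apply not_all_ex_not in Hno. destruct Hno as (dl & Hno). apply imply_to_and in Hno. destruct Hno as (Pd & Hno).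
    exists dl. split; auto. intros y Hy Hn. exfalso. apply Hno. eauto.
Qed.
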